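(* Let $N\geq 1$ be an integer and let $R_N(z)$ be the remainder function defined in the context. Then, for $|\arg z|<\frac{\pi}{2}$, \[ R_N(z)=\frac{1}{z^{2N}}\frac{(-1)^{N+1}}{\pi}\int_0^{+\infty}\left(\int_0^1\frac{s^{2N-1}}{1+(st/z)^2}\,ds\right)t^{2N}\log\left(1-e^{-2\pi t}\right)dt \] and \[ R_N(z)=\frac{1}{z^{2N}}\frac{(-1)^{N}}{2\pi^2}\int_0^{+\infty}\frac{t^{2N-1}}{1+(t/z)^2}\,\mathrm{Li}_2\left(e^{-2\pi t}\right)dt . \] Moreover, for $|\arg z|<\pi$, \[ R_N(z)=-\frac{1}{2N(2N+1)}\int_0^{+\infty}\frac{B_{2N+1}(t-\lfloor t\rfloor)}{(t+z)^{2N}}\,dt \] and \[ R_N(z)=-\frac{1}{(2N+1)(2N+2)}\int_0^{+\infty}\frac{B_{2N+2}+B_{2N+2}(t-\lfloor t\rfloor)}{(t+z)^{2N+1}}\,dt . \]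
   Context: $B_n(x)$ denotes the $n$th Bernoulli polynomial and $B_n=B_n(0)$ the $n$th Bernoulli number. The dilogarithm is $\mathrm{Li}_2(w)=\sum_{n=1}^\infty w^n/n^2$ for $|w|\le 1$. $z$ is a nonzero complex number, and $\arg z$ and $\log z$ denote principal values. The Barnes $G$-function is the entire function given by \[ G(z+1)=(2\pi)^{z/2}e^{-[z(z+1)+\gamma z^2]/2}\prod_{n=1}^\infty\left[\left(1+\frac{z}{n}\right)^n e^{-z+z^2/(2n)}\right], \] where $\gamma$ is the Euler–Mascheroni constant. For $|\arg z|<\pi$, $\log G(z+1)$ and $\log\Gamma(z+1)$ denote the analytic branches on $\mathbb{C}\setminus(-\infty,0]$ that are real for $z>0$. The Glaisher–Kinkelin constant $A$ is given by $\log A=\frac{1}{12}-\zeta'(-1)$, where $\zeta$ is the Riemann zeta function. For $|\arg z|<\pi$ and $N\ge 1$ the remainder $R_N(z)$ is defined by \[ \log G(z+1)=\frac14 z^2+z\log\Gamma(z+1)-\left(\frac12 z(z+1)+\frac1{12}\right)\log z-\log A+\sum_{n=1}^{N-1}\frac{B_{2n+2}}{2n(2n+1)(2n+2)z^{2n}}+R_N(z), \] where empty sums are zero.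
   Formalization: In the fourth formula the integrand's numerator is taken as B_{2N+2}(t-⌊t⌋) - B_{2N+2}; the printed plus sign contradicts the third formula, since the two would differ by a nonzero multiple of B_{2N+2}/z^{2N}. *)

(* Defs.v *)
From Stdlib Require Import Reals.
From Coquelicot Require Import Coquelicot.
Open Scope R_scope.

(** * Complex exponential, principal argument and principal logarithm *)

Definition Cexp (z : C) : C := (exp (Re z) * cos (Im z), exp (Re z) * sin (Im z)).

(* Values in (-PI, PI], with Carg z = PI on the negative real axis;
   meaningless at z = 0. *)
Definition Carg (z : C) : R :=
  if Rle_dec 0 (Im z) then acos (Re z / Cmod z) else - acos (Re z / Cmod z).

Definition Clog (z : C) : C := (ln (Cmod z), Carg z).

(** * Limits, series and products of complex sequences *)

Definition CLim_seq (u : nat -> C) : C :=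
  (real (Lim_seq (fun n => Re (u n))), real (Lim_seq (fun n => Im (u n)))).

Definition CSeries (a : nat -> C) : C :=
  (Series (fun n => Re (a n)), Series (fun n => Im (a n))).

(* u 1 * ... * u n *)
Fixpoint Cprod (u : nat -> C) (n : nat) : C :=
  match n with
  | O => RtoC 1
  | S m => (Cprod u m * u (S m))%C
  end.

(* The product of the u n over n >= 1. *)
Definition Cinfprod (u : nat -> C) : C := CLim_seq (Cprod u).

(** * Analytic functions *)

Definition analytic_at (f : C -> C) (z0 : C) : Prop :=
  exists (a : nat -> C) (r : R), 0 < r /\
    forall z : C, Cmod (z - z0) < r ->
      is_pseries (K := C_AbsRing) (V := C_NormedModule) a (z - z0)%C (f z).

(* The complement of (-oo, 0]. *)
Definition slit_plane (z : C) : Prop := ~ (Im z = 0 /\ Re z <= 0).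

(* f is the analytic branch of log F on the slit plane that is real on
   (0, +oo). *)
Definition is_log_branch (F f : C -> C) : Prop :=
  (forall z : C, slit_plane z -> analytic_at f z /\ Cexp (f z) = F z) /\
  (forall x : R, 0 < x -> Im (f (RtoC x)) = 0).

(** * Bernoulli numbers and polynomials *)

(* bernoulli_upto n k is the k-th Bernoulli number for k <= n; it is computed by
   B_0 = 1 and sum_(0 <= j <= n) binom(n+1, j) B_j = 0 for n >= 1. *)
Fixpoint bernoulli_upto (n : nat) : nat -> R :=
  match n with
  | O => fun _ => 1
  | S m => fun k =>
      if Nat.leb k m then bernoulli_upto m k
      else - sum_f_R0 (fun j => Binomial.C (m + 2) j * bernoulli_upto m j) m
             / INR (m + 2)
  end.

Definition bernoulli (n : nat) : R := bernoulli_upto n n.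

Definition bernoulli_poly (n : nat) (x : R) : R :=
  sum_f_R0 (fun k => Binomial.C n k * bernoulli k * x ^ (n - k)) n.

(** * Special functions and constants *)

Definition Li2 (w : C) : C :=
  CSeries (fun n => (w ^ S n / RtoC (INR (S n) ^ 2))%C).

Definition euler_gamma : R :=
  real (Lim_seq (fun n => sum_f_R0 (fun k => / INR (S k)) n - ln (INR (S n)))).

(* Weierstrass product. *)
Definition Gamma (z : C) : C :=
  (/ (z * Cexp (RtoC euler_gamma * z) *
      Cinfprod (fun n => (1 + z / RtoC (INR n)) * Cexp (- z / RtoC (INR n)))))%C.

(* Product formula for G(z+1) with z = w - 1. *)
Definition BarnesG (w : C) : C :=
  let z := (w - 1)%C in
  (Cexp (z / 2 * RtoC (ln (2 * PI))) *
   Cexp (- (z * (z + 1) + RtoC euler_gamma * z ^ 2) / 2) *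
   Cinfprod (fun n => (1 + z / RtoC (INR n)) ^ n *
                      Cexp (- z + z ^ 2 / (2 * RtoC (INR n)))))%C.

(* zeta is analytic off 1 and agrees with the Dirichlet series for Re s > 1.
   These conditions determine its values off 1. *)
Definition is_riemann_zeta (zeta : C -> C) : Prop :=
  (forall s : C, s <> RtoC 1 -> analytic_at zeta s) /\
  (forall s : C, 1 < Re s ->
     is_series (K := C_AbsRing) (V := C_NormedModule)
       (fun n => Cexp (- s * RtoC (ln (INR (S n))))%C) (zeta s)).

(* log A = 1/12 - zeta'(-1) *)
Definition is_glaisher (A : R) : Prop :=
  0 < A /\
  exists (zeta : C -> C) (d : C),
    is_riemann_zeta zeta /\
    is_derive (K := C_AbsRing) (V := C_NormedModule) zeta (RtoC (-1)) d /\
    RtoC (ln A) = (RtoC (1 / 12) - d)%C.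

(** * The remainder *)

(* logG and logGamma stand for z |-> log G(z+1) and z |-> log Gamma(z+1). *)
Definition barnes_remainder (A : R) (logG logGamma : C -> C) (N : nat) (z : C) : C :=
  (logG z -
   (RtoC (1 / 4) * z ^ 2 + z * logGamma z
    - (RtoC (1 / 2) * z * (z + 1) + RtoC (1 / 12)) * Clog z
    - RtoC (ln A)
    + sum_n_m (G := C_AbelianMonoid)
        (fun n => RtoC (bernoulli (2 * n + 2)) /
                  (RtoC (INR (2 * n) * INR (2 * n + 1) * INR (2 * n + 2))
                   * z ^ (2 * n)))
        1 (N - 1)))%C.

(* The improper integral of f over (0, +oo) converges and its value is I. *)
Definition is_Cint_0_infty (f : R -> C) (I : C) : Prop :=
  is_RInt_gen (V := C_R_NormedModule) f (at_point 0) (Rbar_locally p_infty) I.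

(* Main.v *)
Require Import Defs.
From Stdlib Require Import Reals.
From Stdlib Require Import Lra Lia Classical Factorial.
From Coquelicot Require Import Coquelicot.
Open Scope R_scope.

(** The proof computes log Gamma(z+1) and log G(z+1) by Euler-Maclaurin summation and
    then transforms the integral that is left over.

    The partial Weierstrass products have logarithms made of the sums of (n+z) log(n+z),
    log(n+z), n log n, log n and 1/n over n <= m. The Euler-Maclaurin formula of order
    three ([euler_maclaurin]) evaluates each of them up to o(1); the remainders converge
    to the kernel integrals of B_3({t}) against (t+z)^(-q). The divergent parts cancel
    ([lgamma_lim], [lbarnes_lim]), and the exponentials of the limits are the values of
    Gamma and G ([Gamma_val], [BarnesG_val]). The limits are continuous along the segment
    from 1 to z and real at 1, hence they are the required branches of the logarithms
    ([branch_unique], [logGamma_value], [logG_value]).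

    Three constants enter. The constant of the harmonic sum is gamma by definition. That
    of log m! comes from Wallis' product ([stirling_lim]). That of the sum of n log n has
    to be log A, that is, it has to be found from zeta'(-1): the function zeta is only known
    to be analytic off 1 and to equal its series for Re s > 1, where Euler-Maclaurin
    represents it by an integral that converges for Re s > -2 and is analytic there
    ([zeta_half_plane], [analytic_zval]). The identity theorem along a line from -1 that
    avoids the pole extends the representation ([identity_line], [zeta_defect_zero]), and
    differentiating at -1 gives the constant ([zeta_derive_m1], [glaisher_value]).

    The outcome is R_1(z) as the kernel integral of B_3({t}) against (t+z)^(-2). Integrating
    by parts twice ([kint_parts]) lowers the remainder by exactly one term of the asymptotic
    series, as the Bernoulli numbers of odd index at least 3 vanish. This is the third
    formula for all N ([remainder_kint]); one more integration by parts, with the constant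
    B_{2N+2} integrated explicitly ([kint_0]), gives the fourth.

    In the right half-plane insert the Fourier series of B_3({t}) into R_1(z). It converges
    uniformly at a known rate ([fourier_gap_bound]); this is proved from the Dirichlet
    kernel at level 1 by climbing to higher levels with the mean value theorem. Each sine
    integral equals a Laplace integral of t/(z^2+t^2), which is the classical rotation of the
    path of integration, replaced here by a differential equation in the base point
    ([rotated_integral], [sine_integral]). The Laplace kernels add up to the dilogarithm:
    this is the second formula for N = 1 ([kval_dilog]). Passing from N to N+1 subtracts a
    moment of the dilogarithm, an even zeta value, and Euler's evaluation of it turns the
    moment into the next term of the asymptotic series ([dilog_moment], [remainder_dilog]).
    Finally the inner integral of the first formula is, after the substitution u = st, an
    antiderivative of the kernel of the second, and integrating by parts termwise replaces
    the dilogarithm by the logarithm ([inner_integral], [log_integral]).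

    Complex functions of a real variable are handled by components; improper integrals are
    limits of integrals over [0, T], with domination by c/(1+t)^2 as the criterion for
    convergence and for termwise integration. *)

(** * Calculus of complex-valued functions of a real variable *)

(* The carriers of normed modules over R must be seen as R by ring and field. *)
Ltac to_R := match goal with |- @eq _ ?a ?b => change (@eq R a b) end.

Lemma C_ext (a b : C) : Re a = Re b -> Im a = Im b -> a = b.
Proof. destruct a, b; simpl; intros; subst; reflexivity. Qed.

Lemma Cmod_Rabs_le (z : C) : Cmod z <= Rabs (Re z) + Rabs (Im z).
Proof.
  unfold Cmod. apply Rsqr_incr_0_var; [|generalize (Rabs_pos (Re z)) (Rabs_pos (Im z)); lra].
  rewrite Rsqr_sqrt; [|nra]. unfold Rsqr.
  rewrite <- (pow2_abs (fst z)), <- (pow2_abs (snd z)). fold (Re z) (Im z).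
  generalize (Rabs_pos (Re z)) (Rabs_pos (Im z)); nra.
Qed.

Lemma im_le_Cmod (c : C) : Rabs (Im c) <= Cmod c.
Proof.
  generalize (Rmax_Cmod c). intros H. eapply Rle_trans; [|exact H].
  apply Rmax_r.
Qed.

Lemma Re_minus_le (a b : C) : Rabs (Re a - Re b) <= Cmod (a - b).
Proof. replace (Re a - Re b) with (Re (a - b)) by (destruct a, b; reflexivity). apply re_le_Cmod. Qed.

Lemma Im_minus_le (a b : C) : Rabs (Im a - Im b) <= Cmod (a - b).
Proof. replace (Im a - Im b) with (Im (a - b)) by (destruct a, b; reflexivity). apply im_le_Cmod. Qed.

Lemma Cmod_minus_sym (a b : C) : Cmod (a - b) = Cmod (b - a).
Proof. rewrite <- Cmod_opp. f_equal. ring. Qed.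

Lemma Cmod_rev_triangle (a b : C) : Cmod a - Cmod b <= Cmod (a + b).
Proof.
  assert (H := Cmod_triangle (a + b) (- b)). rewrite Cmod_opp in H.
  replace (a + b + - b)%C with a in H by ring. lra.
Qed.

Lemma Re_RtoC_mult (r : R) (z : C) : Re (RtoC r * z) = r * Re z.
Proof. unfold Re; simpl; ring. Qed.
Lemma Im_RtoC_mult (r : R) (z : C) : Im (RtoC r * z) = r * Im z.
Proof. unfold Im; simpl; ring. Qed.

(** Derivatives, continuity and integrals are taken componentwise, so that every
    rule reduces to its real counterpart. *)
Definition cder (f : R -> C) (t : R) (l : C) : Prop :=
  is_derive (fun u => Re (f u)) t (Re l) /\ is_derive (fun u => Im (f u)) t (Im l).

Definition ccont (f : R -> C) (t : R) : Prop :=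
  continuous (fun u => Re (f u)) t /\ continuous (fun u => Im (f u)) t.

Definition cint (f : R -> C) (a b : R) (I : C) : Prop :=
  is_RInt (fun u => Re (f u)) a b (Re I) /\ is_RInt (fun u => Im (f u)) a b (Im I).

Lemma cder_eq f t l l' : cder f t l -> l = l' -> cder f t l'.
Proof. intros H E; subst; exact H. Qed.

Lemma cder_ext f g t l : (forall u, f u = g u) -> cder f t l -> cder g t l.
Proof.
  intros E [H1 H2]; split; eapply is_derive_ext; [|exact H1| |exact H2];
    intros u; simpl; now rewrite E.
Qed.

Lemma cder_ext_loc f g t l :
  locally t (fun u => f u = g u) -> cder f t l -> cder g t l.
Proof.
  intros E [H1 H2]; split; eapply is_derive_ext_loc; [|exact H1| |exact H2];
    eapply filter_imp; [|exact E| |exact E]; intros u Hu; simpl; now rewrite Hu.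
Qed.

Lemma cder_const c t : cder (fun _ => c) t 0.
Proof. split; simpl; apply (is_derive_const (K := R_AbsRing) (V := R_NormedModule)). Qed.

Lemma cder_R g t l : is_derive g t l -> cder (fun u => RtoC (g u)) t (RtoC l).
Proof.
  intros H; split; simpl; [exact H|].
  apply (is_derive_const (K := R_AbsRing) (V := R_NormedModule)).
Qed.

Lemma cder_id t : cder (fun u => RtoC u) t 1.
Proof. apply cder_R, (is_derive_id (K := R_AbsRing)). Qed.

Lemma cder_plus f g t l m : cder f t l -> cder g t m ->
  cder (fun u => f u + g u)%C t (l + m)%C.
Proof.
  intros [H1 H2] [H3 H4]; split; simpl;
    apply (is_derive_plus (K := R_AbsRing) (V := R_NormedModule)); assumption.
Qed.

Lemma cder_opp f t l : cder f t l -> cder (fun u => - f u)%C t (- l)%C.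
Proof.
  intros [H1 H2]; split; simpl;
    apply (is_derive_opp (K := R_AbsRing) (V := R_NormedModule)); assumption.
Qed.

Lemma cder_minus f g t l m : cder f t l -> cder g t m ->
  cder (fun u => f u - g u)%C t (l - m)%C.
Proof. intros H1 H2. apply cder_plus; [exact H1|]. apply cder_opp, H2. Qed.

Lemma is_derive_Rconst (c x : R) : is_derive (fun _ : R => c) x 0.
Proof. apply (is_derive_const (K := R_AbsRing) (V := R_NormedModule)). Qed.

Lemma is_derive_Rmult (f g : R -> R) t l m : is_derive f t l -> is_derive g t m ->
  is_derive (fun u => f u * g u) t (l * g t + f t * m).
Proof.
  intros H1 H2.
  apply (is_derive_mult f g t l m H1 H2). intros; apply Rmult_comm.
Qed.

Lemma is_derive_Rplus (f g : R -> R) t l m : is_derive f t l -> is_derive g t m ->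
  is_derive (fun u => f u + g u) t (l + m).
Proof. apply (is_derive_plus (K := R_AbsRing) (V := R_NormedModule)). Qed.

Lemma is_derive_Rminus (f g : R -> R) t l m : is_derive f t l -> is_derive g t m ->
  is_derive (fun u => f u - g u) t (l - m).
Proof. apply (is_derive_minus (K := R_AbsRing) (V := R_NormedModule)). Qed.

Lemma ex_derive_Rcontinuous (f : R -> R) t : ex_derive f t -> continuous f t.
Proof. apply (ex_derive_continuous (K := R_AbsRing) (V := R_NormedModule)). Qed.

Lemma is_derive_eq (f : R -> R) t l l' : is_derive f t l -> l = l' -> is_derive f t l'.
Proof. intros H E; subst; exact H. Qed.

Lemma cder_mult f g t l m : cder f t l -> cder g t m ->
  cder (fun u => f u * g u)%C t (l * g t + f t * m)%C.
Proof.
  intros [H1 H2] [H3 H4]; split; simpl.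
  - eapply is_derive_eq.
    + apply is_derive_Rminus; apply is_derive_Rmult; eassumption.
    + unfold Re, Im; simpl; ring.
  - eapply is_derive_eq.
    + apply is_derive_Rplus; apply is_derive_Rmult; eassumption.
    + unfold Re, Im; simpl; ring.
Qed.

Lemma cder_scal c f t l : cder f t l -> cder (fun u => c * f u)%C t (c * l)%C.
Proof.
  intros H. eapply cder_eq. { apply cder_mult; [apply cder_const|exact H]. }
  cbv beta; ring.
Qed.

Lemma C_sqr_pos (z : C) : z <> RtoC 0 -> 0 < Re z ^ 2 + Im z ^ 2.
Proof.
  intros H. rewrite <- Cmod2_alt. apply Cmod_gt_0 in H. nra.
Qed.

Lemma cder_inv f t l : cder f t l -> f t <> RtoC 0 ->
  cder (fun u => / f u)%C t (- l / (f t * f t))%C.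
Proof.
  intros [H1 H2] Hn. assert (Hp := C_sqr_pos _ Hn).
  assert (Hn' : Re (f t) ^ 2 + Im (f t) ^ 2 <> 0) by lra.
  assert (Hd : is_derive (fun u => Re (f u) ^ 2 + Im (f u) ^ 2) t
                 (2 * Re (f t) * Re l + 2 * Im (f t) * Im l)).
  { eapply is_derive_eq.
    - apply is_derive_Rplus; apply (is_derive_pow _ 2); eassumption.
    - simpl; ring. }
  destruct (f t) as [x y] eqn:E; destruct l as [l1 l2]; unfold Re, Im in *; simpl in Hp, Hn'.
  split; unfold Cinv, Cdiv, Re, Im; simpl fst; simpl snd.
  - eapply is_derive_eq.
    + apply (is_derive_div (fun u => fst (f u)) (fun u => fst (f u) ^ 2 + snd (f u) ^ 2));
        [exact H1|exact Hd|rewrite E; exact Hn'].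
    + rewrite E. simpl. field. split; [nra|].
      replace ((x * x - y * y) * (x * x - y * y) + (x * y + y * x) * (x * y + y * x))
        with ((x * x + y * y) * (x * x + y * y)) by ring. simpl in *. nra.
  - eapply is_derive_eq.
    + apply (is_derive_div (fun u => - snd (f u)) (fun u => fst (f u) ^ 2 + snd (f u) ^ 2));
        [apply (is_derive_opp (K := R_AbsRing) (V := R_NormedModule)); exact H2
        |exact Hd|rewrite E; exact Hn'].
    + rewrite E. simpl. change (opp l2) with (- l2). field. split; [nra|].
      replace ((x * x - y * y) * (x * x - y * y) + (x * y + y * x) * (x * y + y * x))
        with ((x * x + y * y) * (x * x + y * y)) by ring. simpl in *. nra.
Qed.

Lemma cder_pow f t l n : cder f t l ->
  cder (fun u => f u ^ n)%C t (RtoC (INR n) * f t ^ (pred n) * l)%C.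
Proof.
  intros H. induction n as [|n IH].
  - simpl. eapply cder_eq; [apply cder_const|]. ring.
  - apply cder_ext with (fun u => f u * f u ^ n)%C; [reflexivity|].
    eapply cder_eq; [apply cder_mult; [exact H|exact IH]|].
    rewrite S_INR, RtoC_plus. simpl pred.
    destruct n; simpl pred; [simpl; ring|]. rewrite Cpow_S. ring.
Qed.

Lemma cder_inv_pow f t l n : cder f t l -> f t <> RtoC 0 ->
  cder (fun u => / f u ^ n)%C t (- RtoC (INR n) * l / f t ^ (S n))%C.
Proof.
  intros H Hn. eapply cder_eq.
  - apply cder_inv; [apply cder_pow; exact H|]. now apply Cpow_nz.
  - assert (Hp := Cpow_nz (f t) n Hn).
    destruct n as [|n].
    + simpl. field. exact Hn.
    + simpl pred. rewrite !Cpow_S in *. 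
      assert (Hq := Cpow_nz (f t) n Hn). field. split; assumption.
Qed.

Lemma cder_div f g t l m : cder f t l -> cder g t m -> g t <> RtoC 0 ->
  cder (fun u => f u / g u)%C t ((l * g t - f t * m) / (g t * g t))%C.
Proof.
  intros H1 H2 Hn. eapply cder_eq.
  - apply cder_mult; [exact H1|apply cder_inv; eassumption].
  - cbv beta. field. exact Hn.
Qed.

Lemma cder_comp f g t l d : cder f (g t) l -> is_derive g t d ->
  cder (fun u => f (g u)) t (RtoC d * l)%C.
Proof.
  intros [H1 H2] Hg. split.
  - rewrite Re_RtoC_mult.
    apply (is_derive_comp (fun u => Re (f u)) g t (Re l) d H1 Hg).
  - rewrite Im_RtoC_mult.
    apply (is_derive_comp (fun u => Im (f u)) g t (Im l) d H2 Hg).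
Qed.

Lemma cder_Cexp f t l : cder f t l ->
  cder (fun u => Cexp (f u)) t (l * Cexp (f t))%C.
Proof.
  intros [H1 H2]. split; unfold Cexp; simpl.
  - eapply is_derive_eq.
    + apply is_derive_Rmult.
      * apply (is_derive_comp exp (fun u => Re (f u))); [apply is_derive_exp|exact H1].
      * apply (is_derive_comp cos (fun u => Im (f u))); [apply is_derive_cos|exact H2].
    + unfold scal; simpl; unfold mult; simpl; unfold Re, Im; ring.
  - eapply is_derive_eq.
    + apply is_derive_Rmult.
      * apply (is_derive_comp exp (fun u => Re (f u))); [apply is_derive_exp|exact H1].
      * apply (is_derive_comp sin (fun u => Im (f u))); [apply is_derive_sin|exact H2].
    + unfold scal; simpl; unfold mult; simpl; unfold Re, Im; ring.
Qed.

Lemma cder_of_quotient f t l :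
  (forall eps, 0 < eps -> exists del, 0 < del /\ forall h, h <> 0 -> Rabs h < del ->
    Cmod ((f (t + h)%R - f t) / RtoC h - l) < eps) -> cder f t l.
Proof.
  intros W.
  assert (E : forall h, h <> 0 -> ((f (t + h)%R - f t) / RtoC h - l)%C
    = (((Re (f (t + h)%R) - Re (f t)) / h - Re l)%R, ((Im (f (t + h)%R) - Im (f t)) / h - Im l)%R)).
  { intros h Hh. unfold Cdiv. rewrite <- RtoC_inv by exact Hh.
    apply C_ext; unfold Re, Im; simpl; unfold Rdiv; ring. }
  split; apply is_derive_Reals; intros eps Heps; destruct (W eps Heps) as [del [Hdel HW]];
    exists (mkposreal del Hdel); intros h Hh0 Hh; specialize (HW h Hh0 Hh);
    rewrite E in HW by exact Hh0; (eapply Rle_lt_trans; [|exact HW]).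
  - apply (re_le_Cmod (_, _)).
  - apply (im_le_Cmod (_, _)).
Qed.

Lemma cder_ccont f t l : cder f t l -> ccont f t.
Proof.
  intros [H1 H2]; split; apply ex_derive_Rcontinuous;
    eexists; eassumption.
Qed.

Lemma ccont_const c t : ccont (fun _ => c) t.
Proof. split; apply continuous_const. Qed.

Lemma ccont_plus f g t : ccont f t -> ccont g t -> ccont (fun u => f u + g u)%C t.
Proof.
  intros [H1 H2] [H3 H4]; split; simpl;
    apply (continuous_plus (K := R_AbsRing) (V := R_NormedModule)); assumption.
Qed.

Lemma ccont_mult f g t : ccont f t -> ccont g t -> ccont (fun u => f u * g u)%C t.
Proof.
  intros [H1 H2] [H3 H4]; split; simpl.
  - apply (continuous_minus (K := R_AbsRing) (V := R_NormedModule));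
      apply (continuous_mult (K := R_AbsRing)); assumption.
  - apply (continuous_plus (K := R_AbsRing) (V := R_NormedModule));
      apply (continuous_mult (K := R_AbsRing)); assumption.
Qed.

Lemma ccont_R g t : continuous g t -> ccont (fun u => RtoC (g u)) t.
Proof. intros H; split; [exact H|apply continuous_const]. Qed.

Lemma cint_eq f a b I J : cint f a b I -> I = J -> cint f a b J.
Proof. intros H E; subst; exact H. Qed.

Lemma cint_ext f g a b I : (forall x, Rmin a b < x < Rmax a b -> f x = g x) ->
  cint f a b I -> cint g a b I.
Proof.
  intros E [H1 H2]; split; eapply is_RInt_ext; [|exact H1| |exact H2];
    intros x Hx; simpl; now rewrite E.
Qed.

Lemma cint_plus f g a b I J : cint f a b I -> cint g a b J ->
  cint (fun u => f u + g u)%C a b (I + J)%C.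
Proof.
  intros [H1 H2] [H3 H4]; split; simpl;
    apply (is_RInt_plus (V := R_NormedModule)); assumption.
Qed.

Lemma is_RInt_Rscal f a b k I : is_RInt f a b I -> is_RInt (fun u => k * f u) a b (k * I).
Proof. apply (is_RInt_scal (V := R_NormedModule)). Qed.

Lemma is_RInt_eq (f : R -> R) a b I J : is_RInt f a b I -> I = J -> is_RInt f a b J.
Proof. intros H E; subst; exact H. Qed.

Lemma cint_scal c f a b I : cint f a b I -> cint (fun u => c * f u)%C a b (c * I)%C.
Proof.
  intros [H1 H2]; split; simpl.
  - apply (is_RInt_minus (V := R_NormedModule) (fun u => fst c * fst (f u)) (fun u => snd c * snd (f u)));
      apply is_RInt_Rscal; assumption.
  - apply (is_RInt_plus (V := R_NormedModule) (fun u => fst c * snd (f u)) (fun u => snd c * fst (f u)));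
      apply is_RInt_Rscal; assumption.
Qed.

Lemma cint_opp f a b I : cint f a b I -> cint (fun u => - f u)%C a b (- I)%C.
Proof.
  intros H. apply cint_ext with (fun u => RtoC (-1) * f u)%C; [intros; ring|].
  apply cint_eq with (RtoC (-1) * I)%C; [now apply cint_scal|ring].
Qed.

Lemma cint_minus f g a b I J : cint f a b I -> cint g a b J ->
  cint (fun u => f u - g u)%C a b (I - J)%C.
Proof. intros H1 H2. apply cint_plus; [exact H1|]. now apply cint_opp. Qed.

Lemma cint_Chasles f a b c I J : cint f a b I -> cint f b c J -> cint f a c (I + J)%C.
Proof.
  intros [H1 H2] [H3 H4]; split; simpl;
    eapply (is_RInt_Chasles (V := R_NormedModule)); eassumption.
Qed.

Lemma cint_point f a : cint f a a 0.
Proof. split; apply (is_RInt_point (V := R_NormedModule)). Qed.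

Lemma cint_swap f a b I : cint f a b I -> cint f b a (- I)%C.
Proof. intros [H1 H2]; split; apply (is_RInt_swap (V := R_NormedModule)); assumption. Qed.

Lemma cint_unique f a b I J : cint f a b I -> cint f a b J -> I = J.
Proof.
  intros [H1 H2] [H3 H4]. apply C_ext.
  - rewrite <- (is_RInt_unique (V := R_CompleteNormedModule) _ _ _ _ H1).
    exact (is_RInt_unique (V := R_CompleteNormedModule) _ _ _ _ H3).
  - rewrite <- (is_RInt_unique (V := R_CompleteNormedModule) _ _ _ _ H2).
    exact (is_RInt_unique (V := R_CompleteNormedModule) _ _ _ _ H4).
Qed.

Definition cintegrable (f : R -> C) (a b : R) : Prop := exists I, cint f a b I.

Definition cRInt (f : R -> C) (a b : R) : C :=
  (RInt (fun u => Re (f u)) a b, RInt (fun u => Im (f u)) a b).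

Lemma cRInt_correct f a b : cintegrable f a b -> cint f a b (cRInt f a b).
Proof.
  intros [I [H1 H2]]; split; simpl;
    apply (RInt_correct (V := R_CompleteNormedModule)); eexists; eassumption.
Qed.

Lemma cintegrable_cont f a b :
  (forall x, Rmin a b <= x <= Rmax a b -> ccont f x) -> cintegrable f a b.
Proof.
  intros H.
  destruct (ex_RInt_continuous (V := R_CompleteNormedModule) (fun u => Re (f u)) a b) as [x Hx].
  { intros u Hu; apply H, Hu. }
  destruct (ex_RInt_continuous (V := R_CompleteNormedModule) (fun u => Im (f u)) a b) as [y Hy].
  { intros u Hu; apply H, Hu. }
  exists (x, y); split; assumption.
Qed.

Lemma cintegrable_sub f a b c : a <= b <= c -> cintegrable f a c -> cintegrable f a b.
Proof.
  intros H [I [H1 H2]].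
  destruct (ex_RInt_Chasles_1 (V := R_CompleteNormedModule) _ _ _ _ H (ex_intro _ _ H1)) as [x Hx].
  destruct (ex_RInt_Chasles_1 (V := R_CompleteNormedModule) _ _ _ _ H (ex_intro _ _ H2)) as [y Hy].
  exists (x, y); split; assumption.
Qed.

Lemma cint_sub f a b I J : cint f 0 a I -> cint f 0 b J -> cint f a b (J - I)%C.
Proof.
  intros H1 H2. apply cint_eq with (- I + J)%C; [|ring].
  eapply cint_Chasles; [apply cint_swap; exact H1|exact H2].
Qed.

Lemma cint_derive F f a b :
  (forall x, Rmin a b <= x <= Rmax a b -> cder F x (f x)) ->
  (forall x, Rmin a b <= x <= Rmax a b -> ccont f x) ->
  cint f a b (F b - F a)%C.
Proof.
  intros H1 H2; split; simpl;
    apply (is_RInt_derive (V := R_CompleteNormedModule) (fun u => _ (F u)) (fun u => _ (f u)));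
    intros x Hx; try apply H1, Hx; apply H2, Hx.
Qed.

Lemma Re_conj_mult (z : C) : Re (Cconj z * z) = Cmod z * Cmod z.
Proof.
  transitivity (Re z ^ 2 + Im z ^ 2).
  - destruct z; unfold Re, Im; simpl; ring.
  - rewrite <- Cmod2_alt; ring.
Qed.

Lemma cint_le f g a b I J : a <= b -> cint f a b I -> is_RInt g a b J ->
  (forall x, a < x < b -> Cmod (f x) <= g x) -> Cmod I <= J.
Proof.
  (* Project f on the direction of its integral. *)
  intros Hab HI HJ Hle.
  assert (Hm := Cmod_ge_0 I).
  destruct (Req_dec (Cmod I) 0) as [E|E].
  - rewrite E. apply (is_RInt_le (fun _ => 0) g a b); [exact Hab| |exact HJ|].
    + eapply is_RInt_eq; [apply (is_RInt_const (V := R_NormedModule))|].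
      unfold scal; simpl; unfold mult; simpl; ring.
    + intros x Hx. eapply Rle_trans; [apply Cmod_ge_0|apply Hle, Hx].
  - assert (H : Cmod I * Cmod I <= Cmod I * J); [|nra].
    apply (is_RInt_le (fun x => Re (Cconj I * f x)) (fun x => Cmod I * g x) a b);
      [exact Hab| | |].
    + destruct (cint_scal (Cconj I) _ _ _ _ HI) as [H1 _].
      eapply is_RInt_eq; [exact H1|apply Re_conj_mult].
    + now apply is_RInt_Rscal.
    + intros x Hx. eapply Rle_trans; [apply Rle_abs|].
      eapply Rle_trans; [apply re_le_Cmod|].
      rewrite Cmod_mult, Cmod_conj. apply Rmult_le_compat_l; auto.
Qed.

Lemma Rmvt (f df : R -> R) a b : a < b ->
  (forall x, a < x < b -> is_derive f x (df x)) ->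
  (forall x, a <= x <= b -> continuous f x) ->
  exists c, a < c < b /\ f b - f a = df c * (b - a).
Proof.
  intros Hab Hd Hc.
  assert (pr : forall c, a < c < b -> derivable_pt f c).
  { intros c H. exists (df c). apply is_derive_Reals, Hd, H. }
  assert (pr2 : forall c, a < c < b -> derivable_pt id c).
  { intros c _. apply derivable_pt_id. }
  destruct (MVT f id a b pr pr2 Hab) as [c [P E]].
  - intros c H. apply continuity_pt_filterlim, Hc, H.
  - intros c _. apply derivable_continuous_pt, derivable_pt_id.
  - exists c. split; [exact P|].
    replace (derive_pt id c (pr2 c P)) with 1 in E
      by (symmetry; apply derive_pt_eq_0, derivable_pt_lim_id).
    replace (derive_pt f c (pr c P)) with (df c) in E
      by (symmetry; apply derive_pt_eq_0, is_derive_Reals, Hd, P).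
    unfold id in E. lra.
Qed.

(** Project F on the direction of its displacement and apply the real mean value
    theorem. *)
Lemma cder_le F f G g a b : a <= b ->
  (forall x, a < x < b -> cder F x (f x)) -> (forall x, a < x < b -> is_derive G x (g x)) ->
  (forall x, a <= x <= b -> ccont F x) -> (forall x, a <= x <= b -> continuous G x) ->
  (forall x, a < x < b -> Cmod (f x) <= g x) -> Cmod (F b - F a) <= G b - G a.
Proof.
  intros Hab HF HG CF CG Hle.
  destruct Hab as [Hab|Hab].
  2:{ subst. replace (F b - F b)%C with (RtoC 0) by ring. rewrite Cmod_0; lra. }
  set (v := (F b - F a)%C). assert (Hm := Cmod_ge_0 v).
  assert (Hv : Cmod v * Cmod v <= Cmod v * (G b - G a)).
  { destruct (Rmvt (fun u => Cmod v * G u - Re (Cconj v * F u)) 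
               (fun x => Cmod v * g x - Re (Cconj v * f x)) a b Hab) as [c [Hc E]].
    - intros x Hx. apply is_derive_Rminus.
      + eapply is_derive_eq.
        * apply is_derive_Rmult; [apply (is_derive_const (K := R_AbsRing) (V := R_NormedModule))|apply HG, Hx].
        * unfold zero; simpl; ring.
      + destruct (cder_scal (Cconj v) _ _ _ (HF x Hx)) as [H _]. exact H.
    - intros x Hx.
      apply (continuous_minus (K := R_AbsRing) (V := R_NormedModule) (fun u => Cmod v * G u)
             (fun u => Re (Cconj v * F u))).
      + apply (continuous_mult (K := R_AbsRing)); [apply continuous_const|apply CG, Hx].
      + apply (ccont_mult _ _ _ (ccont_const (Cconj v) x) (CF x Hx)).
    - assert (Hpos : 0 <= Cmod v * g c - Re (Cconj v * f c)).
      { assert (H := Rle_abs (Re (Cconj v * f c))).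
        assert (H2 := re_le_Cmod (Cconj v * f c)). rewrite Cmod_mult, Cmod_conj in H2.
        assert (H3 := Hle c Hc). nra. }
      assert (Ev : Cmod v * Cmod v = Re (Cconj v * F b) - Re (Cconj v * F a)).
      { rewrite <- Re_conj_mult. unfold v; destruct (F a), (F b); unfold Re; simpl; ring. }
      nra. }
  destruct (Req_dec (Cmod v) 0) as [E0|E0]; [|nra].
  rewrite E0. destruct (Rmvt G g a b Hab HG CG) as [d [Hd Ed]].
  assert (0 <= g d) by (eapply Rle_trans; [apply Cmod_ge_0|apply Hle, Hd]). nra.
Qed.

(** * Complex limits and improper integrals *)

Definition cseq (u : nat -> C) (l : C) : Prop :=
  is_lim_seq (fun n => Cmod (u n - l)) 0.

Lemma cseq_squeeze u l v : (forall n, Cmod (u n - l) <= v n) -> is_lim_seq v 0 -> cseq u l.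
Proof.
  intros H Hv. apply is_lim_seq_le_le with (fun _ => 0) v.
  - intros n; split; [apply Cmod_ge_0|apply H].
  - apply is_lim_seq_const.
  - exact Hv.
Qed.

Lemma cseq_ext u v l : (forall n, u n = v n) -> cseq u l -> cseq v l.
Proof. intros E. apply is_lim_seq_ext. intros n; now rewrite E. Qed.

Lemma cseq_eq u l l' : cseq u l -> l = l' -> cseq u l'.
Proof. intros H E; subst; exact H. Qed.

Lemma cseq_const l : cseq (fun _ => l) l.
Proof.
  apply cseq_squeeze with (fun _ => 0); [|apply is_lim_seq_const].
  intros _. replace (l - l)%C with (RtoC 0) by ring. rewrite Cmod_0; lra.
Qed.

Lemma cseq_plus u v l m : cseq u l -> cseq v m -> cseq (fun n => u n + v n)%C (l + m)%C.
Proof.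
  intros Hu Hv. apply cseq_squeeze with (fun n => Cmod (u n - l) + Cmod (v n - m)).
  - intros n. replace (u n + v n - (l + m))%C with ((u n - l) + (v n - m))%C by ring.
    apply Cmod_triangle.
  - replace (Finite 0) with (Finite (0 + 0)) by (f_equal; ring).
    apply is_lim_seq_plus'; assumption.
Qed.

Lemma cseq_scal c u l : cseq u l -> cseq (fun n => c * u n)%C (c * l)%C.
Proof.
  intros Hu. apply cseq_squeeze with (fun n => Cmod c * Cmod (u n - l)).
  - intros n. replace (c * u n - c * l)%C with (c * (u n - l))%C by ring.
    rewrite Cmod_mult; lra.
  - replace (Finite 0) with (Finite (Cmod c * 0)) by (f_equal; ring).
    apply is_lim_seq_mult'; [apply is_lim_seq_const|exact Hu].
Qed.

Lemma cseq_opp u l : cseq u l -> cseq (fun n => - u n)%C (- l)%C.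
Proof.
  intros H. apply cseq_ext with (fun n => RtoC (-1) * u n)%C; [intros; ring|].
  apply cseq_eq with (RtoC (-1) * l)%C; [now apply cseq_scal|ring].
Qed.

Lemma cseq_minus u v l m : cseq u l -> cseq v m -> cseq (fun n => u n - v n)%C (l - m)%C.
Proof. intros Hu Hv. apply cseq_plus; [exact Hu|now apply cseq_opp]. Qed.

Lemma cseq_components u l : is_lim_seq (fun n => Re (u n)) (Re l) ->
  is_lim_seq (fun n => Im (u n)) (Im l) -> cseq u l.
Proof.
  intros H1 H2.
  apply cseq_squeeze with (fun n => Rabs (Re (u n) - Re l) + Rabs (Im (u n) - Im l)).
  - intros n. eapply Rle_trans; [apply Cmod_Rabs_le|].
    right; destruct (u n), l; reflexivity.
  - replace (Finite 0) with (Finite (Rabs (Re l - Re l) + Rabs (Im l - Im l)))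
      by (f_equal; rewrite !Rminus_diag, Rabs_R0; ring).
    apply is_lim_seq_plus';
      apply (is_lim_seq_abs _ (Finite _));
      (apply is_lim_seq_minus'; [assumption|apply is_lim_seq_const]).
Qed.

Lemma is_lim_seq_of_abs (u : nat -> R) (l : R) v : (forall n, Rabs (u n - l) <= v n) ->
  is_lim_seq v 0 -> is_lim_seq u l.
Proof.
  intros H Hv. apply is_lim_seq_ext with (fun n => (u n - l) + l); [intros; ring|].
  replace (Finite l) with (Finite (0 + l)) by (f_equal; ring).
  apply is_lim_seq_plus'; [|apply is_lim_seq_const].
  apply is_lim_seq_abs_0. apply is_lim_seq_le_le with (fun _ => 0) v.
  - intros n; split; [apply Rabs_pos|apply H].
  - apply is_lim_seq_const.
  - exact Hv.
Qed.

Lemma cseq_Re u l : cseq u l -> is_lim_seq (fun n => Re (u n)) (Re l).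
Proof.
  intros H. apply is_lim_seq_of_abs with (fun n => Cmod (u n - l)); [|exact H].
  intros n. apply Re_minus_le.
Qed.

Lemma cseq_Im u l : cseq u l -> is_lim_seq (fun n => Im (u n)) (Im l).
Proof.
  intros H. apply is_lim_seq_of_abs with (fun n => Cmod (u n - l)); [|exact H].
  intros n. apply Im_minus_le.
Qed.

Lemma cseq_R u l : is_lim_seq u (Finite l) -> cseq (fun n => RtoC (u n)) (RtoC l).
Proof. intros H. apply cseq_components; [exact H|apply is_lim_seq_const]. Qed.

Lemma cseq_mult u v l m : cseq u l -> cseq v m -> cseq (fun n => u n * v n)%C (l * m)%C.
Proof.
  intros Hu Hv. assert (H1 := cseq_Re _ _ Hu). assert (H2 := cseq_Im _ _ Hu).
  assert (H3 := cseq_Re _ _ Hv). assert (H4 := cseq_Im _ _ Hv).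
  apply cseq_components; simpl.
  - apply is_lim_seq_minus'; apply is_lim_seq_mult'; assumption.
  - apply is_lim_seq_plus'; apply is_lim_seq_mult'; assumption.
Qed.

Lemma cseq_unique u l m : cseq u l -> cseq u m -> l = m.
Proof.
  intros H1 H2. apply C_ext.
  - apply cseq_Re in H1, H2. apply is_lim_seq_unique in H1, H2. congruence.
  - apply cseq_Im in H1, H2. apply is_lim_seq_unique in H1, H2. congruence.
Qed.

Lemma cseq_CLim u l : cseq u l -> CLim_seq u = l.
Proof.
  intros H. unfold CLim_seq.
  rewrite (is_lim_seq_unique _ _ (cseq_Re _ _ H)), (is_lim_seq_unique _ _ (cseq_Im _ _ H)).
  now destruct l.
Qed.

Lemma cseq_Cexp u l : cseq u l -> cseq (fun n => Cexp (u n)) (Cexp l).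
Proof.
  intros H. assert (H1 := cseq_Re _ _ H). assert (H2 := cseq_Im _ _ H).
  assert (Hc : forall f x, continuity_pt f x -> forall w, is_lim_seq w (Finite x) ->
            is_lim_seq (fun n => f (w n)) (f x)).
  { intros f x Hf w Hw. apply is_lim_seq_continuous; assumption. }
  apply cseq_components; unfold Cexp; simpl; apply is_lim_seq_mult'; apply Hc; auto;
    apply derivable_continuous_pt;
    [apply derivable_pt_exp|apply derivable_pt_cos|apply derivable_pt_exp|apply derivable_pt_sin].
Qed.

Lemma cseq_incr_1 u l : cseq (fun n => u (S n)) l -> cseq u l.
Proof. intros H. unfold cseq in *. apply is_lim_seq_incr_1. exact H. Qed.

Lemma cseq_shift u l : cseq u l -> cseq (fun n => u (S n)) l.
Proof. intros H. unfold cseq in *. apply is_lim_seq_incr_1 in H. exact H. Qed.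

(** Asking for the partial integrals over [0, T] with T large already gives them on
    every bounded interval, so integrability is never a separate hypothesis. *)
Definition cint_inf (f : R -> C) (I : C) : Prop :=
  forall eps, 0 < eps -> exists M, forall T, M <= T ->
    exists J, cint f 0 T J /\ Cmod (J - I) < eps.

Lemma cint_inf_eq f I J : cint_inf f I -> I = J -> cint_inf f J.
Proof. intros H E; subst; exact H. Qed.

Lemma cint_inf_ext f g I : (forall t, 0 < t -> f t = g t) -> cint_inf f I -> cint_inf g I.
Proof.
  intros E H eps Heps. destruct (H eps Heps) as [M HM]. exists (Rmax 0 M). intros T HT.
  destruct (HM T) as [J [HJ1 HJ2]]; [eapply Rle_trans; [apply Rmax_r|exact HT]|].
  exists J; split; [|exact HJ2].
  assert (HT0 : 0 <= T) by (eapply Rle_trans; [apply Rmax_l|exact HT]).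
  eapply cint_ext; [|exact HJ1]. intros x. rewrite Rmin_left, Rmax_right by lra.
  intros Hx; apply E; lra.
Qed.

Lemma cint_inf_plus f g I J : cint_inf f I -> cint_inf g J ->
  cint_inf (fun u => f u + g u)%C (I + J)%C.
Proof.
  intros H1 H2 eps Heps.
  destruct (H1 (eps / 2) ltac:(lra)) as [M1 HM1]. destruct (H2 (eps / 2) ltac:(lra)) as [M2 HM2].
  exists (Rmax M1 M2). intros T HT.
  destruct (HM1 T) as [K1 [A1 B1]]; [eapply Rle_trans; [apply Rmax_l|exact HT]|].
  destruct (HM2 T) as [K2 [A2 B2]]; [eapply Rle_trans; [apply Rmax_r|exact HT]|].
  exists (K1 + K2)%C; split; [now apply cint_plus|].
  replace (K1 + K2 - (I + J))%C with ((K1 - I) + (K2 - J))%C by ring.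
  eapply Rle_lt_trans; [apply Cmod_triangle|]. lra.
Qed.

Lemma cint_inf_scal c f I : cint_inf f I -> cint_inf (fun u => c * f u)%C (c * I)%C.
Proof.
  intros H eps Heps. assert (Hc := Cmod_ge_0 c).
  destruct (H (eps / (Cmod c + 1))) as [M HM]; [apply Rdiv_lt_0_compat; lra|].
  exists M. intros T HT. destruct (HM T HT) as [J [A B]].
  exists (c * J)%C; split; [now apply cint_scal|].
  replace (c * J - c * I)%C with (c * (J - I))%C by ring. rewrite Cmod_mult.
  apply Rmult_lt_compat_l with (r := Cmod c + 1) in B; [|lra].
  replace ((Cmod c + 1) * (eps / (Cmod c + 1))) with eps in B by (field; lra).
  assert (Hn := Cmod_ge_0 (J - I)). nra.
Qed.

Lemma cint_inf_minus f g I J : cint_inf f I -> cint_inf g J ->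
  cint_inf (fun u => f u - g u)%C (I - J)%C.
Proof.
  intros H1 H2. apply cint_inf_ext with (fun u => f u + RtoC (-1) * g u)%C; [intros; ring|].
  apply cint_inf_eq with (I + RtoC (-1) * J)%C; [|ring].
  apply cint_inf_plus; [exact H1|now apply cint_inf_scal].
Qed.

Lemma filterlim_INR_large M : eventually (fun n => M <= INR n).
Proof.
  destruct (nfloor_ex (Rmax 0 M)) as [n Hn]; [apply Rmax_l|].
  exists (S n). intros m Hm. apply le_INR in Hm. rewrite S_INR in Hm.
  assert (H := Rmax_r 0 M). lra.
Qed.

Lemma cint_inf_seq f I J : cint_inf f I -> (forall n, cint f 0 (INR n) (J n)) -> cseq J I.
Proof.
  intros H HJ. apply is_lim_seq_spec. intros eps.
  destruct (H eps (cond_pos eps)) as [M HM].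
  eapply filter_imp; [|apply (filterlim_INR_large M)]. intros n Hn; simpl.
  destruct (HM _ Hn) as [K [A B]]. rewrite (cint_unique _ _ _ _ _ (HJ n) A).
  rewrite Rminus_0_r, Rabs_pos_eq; [exact B|apply Cmod_ge_0].
Qed.

(** A value of the integral given by a formula, so that it can be named in a
    function of the parameters without any choice. *)
Definition improper (f : R -> C) : C := CLim_seq (fun m => cRInt f 0 (INR m)).

Lemma improper_correct f I : cint_inf f I -> cint_inf f (improper f).
Proof.
  intros H. unfold improper. rewrite (cseq_CLim _ I); [exact H|].
  apply (cint_inf_seq _ _ _ H). intros m. apply cRInt_correct.
  destruct (H 1 ltac:(lra)) as [M HM]. destruct (HM (Rmax M (INR m)) (Rmax_l _ _)) as [J [HJ _]].
  apply cintegrable_sub with (Rmax M (INR m)); [split; [apply pos_INR|apply Rmax_r]|].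
  exists J; exact HJ.
Qed.

Lemma cint_inf_lim f J I : (forall T, 0 <= T -> cint f 0 T (J T)) ->
  is_lim (fun T => Cmod (J T - I)) p_infty 0 -> cint_inf f I.
Proof.
  intros H HL eps Heps. apply is_lim_spec in HL.
  destruct (HL (mkposreal eps Heps)) as [M HM]. exists (Rmax 0 (M + 1)). intros T HT.
  assert (H1 := Rmax_l 0 (M + 1)). assert (H2 := Rmax_r 0 (M + 1)).
  exists (J T). split; [apply H; lra|].
  specialize (HM T ltac:(lra)). simpl in HM. rewrite Rminus_0_r, Rabs_pos_eq in HM;
    [exact HM|apply Cmod_ge_0].
Qed.

Lemma cint_inf_unique f I J : cint_inf f I -> cint_inf f J -> I = J.
Proof.
  intros H1 H2. apply Ceq_minus, Cmod_eq_0.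
  assert (H : forall eps, 0 < eps -> Cmod (I - J) <= eps).
  { intros eps Heps.
    destruct (H1 (eps / 2) ltac:(lra)) as [M1 HM1]. destruct (H2 (eps / 2) ltac:(lra)) as [M2 HM2].
    destruct (HM1 (Rmax M1 M2) (Rmax_l _ _)) as [K1 [A1 B1]].
    destruct (HM2 (Rmax M1 M2) (Rmax_r _ _)) as [K2 [A2 B2]].
    assert (K1 = K2) by (eapply cint_unique; eassumption). subst K2.
    replace (I - J)%C with ((K1 - J) - (K1 - I))%C by ring.
    eapply Rle_trans; [apply Cmod_triangle|]. rewrite Cmod_opp. lra. }
  assert (H0 := Cmod_ge_0 (I - J)).
  destruct (Req_dec (Cmod (I - J)) 0) as [E|E]; [exact E|].
  specialize (H (Cmod (I - J) / 2) ltac:(lra)). lra.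
Qed.

Lemma cint_inf_bound f I C0 : cint_inf f I ->
  (forall T J, 0 <= T -> cint f 0 T J -> Cmod J <= C0) -> Cmod I <= C0.
Proof.
  intros H HB. apply Rnot_lt_le. intros Hlt.
  destruct (H (Cmod I - C0) ltac:(lra)) as [M HM].
  destruct (HM (Rmax 0 M) (Rmax_r _ _)) as [J [A B]].
  specialize (HB _ _ (Rmax_l _ _) A).
  assert (H1 := Cmod_rev_triangle I (J - I)). replace (I + (J - I))%C with J in H1 by ring. lra.
Qed.

Lemma is_Cint_of_cint_inf f I : cint_inf f I -> is_Cint_0_infty f I.
Proof.
  intros H P [eps Heps].
  assert (Hs : 0 < eps) by apply cond_pos.
  destruct (H eps Hs) as [M HM].
  apply (Filter_prod _ _ _ (fun x => x = 0) (fun y => M < y)).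
  - reflexivity.
  - exists M; auto.
  - intros x y Hx Hy. subst x. destruct (HM y (Rlt_le _ _ Hy)) as [J [A B]].
    exists J. split; simpl.
    + destruct A as [A1 A2]. destruct J as [J1 J2].
      apply (is_RInt_fct_extend_pair (U := R_NormedModule) (V := R_NormedModule)); assumption.
    + apply Heps. split; unfold ball; simpl; unfold AbsRing_ball, abs, minus, plus, opp; simpl.
      * change (Rabs (Re J - Re I) < eps). eapply Rle_lt_trans; [|exact B].
        apply Re_minus_le.
      * change (Rabs (Im J - Im I) < eps). eapply Rle_lt_trans; [|exact B].
        apply Im_minus_le.
Qed.

(** Dominated convergence criterion: G is a bound for the total variation of the
    primitive, so the primitive satisfies Cauchy's criterion when G converges. *)
Lemma cint_inf_dom f G (l : R) :
  (forall T, 0 <= T -> cintegrable f 0 T) -> is_lim G p_infty l ->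
  (forall a b J, 0 <= a <= b -> cint f a b J -> Cmod J <= G b - G a) ->
  exists I, cint_inf f I /\ forall T J, 0 <= T -> cint f 0 T J -> Cmod (I - J) <= l - G T.
Proof.
  intros Hi HG Hb.
  set (J n := cRInt f 0 (INR n)).
  assert (HJ : forall n, cint f 0 (INR n) (J n)) by (intros n; apply cRInt_correct, Hi, pos_INR).
  assert (HGle : forall a b, 0 <= a <= b -> G a <= G b).
  { intros a b H. destruct (Hi b ltac:(lra)) as [K HK]. destruct (Hi a ltac:(lra)) as [K' HK'].
    assert (A := Hb a b _ H (cint_sub _ _ _ _ _ HK' HK)).
    assert (B := Cmod_ge_0 (K - K')). lra. }
  assert (HGl : forall a, 0 <= a -> G a <= l).
  { intros a Ha.
    apply (is_lim_le_loc (fun _ => G a) G p_infty (G a) l); [exists a; intros x Hx; apply HGle; lra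
      |apply is_lim_const|exact HG]. }
  assert (HJb : forall n m, (n <= m)%nat -> Cmod (J m - J n) <= l - G (INR n)).
  { intros n m H. apply le_INR in H.
    eapply Rle_trans; [apply (Hb (INR n) (INR m))|].
    - split; [apply pos_INR|exact H].
    - eapply cint_sub; apply HJ.
    - assert (A := HGl (INR m) (pos_INR m)). lra. }
  assert (HGn : is_lim_seq (fun n => l - G (INR n)) 0).
  { replace (Finite 0) with (Finite (l - l)) by (f_equal; ring).
    apply is_lim_seq_minus'; [apply is_lim_seq_const|].
    apply (is_lim_comp_seq G INR p_infty l HG); [|apply is_lim_seq_INR].
    exists 0%nat. intros n _. discriminate. }
  assert (HC : forall (pr : C -> R), (forall a b, Rabs (pr a - pr b) <= Cmod (a - b)) ->
     ex_finite_lim_seq (fun n => pr (J n))).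
  { intros pr Hpr. apply ex_lim_seq_cauchy_corr. intros eps.
    apply is_lim_seq_spec in HGn. destruct (HGn eps) as [N HN]. exists N.
    assert (W : forall n m, (N <= n)%nat -> (n <= m)%nat -> Rabs (pr (J m) - pr (J n)) < eps).
    { intros n m Hn Hm. eapply Rle_lt_trans; [apply Hpr|].
      eapply Rle_lt_trans; [apply HJb, Hm|]. specialize (HN n Hn). simpl in HN.
      rewrite Rminus_0_r in HN. eapply Rle_lt_trans; [apply Rle_abs|exact HN]. }
    intros n m Hn Hm. destruct (Nat.le_ge_cases n m) as [H|H].
    - rewrite Rabs_minus_sym. apply W; assumption.
    - apply W; assumption. }
  destruct (HC Re) as [x Hx].
  { intros a b. apply Re_minus_le. }
  destruct (HC Im) as [y Hy].
  { intros a b. apply Im_minus_le. }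
  exists (x, y).
  assert (HJl : cseq J (x, y)) by (apply cseq_components; assumption).
  assert (HT : forall T K, 0 <= T -> cint f 0 T K -> Cmod ((x, y) - K) <= l - G T).
  { intros T K HT HK.
    assert (Hbd : is_lim_seq (fun n => Cmod (J n - (x, y)) + (l - G T)) (0 + (l - G T))).
    { apply is_lim_seq_plus'; [exact HJl|apply is_lim_seq_const]. }
    assert (Hle : eventually (fun n => Cmod ((x, y) - K) <= Cmod (J n - (x, y)) + (l - G T))).
    { eapply filter_imp; [|apply (filterlim_INR_large T)]. intros n Hn.
      replace ((x, y) - K)%C with (((x, y) - J n) + (J n - K))%C by ring.
      eapply Rle_trans; [apply Cmod_triangle|]. rewrite Cmod_minus_sym.
      apply Rplus_le_compat_l.
      eapply Rle_trans; [apply (Hb T (INR n)); [lra|eapply cint_sub; [exact HK|apply HJ]]|].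
      assert (A := HGl (INR n) (pos_INR n)). lra. }
    assert (A := is_lim_seq_le_loc _ _ _ _ Hle (is_lim_seq_const _) Hbd). simpl in A. lra. }
  split; [|exact HT].
  intros eps Heps. apply is_lim_spec in HG. destruct (HG (mkposreal eps Heps)) as [M HM].
  exists (Rmax 0 (M + 1)). intros T HT1.
  assert (H1 := Rmax_l 0 (M + 1)). assert (H2 := Rmax_r 0 (M + 1)).
  destruct (Hi T ltac:(lra)) as [K HK]. exists K. split; [exact HK|].
  rewrite Cmod_minus_sym. eapply Rle_lt_trans; [apply (HT T); [lra|exact HK]|].
  specialize (HM T ltac:(lra)). simpl in HM. rewrite Rabs_minus_sym in HM.
  eapply Rle_lt_trans; [apply Rle_abs|exact HM].
Qed.

Lemma cint_inf_dom_pt f g G (l : R) :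
  (forall T, 0 <= T -> cintegrable f 0 T) -> is_lim G p_infty l ->
  (forall t, 0 <= t -> is_derive G t (g t)) -> (forall t, 0 <= t -> continuous g t) ->
  (forall t, 0 < t -> Cmod (f t) <= g t) ->
  exists I, cint_inf f I /\ forall T J, 0 <= T -> cint f 0 T J -> Cmod (I - J) <= l - G T.
Proof.
  intros Hi HG Hd Hc Hle. apply cint_inf_dom; [exact Hi|exact HG|].
  intros a b J Hab HJ. apply (cint_le f g a b J); [lra|exact HJ| |].
  - apply (is_RInt_derive (V := R_CompleteNormedModule) G g); rewrite Rmin_left by lra;
      intros x Hx; [apply Hd; lra|apply Hc; lra].
  - intros x Hx; apply Hle; lra.
Qed.

Lemma is_lim_inv_shift c : is_lim (fun T => - c / (1 + T)) p_infty 0.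
Proof.
  apply is_lim_ext with (fun T => (- c) * / (1 + T)); [reflexivity|].
  replace (Finite 0) with (Rbar_mult (- c) 0) by (simpl; f_equal; ring).
  apply is_lim_scal_l. replace (Finite 0) with (Rbar_inv p_infty) by reflexivity.
  apply is_lim_inv; [|discriminate].
  replace p_infty with (Rbar_plus 1 p_infty) by reflexivity.
  eapply is_lim_plus; [apply is_lim_const|apply is_lim_id|reflexivity].
Qed.

Lemma cint_inf_dom2 f c :
  (forall T, 0 <= T -> cintegrable f 0 T) ->
  (forall t, 0 < t -> Cmod (f t) <= c / (1 + t) ^ 2) ->
  exists I, cint_inf f I /\ forall T J, 0 <= T -> cint f 0 T J -> Cmod (I - J) <= c / (1 + T).
Proof.
  intros Hi Hle.
  destruct (cint_inf_dom_pt f (fun t => c / (1 + t) ^ 2) (fun t => - c / (1 + t)) 0) as [I [H1 H2]];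
    [exact Hi|apply is_lim_inv_shift| | |exact Hle|].
  - intros t Ht. auto_derive; [lra|]. field. lra.
  - intros t Ht. apply ex_derive_Rcontinuous.
    auto_derive. simpl; nra.
  - exists I; split; [exact H1|]. intros T J HT HJ.
    eapply Rle_trans; [apply H2; eassumption|]. right; field; lra.
Qed.

Lemma cint_inf_dom2_le f c I : cint_inf f I ->
  (forall t, 0 < t -> Cmod (f t) <= c / (1 + t) ^ 2) -> Cmod I <= c.
Proof.
  intros H Hle.
  assert (Hc : 0 <= c).
  { assert (A := Hle 1 ltac:(lra)). assert (B := Cmod_ge_0 (f 1)).
    replace (c / (1 + 1) ^ 2) with (c / 4) in A by field. lra. }
  apply (cint_inf_bound f I c H). intros T J HT HJ.
  assert (Hi : is_RInt (fun t => c / (1 + t) ^ 2) 0 T (- c / (1 + T) - (- c / (1 + 0)))).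
  { apply (is_RInt_derive (V := R_CompleteNormedModule) (fun t => - c / (1 + t)));
      rewrite Rmin_left by lra; intros x Hx.
    - auto_derive; [lra|]. field. lra.
    - apply ex_derive_Rcontinuous.
      auto_derive. simpl; nra. }
  eapply Rle_trans; [apply (cint_le f _ 0 T J _ HT HJ Hi)|].
  - intros x Hx; apply Hle; lra.
  - unfold Rdiv at 1. assert (0 < / (1 + T)) by (apply Rinv_0_lt_compat; lra).
    replace (- c / (1 + 0)) with (- c) by field. nra.
Qed.

(** * The exponential, the principal logarithm and the slit plane *)

Lemma Cexp_plus a b : Cexp (a + b) = (Cexp a * Cexp b)%C.
Proof.
  destruct a as [x y], b as [x' y']. unfold Cexp; simpl.
  apply C_ext; unfold Re, Im; simpl; rewrite exp_plus; [rewrite cos_plus|rewrite sin_plus]; ring.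
Qed.

Lemma Cexp_RtoC x : Cexp (RtoC x) = RtoC (exp x).
Proof. unfold Cexp; simpl. rewrite cos_0, sin_0. apply C_ext; unfold Re, Im; simpl; ring. Qed.

Lemma Cexp_0 : Cexp 0 = 1.
Proof. rewrite Cexp_RtoC, exp_0. reflexivity. Qed.

Lemma Cmod_sqr (z : C) : Cmod z * Cmod z = Re z * Re z + Im z * Im z.
Proof. replace (Cmod z * Cmod z) with (Cmod z ^ 2) by ring. rewrite Cmod2_alt; ring. Qed.

Lemma Cmod_Cexp z : Cmod (Cexp z) = exp (Re z).
Proof.
  apply Rsqr_inj; [apply Cmod_ge_0|left; apply exp_pos|]. unfold Rsqr.
  rewrite Cmod_sqr. unfold Cexp; simpl. assert (H := sin2_cos2 (Im z)). unfold Rsqr in H.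
  transitivity (exp (Re z) * exp (Re z) * (sin (Im z) * sin (Im z) + cos (Im z) * cos (Im z)));
    [ring|rewrite H; ring].
Qed.

Lemma Cexp_nz z : Cexp z <> RtoC 0.
Proof. apply Cmod_gt_0. rewrite Cmod_Cexp. apply exp_pos. Qed.

Lemma Cexp_opp z : Cexp (- z) = (/ Cexp z)%C.
Proof.
  assert (H : (Cexp (- z) * Cexp z)%C = RtoC 1).
  { rewrite <- Cexp_plus. replace (- z + z)%C with (RtoC 0) by ring. apply Cexp_0. }
  transitivity (Cexp (- z) * Cexp z * / Cexp z)%C; [field; apply Cexp_nz|].
  rewrite H. ring.
Qed.

Lemma Cexp_nat n z : Cexp (RtoC (INR n) * z) = (Cexp z ^ n)%C.
Proof.
  induction n as [|n IH].
  - simpl. replace (RtoC 0 * z)%C with (RtoC 0) by ring. apply Cexp_0.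
  - rewrite S_INR, RtoC_plus, Cpow_S, <- IH, <- Cexp_plus. f_equal. ring.
Qed.

Lemma Clog_R x : 0 < x -> Clog (RtoC x) = RtoC (ln x).
Proof.
  intros H. unfold Clog, Carg. rewrite Cmod_R, Rabs_pos_eq by lra. simpl.
  destruct (Rle_dec 0 0) as [_|n]; [|lra].
  replace (x / x) with 1 by (field; lra). rewrite acos_1. reflexivity.
Qed.

Lemma Re_div_Cmod z : z <> RtoC 0 -> -1 <= Re z / Cmod z <= 1.
Proof.
  intros H. apply Cmod_gt_0 in H. assert (A := re_le_Cmod z). apply Rabs_le_between in A.
  split; [apply Rle_div_r|apply Rle_div_l]; lra.
Qed.

Lemma Cexp_Clog z : z <> RtoC 0 -> Cexp (Clog z) = z.
Proof.
  intros Hz. assert (Hm := proj1 (Cmod_gt_0 z) Hz). assert (Hr := Re_div_Cmod z Hz).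
  unfold Cexp, Clog; simpl. rewrite exp_ln by exact Hm.
  assert (Hs : sqrt (1 - (Re z / Cmod z)²) = Rabs (Im z) / Cmod z).
  { apply Rsqr_inj.
    - apply sqrt_pos.
    - apply Rdiv_le_0_compat; [apply Rabs_pos|exact Hm].
    - rewrite Rsqr_sqrt; [|unfold Rsqr; nra]. rewrite !Rsqr_div', <- Rsqr_abs.
      unfold Rsqr. replace (Im z * Im z) with (Cmod z * Cmod z - Re z * Re z)
        by (rewrite Cmod_sqr; ring). field. lra. }
  unfold Carg. destruct (Rle_dec 0 (Im z)) as [H|H].
  - rewrite cos_acos, sin_acos, Hs by exact Hr. rewrite Rabs_pos_eq by exact H.
    apply C_ext; unfold Re, Im; simpl; field; lra.
  - rewrite cos_neg, sin_neg, cos_acos, sin_acos, Hs by exact Hr. rewrite Rabs_left by lra.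
    apply C_ext; unfold Re, Im; simpl; field; lra.
Qed.

Lemma slit_plane_pos z : slit_plane z <-> 0 < Re z + Cmod z.
Proof.
  assert (A := re_le_Cmod z). assert (A1 := Rle_abs (- Re z)). rewrite Rabs_Ropp in A1.
  assert (B := Cmod_sqr z). assert (D := Cmod_ge_0 z).
  split; intros H.
  - apply Rnot_le_lt. intros Hle. apply H. split; [|lra].
    assert (E : Cmod z = - Re z) by lra. rewrite E in B.
    apply Rsqr_0_uniq. unfold Rsqr. lra.
  - intros [H1 H2]. rewrite H1 in B. nra.
Qed.

Lemma slit_plane_nz z : slit_plane z -> z <> RtoC 0.
Proof. intros H E. apply H. rewrite E. simpl; lra. Qed.

(** The half-angle formula is smooth across the positive real axis, where the arccosine
    formula changes its branch; it allows Clog to be differentiated on the whole slit plane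
    at once. *)
Lemma Carg_atan z : slit_plane z -> Carg z = 2 * atan (Im z / (Re z + Cmod z)).
Proof.
  intros Hz. assert (Hn := slit_plane_nz z Hz). assert (Hm := proj1 (Cmod_gt_0 z) Hn).
  apply slit_plane_pos in Hz. set (q := Im z / (Re z + Cmod z)).
  assert (Hq : cos (2 * atan q) = Re z / Cmod z).
  { rewrite cos_2a_cos, cos_atan.
    replace (2 * (1 / sqrt (1 + q²)) * (1 / sqrt (1 + q²)))
      with (2 / (sqrt (1 + q²) * sqrt (1 + q²))).
    2:{ field. apply Rgt_not_eq, sqrt_lt_R0. unfold Rsqr; nra. }
    rewrite sqrt_sqrt by (unfold Rsqr; nra).
    assert (E : 1 + q² = 2 * Cmod z / (Re z + Cmod z)).
    { unfold q, Rsqr.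
      transitivity (((Re z + Cmod z) * (Re z + Cmod z) + Im z * Im z) /
                    ((Re z + Cmod z) * (Re z + Cmod z))); [field; lra|].
      replace (Im z * Im z) with (Cmod z * Cmod z - Re z * Re z) by (rewrite Cmod_sqr; ring).
      field. lra. }
    rewrite E. field. lra. }
  assert (Hb := atan_bound q). unfold Carg. destruct (Rle_dec 0 (Im z)) as [H|H].
  - rewrite <- Hq. apply acos_cos. assert (0 <= q) by (apply Rdiv_le_0_compat; lra).
    assert (0 <= atan q).
    { destruct (Req_dec q 0) as [E|E]; [rewrite E, atan_0; lra|].
      rewrite <- atan_0. left. apply atan_increasing. lra. }
    lra.
  - rewrite <- Hq, <- cos_neg, acos_cos; [ring|].
    assert (q < 0).
    { unfold q, Rdiv. assert (0 < / (Re z + Cmod z)) by now apply Rinv_0_lt_compat. nra. }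
    assert (atan q < 0) by (rewrite <- atan_0; apply atan_increasing; lra).
    lra.
Qed.

Lemma cder_Cmod f t l : cder f t l -> f t <> RtoC 0 ->
  is_derive (fun u => Cmod (f u)) t ((Re (f t) * Re l + Im (f t) * Im l) / Cmod (f t)).
Proof.
  intros [H1 H2] Hn. assert (Hp := C_sqr_pos _ Hn).
  assert (Hm := proj1 (Cmod_gt_0 _) Hn).
  apply is_derive_ext with (fun u => sqrt (Re (f u) ^ 2 + Im (f u) ^ 2)); [reflexivity|].
  eapply is_derive_eq.
  - apply (is_derive_comp sqrt (fun u => Re (f u) ^ 2 + Im (f u) ^ 2)).
    + apply is_derive_Reals, derivable_pt_lim_sqrt, Hp.
    + apply is_derive_Rplus; apply (is_derive_pow _ 2); eassumption.
  - change (sqrt (Re (f t) ^ 2 + Im (f t) ^ 2)) with (Cmod (f t)).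
    unfold scal; simpl; unfold mult; simpl. field. lra.
Qed.

Lemma cder_Clog f t l : cder f t l -> slit_plane (f t) ->
  cder (fun u => Clog (f u)) t (l / f t)%C.
Proof.
  intros H Hs. assert (Hn := slit_plane_nz _ Hs). assert (Hm := proj1 (Cmod_gt_0 _) Hn).
  assert (Hd := cder_Cmod _ _ _ H Hn). destruct H as [H1 H2].
  assert (Hp := proj1 (slit_plane_pos _) Hs).
  assert (Hsum := is_derive_Rplus _ _ _ _ _ H1 Hd).
  assert (Hloc : locally t (fun u => 0 < Re (f u) + Cmod (f u))).
  { assert (Hc : continuous (fun u => Re (f u) + Cmod (f u)) t).
    { apply ex_derive_Rcontinuous.
      eexists; exact Hsum. }
    apply Hc. apply (open_gt 0). exact Hp. }
  apply cder_ext_loc with (fun u => (ln (Cmod (f u)), 2 * atan (Im (f u) / (Re (f u) + Cmod (f u))))).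
  { eapply filter_imp; [|exact Hloc]. intros u Hu. unfold Clog. f_equal.
    symmetry. apply Carg_atan. apply slit_plane_pos. exact Hu. }
  set (m := Cmod (f t)) in *. assert (Hsq := Cmod_sqr (f t)). fold m in Hsq.
  split; simpl.
  - eapply is_derive_eq.
    + apply (is_derive_comp ln (fun u => Cmod (f u)));
        [apply is_derive_Reals, derivable_pt_lim_ln; exact Hm|exact Hd].
    + unfold scal; simpl; unfold mult; simpl. fold m.
      replace (fst (f t) * (fst (f t) * 1) + snd (f t) * (snd (f t) * 1)) with (m * m)
        by (rewrite Hsq; unfold Re, Im; ring).
      unfold Re, Im. field. lra.
  - eapply is_derive_eq.
    + apply (is_derive_scal (fun u => atan (Im (f u) / (Re (f u) + Cmod (f u))))).
      apply (is_derive_comp atan).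
      * apply is_derive_atan.
      * apply is_derive_div; [exact H2|exact Hsum|]. fold m. lra.
    + unfold scal; simpl; unfold mult; simpl. fold m.
      replace (fst (f t) * (fst (f t) * 1) + snd (f t) * (snd (f t) * 1)) with (m * m)
        by (rewrite Hsq; unfold Re, Im; ring).
      destruct (f t) as [x y], l as [l1 l2]; unfold Re, Im in *; simpl in *.
      assert (E : 1 + y / (x + m) * (y / (x + m)) = 2 * m / (x + m)).
      { transitivity (((x + m) * (x + m) + y * y) / ((x + m) * (x + m))); [field; lra|].
        replace (y * y) with (m * m - x * x) by lra. field. lra. }
      unfold Rsqr. rewrite Rmult_1_r. rewrite E.
      transitivity ((l2 * (m * m - y * y + x * m) - y * l1 * (x + m)) / (m * m * (x + m)));
        [field; lra|].
      replace (m * m - y * y) with (x * x) by lra. field. lra.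
Qed.

Lemma Re_pos_slit z : 0 < Re z -> slit_plane z.
Proof. intros H [_ H2]; lra. Qed.

Lemma Carg_slit z : z <> RtoC 0 -> Rabs (Carg z) < PI -> slit_plane z.
Proof.
  intros Hn H [H1 H2]. unfold Carg in H. rewrite H1 in H.
  destruct (Rle_dec 0 0) as [_|n]; [|lra].
  assert (E : Cmod z = - Re z).
  { unfold Cmod. fold (Re z) (Im z). rewrite H1. rewrite <- (sqrt_Rsqr (- Re z)) by lra.
    f_equal. unfold Rsqr; simpl; ring. }
  assert (Hr : Re z <> 0).
  { intros E0. apply Hn. apply C_ext; simpl; assumption. }
  rewrite E in H. replace (Re z / - Re z) with (-(1)) in H by (field; lra).
  rewrite acos_opp, acos_1, Rminus_0_r, Rabs_pos_eq in H; [lra|]. left; apply PI_RGT_0.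
Qed.

Lemma Carg_Re_pos z : z <> RtoC 0 -> Rabs (Carg z) < PI / 2 -> 0 < Re z.
Proof.
  intros Hn H. assert (Hm := proj1 (Cmod_gt_0 z) Hn).
  assert (Ha : acos (Re z / Cmod z) < PI / 2).
  { unfold Carg in H. destruct (Rle_dec 0 (Im z)).
    - eapply Rle_lt_trans; [apply Rle_abs|exact H].
    - rewrite Rabs_Ropp in H. eapply Rle_lt_trans; [apply Rle_abs|exact H]. }
  assert (Hr := Re_div_Cmod z Hn).
  assert (Hb := acos_bound (Re z / Cmod z)).
  assert (Hc : 0 < cos (acos (Re z / Cmod z))).
  { apply cos_gt_0; [assert (0 < PI) by apply PI_RGT_0; lra|lra]. }
  rewrite cos_acos in Hc by exact Hr.
  replace (Re z) with (Re z / Cmod z * Cmod z) by (field; lra). nra.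
Qed.

(** A point off the negative axis makes an angle less than pi with the positive
    axis, so positive combinations of 1 and z cannot cancel. *)
Lemma slit_plane_lower z : slit_plane z ->
  exists c, 0 < c /\ forall a b, 0 <= a -> 0 <= b -> c * (a + b) <= Cmod (RtoC a + RtoC b * z).
Proof.
  intros Hz. assert (Hn := slit_plane_nz z Hz). assert (Hm := proj1 (Cmod_gt_0 _) Hn).
  destruct (Rle_dec 0 (Re z)) as [Hr|Hr].
  - (* then |a + b z|^2 >= a^2 + b^2 |z|^2 *)
    set (k := Rmin 1 (Cmod z)).
    assert (Hk : 0 < k) by (apply Rmin_glb_lt; lra).
    assert (Hk1 : k <= 1) by apply Rmin_l. assert (Hk2 : k <= Cmod z) by apply Rmin_r.
    exists (k / 2). split; [lra|]. intros a b Ha Hb.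
    apply Rsqr_incr_0; [|nra|apply Cmod_ge_0]. unfold Rsqr. rewrite Cmod_sqr.
    assert (E : Re (RtoC a + RtoC b * z) = a + b * Re z) by (unfold Re; simpl; ring).
    assert (E' : Im (RtoC a + RtoC b * z) = b * Im z) by (unfold Im; simpl; ring).
    rewrite E, E'. assert (Hsq := Cmod_sqr z).
    replace ((a + b * Re z) * (a + b * Re z) + b * Im z * (b * Im z))
      with (a * a + 2 * (a * b * Re z) + b * b * (Cmod z * Cmod z)) by (rewrite Hsq; ring).
    assert (0 <= a * b * Re z) by (apply Rmult_le_pos; nra).
    assert (k * k <= 1) by nra. assert (k * k <= Cmod z * Cmod z) by nra.
    assert (a * a * (k * k) <= a * a) by nra.
    assert (b * b * (k * k) <= b * b * (Cmod z * Cmod z)) by nra.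
    assert (k / 2 * (a + b) * (k / 2 * (a + b)) <= k * k * (a * a + b * b)); [|nra].
    assert (0 <= k * k) by nra. assert ((a + b) * (a + b) <= 4 * (a * a + b * b)) by nra. nra.
  - (* then Im z <> 0, and the imaginary part controls b, hence a *)
    assert (Hi : 0 < Rabs (Im z)).
    { apply Rabs_pos_lt. intros E. apply Hz. lra. }
    set (i := Rabs (Im z)) in *.
    exists (i / (1 + i + Cmod z)). split; [apply Rdiv_lt_0_compat; lra|]. intros a b Ha Hb.
    set (w := (RtoC a + RtoC b * z)%C).
    assert (H1 : b * i <= Cmod w).
    { eapply Rle_trans; [|apply im_le_Cmod]. right. unfold i.
      rewrite <- (Rabs_pos_eq b) at 1 by exact Hb. rewrite <- Rabs_mult. f_equal.
      unfold w, Im; simpl; ring. }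
    assert (H2 : a - b * Cmod z <= Cmod w).
    { assert (A := Cmod_rev_triangle (RtoC a) (RtoC b * z)).
      rewrite Cmod_mult, !Cmod_R, !Rabs_pos_eq in A by assumption. exact A. }
    apply Rmult_le_reg_r with (1 + i + Cmod z); [lra|].
    replace (i / (1 + i + Cmod z) * (a + b) * (1 + i + Cmod z)) with (i * (a + b)) by (field; lra).
    nra.
Qed.

Lemma slit_plane_comb z a b : slit_plane z -> 0 <= a -> 0 <= b -> 0 < a + b ->
  slit_plane (RtoC a + RtoC b * z).
Proof.
  intros Hz Ha Hb Hab [H1 H2].
  assert (H1' : b * Im z = 0) by (rewrite <- H1; unfold Im; simpl; ring).
  assert (H2' : a + b * Re z <= 0).
  { replace (a + b * Re z) with (Re (RtoC a + RtoC b * z)) by (unfold Re; simpl; ring). exact H2. }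
  apply Rmult_integral in H1'. destruct H1' as [E|E]; [subst b; lra|].
  apply Hz. split; [exact E|]. apply Rnot_lt_le. intros Hr.
  assert (0 <= b * Re z) by nra. destruct (Req_dec b 0); [subst; lra|]. nra.
Qed.

Lemma slit_plane_add z t : slit_plane z -> 0 <= t -> slit_plane (RtoC t + z).
Proof.
  intros Hz Ht. replace (RtoC t + z)%C with (RtoC t + RtoC 1 * z)%C by ring.
  apply slit_plane_comb; auto; lra.
Qed.

(** * Bernoulli polynomials *)

Lemma bernoulli_upto_stable n k : (k <= n)%nat -> bernoulli_upto n k = bernoulli k.
Proof.
  intros H. induction H as [|n H IH]; [reflexivity|].
  rewrite <- IH. simpl. apply Nat.leb_le in H. now rewrite H.
Qed.

Lemma binomial_pred_top n : Binomial.C (S n) n = INR (S n).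
Proof.
  unfold Binomial.C. replace (S n - n)%nat with 1%nat by lia. rewrite fact_simpl, mult_INR.
  simpl (fact 1). simpl (INR 1). field. apply INR_fact_neq_0.
Qed.

Lemma binomial_top n : Binomial.C n n = 1.
Proof.
  unfold Binomial.C. rewrite Nat.sub_diag. simpl. field. apply INR_fact_neq_0.
Qed.

Lemma bernoulli_sum m : sum_f_R0 (fun j => Binomial.C (m + 2) j * bernoulli j) (m + 1) = 0.
Proof.
  replace (m + 1)%nat with (S m) by lia. rewrite tech5.
  assert (E : bernoulli (S m) = - sum_f_R0 (fun j => Binomial.C (m + 2) j * bernoulli j) m
                                  / INR (m + 2)).
  { unfold bernoulli at 1. change (bernoulli_upto (S m) (S m)) with
      (if Nat.leb (S m) m then bernoulli_upto m (S m)
       else - sum_f_R0 (fun j => Binomial.C (m + 2) j * bernoulli_upto m j) m / INR (m + 2)).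
    replace (Nat.leb (S m) m) with false by (symmetry; apply Nat.leb_gt; lia).
    do 2 f_equal. apply sum_eq. intros i Hi. now rewrite bernoulli_upto_stable. }
  rewrite E. replace (m + 2)%nat with (S (S m)) by lia. rewrite binomial_pred_top.
  field. apply not_0_INR; lia.
Qed.

Lemma is_derive_sum_f (f df : nat -> R -> R) x n :
  (forall k, (k <= n)%nat -> is_derive (f k) x (df k x)) ->
  is_derive (fun y => sum_f_R0 (fun k => f k y) n) x (sum_f_R0 (fun k => df k x) n).
Proof.
  induction n as [|n IH]; intros H; simpl.
  - apply H; lia.
  - apply is_derive_Rplus; [apply IH; intros; apply H; lia|apply H; lia].
Qed.

Lemma is_derive_bernoulli_poly n x :
  is_derive (bernoulli_poly (S n)) x (INR (S n) * bernoulli_poly n x).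
Proof.
  unfold bernoulli_poly.
  eapply is_derive_eq.
  - apply is_derive_sum_f with
      (df := fun k x => Binomial.C (S n) k * bernoulli k * (INR (S n - k) * x ^ pred (S n - k))).
    intros k Hk. apply is_derive_Reals, derivable_pt_lim_scal, derivable_pt_lim_pow.
  - rewrite tech5, Nat.sub_diag, scal_sum. simpl (INR 0). rewrite Rmult_0_l, Rmult_0_r, Rplus_0_r.
    apply sum_eq. intros k Hk. replace (pred (S n - k)) with (n - k)%nat by lia.
    unfold Binomial.C. replace (S n - k)%nat with (S (n - k)) by lia.
    rewrite !fact_simpl, !mult_INR. field.
    repeat split; try apply INR_fact_neq_0. apply not_0_INR; lia.
Qed.

Lemma continuous_bernoulli_poly n x : continuous (bernoulli_poly n) x.
Proof.
  destruct n as [|n].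
  - apply continuous_ext with (fun _ => bernoulli_poly 0 0); [|apply continuous_const].
    intros y. unfold bernoulli_poly; simpl. reflexivity.
  - apply ex_derive_Rcontinuous.
    eexists; apply is_derive_bernoulli_poly.
Qed.

Lemma bernoulli_poly_0 n : bernoulli_poly n 0 = bernoulli n.
Proof.
  unfold bernoulli_poly. destruct n as [|n].
  - simpl. rewrite binomial_top. ring.
  - rewrite tech5, Nat.sub_diag, binomial_top.
    rewrite (sum_eq _ (fun _ => 0)); [rewrite sum_cte; simpl; ring|].
    intros i Hi. rewrite pow_i by lia. ring.
Qed.

Lemma bernoulli_poly_1 n : (2 <= n)%nat -> bernoulli_poly n 1 = bernoulli n.
Proof.
  intros H. destruct n as [|[|m]]; try lia. unfold bernoulli_poly.
  rewrite (sum_eq _ (fun k => Binomial.C (m + 2) k * bernoulli k)).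
  2:{ intros i Hi. rewrite pow1. replace (S (S m)) with (m + 2)%nat by lia. ring. }
  replace (S (S m)) with (S (m + 1)) by lia. rewrite tech5, bernoulli_sum.
  replace (m + 2)%nat with (S (m + 1)) by lia. rewrite binomial_top. ring.
Qed.

Lemma bernoulli_0 : bernoulli 0 = 1.
Proof. reflexivity. Qed.

Lemma bernoulli_1 : bernoulli 1 = - / 2.
Proof. unfold bernoulli; simpl. unfold Binomial.C; simpl. field. Qed.

Lemma bernoulli_2 : bernoulli 2 = / 6.
Proof. unfold bernoulli; simpl. unfold Binomial.C; simpl. field. Qed.

Lemma bernoulli_poly_0_E x : bernoulli_poly 0 x = 1.
Proof. unfold bernoulli_poly; simpl. rewrite bernoulli_0, binomial_top. ring. Qed.

Lemma bernoulli_poly_1_E x : bernoulli_poly 1 x = x - / 2.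
Proof.
  unfold bernoulli_poly; simpl. rewrite bernoulli_0, bernoulli_1.
  unfold Binomial.C; simpl. field.
Qed.

(** ** Fourier expansion *)

Definition fourier_sum (n M : nat) (x : R) : R :=
  sum_f_R0 (fun k => cos (2 * PI * INR (S k) * x - INR n * PI / 2) / INR (S k) ^ n) M.

(** The partial Fourier sum minus its expected limit. With this weight the derivative
    at level n+1 is 2 pi times the gap at level n, so bounds climb from level to level. *)
Definition fourier_gap (n M : nat) (x : R) : R :=
  fourier_sum n M x + bernoulli_poly n x * ((2 * PI) ^ n / (2 * INR (fact n))).

Lemma INR_S_pos k : 0 < INR (S k).
Proof. apply lt_0_INR; lia. Qed.

Lemma is_derive_cos_affine (c d x : R) :
  is_derive (fun y => cos (c * y - d)) x (- sin (c * x - d) * c).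
Proof. auto_derive; [exact I|unfold Rminus; ring]. Qed.

Lemma is_derive_fourier_gap n M x :
  is_derive (fourier_gap (S n) M) x (2 * PI * fourier_gap n M x).
Proof.
  unfold fourier_gap, fourier_sum. eapply is_derive_eq.
  - apply is_derive_Rplus.
    + apply is_derive_sum_f with (df := fun k x =>
        cos (2 * PI * INR (S k) * x - INR n * PI / 2) / INR (S k) ^ n * (2 * PI)).
      intros k _. assert (Hk := INR_S_pos k). assert (Hp := pow_lt _ n Hk).
      eapply is_derive_eq.
      * apply is_derive_Reals.
        apply (derivable_pt_lim_div (fun y => cos (2 * PI * INR (S k) * y - INR (S n) * PI / 2))
                 (fun _ => INR (S k) ^ S n) x
                 (- sin (2 * PI * INR (S k) * x - INR (S n) * PI / 2) * (2 * PI * INR (S k))) 0);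
          [|apply derivable_pt_lim_const|apply Rgt_not_eq, pow_lt, Hk].
        apply is_derive_Reals, is_derive_cos_affine.
      * replace (2 * PI * INR (S k) * x - INR (S n) * PI / 2)
          with ((2 * PI * INR (S k) * x - INR n * PI / 2) - PI / 2)
          by (rewrite (S_INR n); field).
        rewrite (sin_minus _ (PI / 2)), cos_PI2, sin_PI2. unfold Rsqr. rewrite <- tech_pow_Rmult.
        to_R.
        field. split; apply Rgt_not_eq; assumption.
    + apply is_derive_Rmult; [apply is_derive_bernoulli_poly|apply is_derive_Rconst].
  - rewrite Rmult_0_r, Rplus_0_r, <- scal_sum, fact_simpl, mult_INR, <- (tech_pow_Rmult (2 * PI)).
    to_R. field. split; [apply INR_fact_neq_0|apply Rgt_not_eq, INR_S_pos].
Qed.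

Lemma continuous_fourier_gap n M x : continuous (fourier_gap (S n) M) x.
Proof.
  apply ex_derive_Rcontinuous.
  eexists; apply is_derive_fourier_gap.
Qed.

Lemma cos_shift_nat x k : cos (2 * PI * INR k + x) = cos x.
Proof.
  replace (2 * PI * INR k + x) with (x + 2 * INR k * PI) by ring. apply cos_period.
Qed.

Lemma fourier_gap_periodic n M : (2 <= n)%nat -> fourier_gap n M 1 = fourier_gap n M 0.
Proof.
  intros H. unfold fourier_gap, fourier_sum.
  rewrite bernoulli_poly_1, bernoulli_poly_0 by exact H. f_equal.
  apply sum_eq. intros k _. f_equal.
  replace (2 * PI * INR (S k) * 1 - INR n * PI / 2) with (2 * PI * INR (S k) + - (INR n * PI / 2)) by ring.
  rewrite cos_shift_nat. f_equal. ring.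
Qed.

(** Rolle: up to a factor, the gap at level n is the derivative of the gap at level
    n+1, which takes the same value at 0 and at 1. *)
Lemma fourier_gap_zero n M : (1 <= n)%nat -> exists y, 0 < y < 1 /\ fourier_gap n M y = 0.
Proof.
  intros H.
  destruct (Rmvt (fourier_gap (S n) M) (fun x => 2 * PI * fourier_gap n M x) 0 1) as [c [Hc E]].
  - lra.
  - intros x _. apply is_derive_fourier_gap.
  - intros x _. apply continuous_fourier_gap.
  - exists c. split; [exact Hc|]. rewrite fourier_gap_periodic in E by lia.
    assert (Hpi := PI_RGT_0). nra.
Qed.

Lemma Rmvt_bound (f df : R -> R) a b B :
  (forall x, Rmin a b < x < Rmax a b -> is_derive f x (df x)) ->
  (forall x, Rmin a b <= x <= Rmax a b -> continuous f x) ->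
  (forall x, Rmin a b < x < Rmax a b -> Rabs (df x) <= B) -> Rabs (f b - f a) <= B * Rabs (b - a).
Proof.
  assert (W : forall u v, u < v -> (forall x, u < x < v -> is_derive f x (df x)) ->
     (forall x, u <= x <= v -> continuous f x) ->
     (forall x, u < x < v -> Rabs (df x) <= B) -> Rabs (f v - f u) <= B * Rabs (v - u)).
  { intros u v Huv H1 H2 H3. destruct (Rmvt f df u v Huv H1 H2) as [c [Hc E]].
    rewrite E, Rabs_mult. apply Rmult_le_compat_r; [apply Rabs_pos|apply H3, Hc]. }
  intros H1 H2 H3. destruct (Rtotal_order a b) as [H|[H|H]].
  - rewrite Rmin_left, Rmax_right in * by lra. now apply W.
  - subst. rewrite !Rminus_diag, Rabs_R0. lra.
  - rewrite Rmin_right, Rmax_left in * by lra.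
    rewrite Rabs_minus_sym, (Rabs_minus_sym b). now apply W.
Qed.

Lemma dirichlet_kernel M x :
  sin (PI * x) * (1 + 2 * sum_f_R0 (fun k => cos (2 * PI * INR (S k) * x)) M)
  = sin ((2 * INR (S M) + 1) * PI * x).
Proof.
  assert (H : forall k : R, 2 * (sin (PI * x) * cos (2 * PI * k * x))
     = sin ((2 * k + 1) * PI * x) - sin ((2 * k - 1) * PI * x)).
  { intros k. replace ((2 * k + 1) * PI * x) with (2 * PI * k * x + PI * x) by ring.
    replace ((2 * k - 1) * PI * x) with (2 * PI * k * x - PI * x) by ring.
    rewrite sin_plus, sin_minus. ring. }
  induction M as [|M IH].
  - simpl sum_f_R0. assert (H1 := H (INR 1)). simpl (INR 1) in *.
    rewrite Rmult_plus_distr_l. replace ((2 * 1 - 1) * PI * x) with (PI * x) in H1 by ring. lra.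
  - rewrite tech5. assert (H1 := H (INR (S (S M)))).
    replace ((2 * INR (S (S M)) - 1) * PI * x) with ((2 * INR (S M) + 1) * PI * x) in H1
      by (rewrite (S_INR (S M)); ring).
    transitivity (sin (PI * x) * (1 + 2 * sum_f_R0 (fun k => cos (2 * PI * INR (S k) * x)) M)
       + 2 * (sin (PI * x) * cos (2 * PI * INR (S (S M)) * x))); [ring|].
    rewrite IH, H1. ring.
Qed.

Lemma fourier_gap_0_E M x : fourier_gap 0 M x =
  sum_f_R0 (fun k => cos (2 * PI * INR (S k) * x)) M + / 2.
Proof.
  unfold fourier_gap, fourier_sum. rewrite bernoulli_poly_0_E. simpl (fact 0). f_equal.
  - apply sum_eq. intros k _. simpl (INR 0). simpl pow. rewrite Rdiv_1_r. f_equal. field.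
  - simpl. field.
Qed.

Lemma fourier_gap_1_half M : fourier_gap 1 M (/ 2) = 0.
Proof.
  unfold fourier_gap, fourier_sum. rewrite bernoulli_poly_1_E.
  rewrite (sum_eq _ (fun _ => 0)); [rewrite sum_cte; ring|].
  intros k _. replace (2 * PI * INR (S k) * / 2 - INR 1 * PI / 2) with (INR (S k) * PI - PI / 2)
    by (simpl (INR 1); field).
  rewrite cos_minus, cos_PI2, sin_PI2.
  assert (E : forall j, sin (INR j * PI) = 0).
  { intros j. apply sin_eq_0_1. exists (Z.of_nat j). now rewrite <- INR_IZR_INZ. }
  rewrite E. unfold Rdiv; ring.
Qed.

(** By the Dirichlet kernel, the derivative of the gap is pi sin(K pi x) / sin(pi x) with
    K = 2M+3, and the gap vanishes at 1/2. Integrating from there and by parts once leaves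
    O(1/K) away from the integers. *)
Lemma fourier_gap_1_bound a : 0 < a < 1 -> exists B, 0 < B /\
  forall M x, Rmin a (1 - a) <= x <= Rmax a (1 - a) -> Rabs (fourier_gap 1 M x) <= B / INR (S M).
Proof.
  intros Ha. assert (Hpi := PI_RGT_0).
  set (a0 := Rmin a (1 - a)). set (a1 := Rmax a (1 - a)).
  assert (Ha1 : a1 = 1 - a0).
  { unfold a0, a1. destruct (Rle_dec a (1 - a)).
    - rewrite Rmin_left, Rmax_right by lra. lra.
    - rewrite Rmin_right, Rmax_left by lra. lra. }
  assert (Ha0 : 0 < a0 <= / 2).
  { unfold a0. split; [apply Rmin_glb_lt; lra|]. destruct (Rle_dec a (1 - a)).
    - rewrite Rmin_left by lra. lra.
    - rewrite Rmin_right by lra. lra. }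
  clearbody a0 a1. subst a1.
  set (s := sin (PI * a0)).
  assert (Hs : 0 < s) by (apply sin_gt_0; nra).
  assert (Hsin : forall x, a0 <= x <= 1 - a0 -> s <= sin (PI * x)).
  { intros x Hx. destruct (Rle_dec x (/ 2)).
    - apply sin_incr_1; nra.
    - replace (PI * x) with (PI - PI * (1 - x)) by ring. rewrite sin_PI_x.
      apply sin_incr_1; nra. }
  exists (PI / (s * s) + / s). split.
  { apply Rplus_lt_0_compat; [apply Rdiv_lt_0_compat; nra|now apply Rinv_0_lt_compat]. }
  intros M x Hx. set (K := 2 * INR (S M) + 1).
  assert (HM := INR_S_pos M). assert (HK : INR (S M) <= K) by (unfold K; lra).
  assert (HK0 : 0 < K) by lra.
  (* the gap without the boundary term of that integration by parts *)
  set (W := fun y => fourier_gap 1 M y + cos (K * PI * y) / (K * sin (PI * y))).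
  assert (HW : forall y, a0 <= y <= 1 - a0 -> is_derive W y
     (- (PI / K) * cos (K * PI * y) * cos (PI * y) / (sin (PI * y) * sin (PI * y)))).
  { intros y Hy. assert (Hsy := Hsin y Hy). eapply is_derive_eq.
    - apply is_derive_Rplus; [apply is_derive_fourier_gap|].
      apply (is_derive_div (fun y => cos (K * PI * y)) (fun y => K * sin (PI * y)) y
               (- sin (K * PI * y) * (K * PI)) (K * (cos (PI * y) * PI))).
      + auto_derive; [exact I|unfold K; ring].
      + auto_derive; [exact I|unfold K; ring].
      + nra.
    - rewrite fourier_gap_0_E. assert (Hd := dirichlet_kernel M y). fold K in Hd.
      rewrite <- Hd. to_R. field. split; lra. }
  assert (HWh : W (/ 2) = 0).
  { unfold W. rewrite fourier_gap_1_half.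
    replace (K * PI * / 2) with (PI / 2 + INR (S M) * PI) by (unfold K; field).
    replace (cos (PI / 2 + INR (S M) * PI)) with 0; [unfold Rdiv; ring|].
    symmetry. apply cos_eq_0_1. exists (Z.of_nat (S M)). rewrite <- INR_IZR_INZ. ring. }
  assert (Hxx : Rmin (/ 2) x >= a0 /\ Rmax (/ 2) x <= 1 - a0).
  { split; [apply Rle_ge, Rmin_glb; lra|apply Rmax_lub; lra]. }
  assert (HWx : Rabs (W x - W (/ 2)) <= PI / K / (s * s) * Rabs (x - / 2)).
  { apply (Rmvt_bound W (fun y => - (PI / K) * cos (K * PI * y) * cos (PI * y) / (sin (PI * y) * sin (PI * y)))).
    - intros y Hy. apply HW; lra.
    - intros y Hy. apply ex_derive_Rcontinuous.
      eexists; apply HW; lra.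
    - intros y Hy. assert (Hsy := Hsin y ltac:(lra)).
      unfold Rdiv at 1. rewrite !Rabs_mult, Rabs_Ropp.
      rewrite (Rabs_pos_eq (PI / K)) by (apply Rdiv_le_0_compat; lra).
      rewrite Rabs_inv, (Rabs_pos_eq (_ * _)) by nra.
      assert (C1 : Rabs (cos (K * PI * y)) <= 1) by (apply Rabs_le; apply COS_bound).
      assert (C2 : Rabs (cos (PI * y)) <= 1) by (apply Rabs_le; apply COS_bound).
      apply Rmult_le_compat.
      + apply Rmult_le_pos; [apply Rmult_le_pos|]; try apply Rabs_pos. apply Rdiv_le_0_compat; lra.
      + left; apply Rinv_0_lt_compat; nra.
      + rewrite <- (Rmult_1_r (PI / K)) at 2. rewrite Rmult_assoc. apply Rmult_le_compat_l.
        * apply Rdiv_le_0_compat; lra.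
        * assert (P1 := Rabs_pos (cos (K * PI * y))). assert (P2 := Rabs_pos (cos (PI * y))). nra.
      + apply Rinv_le_contravar; nra. }
  rewrite HWh, Rminus_0_r in HWx.
  assert (Hc : Rabs (cos (K * PI * x) / (K * sin (PI * x))) <= / s / K).
  { assert (Hsx := Hsin x Hx). unfold Rdiv. rewrite Rabs_mult, Rabs_inv, (Rabs_pos_eq (_ * sin _)) by nra.
    replace (/ s * / K) with (1 * / (K * s)) by (field; lra).
    apply Rmult_le_compat; [apply Rabs_pos|left; apply Rinv_0_lt_compat; nra| |].
    - apply Rabs_le, COS_bound.
    - apply Rinv_le_contravar; nra. }
  assert (Hg : Rabs (fourier_gap 1 M x) <= PI / K / (s * s) + / s / K).
  { replace (fourier_gap 1 M x) with (W x + - (cos (K * PI * x) / (K * sin (PI * x))))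
      by (unfold W; ring).
    eapply Rle_trans; [apply Rabs_triang|]. rewrite Rabs_Ropp. apply Rplus_le_compat; [|exact Hc].
    eapply Rle_trans; [exact HWx|]. rewrite <- Rmult_1_r. apply Rmult_le_compat_l.
    - apply Rdiv_le_0_compat; [apply Rdiv_le_0_compat; lra|nra].
    - apply Rabs_le; lra. }
  eapply Rle_trans; [exact Hg|].
  replace (PI / K / (s * s) + / s / K) with ((PI / (s * s) + / s) * / K) by (field; lra).
  apply Rmult_le_compat_l.
  - left. apply Rplus_lt_0_compat; [apply Rdiv_lt_0_compat; nra|now apply Rinv_0_lt_compat].
  - apply Rinv_le_contravar; lra.
Qed.

Lemma inv_square_telescope k : / INR (S (S k)) ^ 2 <= / INR (S k) - / INR (S (S k)).
Proof.
  assert (H := INR_S_pos k). rewrite (S_INR (S k)). set (u := INR (S k)) in *.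
  replace (/ u - / (u + 1)) with (/ (u * (u + 1))) by (field; lra).
  apply Rinv_le_contravar; nra.
Qed.

Lemma telescoping_partial (u : nat -> R) c M d :
  (forall k, Rabs (u (S k)) <= c * (/ INR (S k) - / INR (S (S k)))) ->
  Rabs (sum_f_R0 u (M + d) - sum_f_R0 u M) <= c * (/ INR (S M) - / INR (S (M + d))).
Proof.
  intros H. induction d as [|d IH].
  - rewrite Nat.add_0_r, !Rminus_diag, Rabs_R0. lra.
  - replace (M + S d)%nat with (S (M + d)) by lia. rewrite tech5.
    replace (sum_f_R0 u (M + d) + u (S (M + d)) - sum_f_R0 u M)
      with (sum_f_R0 u (M + d) - sum_f_R0 u M + u (S (M + d))) by ring.
    eapply Rle_trans; [apply Rabs_triang|]. specialize (H (M + d)%nat). lra.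
Qed.

Lemma fourier_gap_2_tail M M' x : (M <= M')%nat ->
  Rabs (fourier_gap 2 M' x - fourier_gap 2 M x) <= / INR (S M).
Proof.
  intros H. replace M' with (M + (M' - M))%nat by lia. unfold fourier_gap.
  match goal with |- Rabs ?a <= _ => replace a with
    (fourier_sum 2 (M + (M' - M)) x - fourier_sum 2 M x) by ring end.
  eapply Rle_trans; [apply (telescoping_partial _ 1)|].
  - intros k. assert (Ht := inv_square_telescope k). assert (Hk := INR_S_pos (S k)).
    unfold Rdiv. rewrite Rabs_mult, Rabs_inv, (Rabs_pos_eq (_ ^ 2)) by (apply pow_le; lra).
    assert (Hc : Rabs (cos (2 * PI * INR (S (S k)) * x - INR 2 * PI / 2)) <= 1)
      by apply Rabs_le, COS_bound.
    apply Rmult_le_compat; [apply Rabs_pos|left; apply Rinv_0_lt_compat, pow_lt, Hk|exact Hc|exact Ht].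
  - assert (0 < / INR (S (M + (M' - M)))) by apply Rinv_0_lt_compat, INR_S_pos. lra.
Qed.

Lemma inv_INR_S_small eps : 0 < eps -> exists N, forall n, (N <= n)%nat -> / INR (S n) < eps.
Proof.
  intros H. destruct (archimed_cor1 eps H) as [N [H1 H2]]. exists N. intros n Hn.
  eapply Rlt_trans; [|exact H1]. apply Rinv_lt_contravar.
  - apply Rmult_lt_0_compat; apply lt_0_INR; lia.
  - apply lt_INR; lia.
Qed.

(** The limit of the gap is constant on (0,1), because its derivative tends to 0
    there, and the zeros supplied by periodicity make the constant vanish. *)
Lemma fourier_gap_2_bound M x : 0 < x < 1 -> Rabs (fourier_gap 2 M x) <= / INR (S M).
Proof.
  intros Hx. apply le_epsilon. intros eps Heps.
  destruct (inv_INR_S_small (eps / 2) ltac:(lra)) as [N HN].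
  destruct (fourier_gap_zero 2 N ltac:(lia)) as [y [Hy Ey]].
  set (a := Rmin (Rmin x (1 - x)) (Rmin y (1 - y))).
  assert (A1 : a <= Rmin x (1 - x)) by apply Rmin_l. assert (A2 : a <= Rmin y (1 - y)) by apply Rmin_r.
  assert (A3 := Rmin_l x (1 - x)). assert (A4 := Rmin_r x (1 - x)).
  assert (A5 := Rmin_l y (1 - y)). assert (A6 := Rmin_r y (1 - y)).
  assert (Ha : 0 < a) by (repeat apply Rmin_glb_lt; lra).
  destruct (fourier_gap_1_bound a ltac:(lra)) as [B [HB HB1]].
  rewrite Rmin_left, Rmax_right in HB1 by lra.
  assert (Hpi := PI_RGT_0).
  destruct (inv_INR_S_small (eps / 2 / (2 * PI * B))) as [N' HN'].
  { apply Rdiv_lt_0_compat; nra. }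
  set (M' := (M + N + N')%nat).
  assert (Hxy : Rabs (fourier_gap 2 M' x - fourier_gap 2 M' y) <= 2 * PI * (B / INR (S M')) * Rabs (x - y)).
  { apply (Rmvt_bound (fourier_gap 2 M') (fun u => 2 * PI * fourier_gap 1 M' u)).
    - intros u _. apply is_derive_fourier_gap.
    - intros u _. apply continuous_fourier_gap.
    - intros u Hu. rewrite Rabs_mult, (Rabs_pos_eq (2 * PI)) by lra.
      apply Rmult_le_compat_l; [lra|]. apply HB1.
      destruct Hu as [Hu1 Hu2].
      assert (a <= Rmin y x) by (apply Rmin_glb; lra).
      assert (Rmax y x <= 1 - a) by (apply Rmax_lub; lra). lra. }
  assert (Hxy1 : Rabs (x - y) <= 1) by (apply Rabs_le; lra).
  assert (Hs : 2 * PI * (B / INR (S M')) <= eps / 2).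
  { specialize (HN' M' ltac:(lia)). left.
    apply Rmult_lt_compat_l with (r := 2 * PI * B) in HN'; [|nra].
    replace (2 * PI * B * (eps / 2 / (2 * PI * B))) with (eps / 2) in HN' by (field; lra).
    unfold Rdiv in *. lra. }
  assert (H0 : 0 <= 2 * PI * (B / INR (S M'))).
  { assert (0 < / INR (S M')) by apply Rinv_0_lt_compat, INR_S_pos. unfold Rdiv.
    apply Rmult_le_pos; nra. }
  assert (T1 := fourier_gap_2_tail M M' x ltac:(lia)).
  assert (T2 := fourier_gap_2_tail N M' y ltac:(lia)). rewrite Ey, Rminus_0_r in T2.
  specialize (HN N (le_n _)).
  assert (P1 := Rabs_pos (x - y)).
  replace (fourier_gap 2 M x) with (- (fourier_gap 2 M' x - fourier_gap 2 M x)
     + ((fourier_gap 2 M' x - fourier_gap 2 M' y) + fourier_gap 2 M' y)) by ring.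
  eapply Rle_trans; [apply Rabs_triang|]. rewrite Rabs_Ropp.
  eapply Rle_trans; [apply Rplus_le_compat_l, Rabs_triang|]. nra.
Qed.

(** The mean value theorem between x and a zero of the gap loses only the factor 2 pi. *)
Lemma fourier_gap_bound n M x : 0 < x < 1 ->
  Rabs (fourier_gap (n + 2) M x) <= (2 * PI) ^ n / INR (S M).
Proof.
  assert (Hpi := PI_RGT_0). assert (HM := INR_S_pos M).
  revert x; induction n as [|n IH]; intros x Hx.
  - simpl ((2 * PI) ^ 0). rewrite Rdiv_1_l. now apply fourier_gap_2_bound.
  - destruct (fourier_gap_zero (S n + 2) M ltac:(lia)) as [y [Hy Ey]].
    assert (A := Rmvt_bound (fourier_gap (S n + 2) M) (fun u => 2 * PI * fourier_gap (n + 2) M u)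
                   y x (2 * PI * ((2 * PI) ^ n / INR (S M)))).
    rewrite Ey, Rminus_0_r in A.
    assert (Hq : 0 <= 2 * PI * ((2 * PI) ^ n / INR (S M))).
    { apply Rmult_le_pos; [lra|]. apply Rdiv_le_0_compat; [apply pow_le; lra|exact HM]. }
    eapply Rle_trans; [apply A|].
    + intros u _. apply is_derive_fourier_gap.
    + intros u _. apply continuous_fourier_gap.
    + intros u Hu. rewrite Rabs_mult, (Rabs_pos_eq (2 * PI)) by lra.
      apply Rmult_le_compat_l; [lra|]. apply IH.
      assert (0 <= Rmin y x) by (apply Rmin_glb; lra).
      assert (Rmax y x <= 1) by (apply Rmax_lub; lra). lra.
    + assert (Rabs (x - y) <= 1) by (apply Rabs_le; lra).
      replace ((2 * PI) ^ S n / INR (S M)) with (2 * PI * ((2 * PI) ^ n / INR (S M)) * 1)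
        by (rewrite <- tech_pow_Rmult; field; lra).
      now apply Rmult_le_compat_l.
Qed.

(** At an end point the bound follows from the one inside by continuity. *)
Lemma fourier_gap_bound_0 n M : Rabs (fourier_gap (n + 2) M 0) <= (2 * PI) ^ n / INR (S M).
Proof.
  set (B := (2 * PI) ^ n / INR (S M)). apply le_epsilon. intros eps Heps.
  assert (Hc := continuous_fourier_gap (S n) M 0). replace (S (S n)) with (n + 2)%nat in Hc by lia.
  apply continuity_pt_filterlim in Hc. destruct (Hc eps Heps) as [d [Hd Hd2]].
  set (x := Rmin (d / 2) (/ 2)).
  assert (Hx : 0 < x) by (apply Rmin_glb_lt; lra).
  assert (Hx1 : x <= d / 2) by apply Rmin_l. assert (Hx2 : x <= / 2) by apply Rmin_r.
  specialize (Hd2 x). simpl in Hd2. unfold Rdist in Hd2.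
  assert (H1 : Rabs (fourier_gap (n + 2) M x - fourier_gap (n + 2) M 0) < eps).
  { apply Hd2. split; [split; [exact I|lra]|]. rewrite Rminus_0_r, Rabs_pos_eq; lra. }
  assert (H2 := fourier_gap_bound n M x ltac:(lra)). fold B in H2.
  replace (fourier_gap (n + 2) M 0) with (fourier_gap (n + 2) M x +
    - (fourier_gap (n + 2) M x - fourier_gap (n + 2) M 0)) by ring.
  eapply Rle_trans; [apply Rabs_triang|]. rewrite Rabs_Ropp. lra.
Qed.

Lemma is_lim_seq_inv_INR_S : is_lim_seq (fun n => / INR (S n)) 0.
Proof.
  apply is_lim_seq_spec. intros eps. destruct (inv_INR_S_small eps (cond_pos eps)) as [N HN].
  exists N. intros n Hn. rewrite Rminus_0_r, Rabs_pos_eq; [now apply HN|].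
  left; apply Rinv_0_lt_compat, INR_S_pos.
Qed.

Lemma fourier_sum_0_lim n : is_lim_seq (fun M => fourier_sum (n + 2) M 0)
  (- (bernoulli (n + 2) * ((2 * PI) ^ (n + 2) / (2 * INR (fact (n + 2)))))).
Proof.
  apply is_lim_seq_of_abs with (fun M => (2 * PI) ^ n * / INR (S M)).
  - intros M. assert (H := fourier_gap_bound_0 n M). unfold fourier_gap in H.
    rewrite bernoulli_poly_0 in H.
    match goal with |- Rabs ?a <= _ => match type of H with Rabs ?b <= _ =>
      replace a with b by ring end end. exact H.
  - replace (Finite 0) with (Finite ((2 * PI) ^ n * 0)) by (f_equal; ring).
    apply is_lim_seq_mult'; [apply is_lim_seq_const|apply is_lim_seq_inv_INR_S].
Qed.

(** Every term of the Fourier series of odd level vanishes at 0. *)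
Lemma bernoulli_odd n : bernoulli (2 * n + 3) = 0.
Proof.
  assert (H := fourier_sum_0_lim (2 * n + 1)).
  replace (2 * n + 1 + 2)%nat with (2 * n + 3)%nat in H by lia.
  assert (H0 : is_lim_seq (fun M => fourier_sum (2 * n + 3) M 0) 0).
  { apply is_lim_seq_ext with (fun _ => 0); [|apply is_lim_seq_const].
    intros M. unfold fourier_sum. rewrite (sum_eq _ (fun _ => 0)); [rewrite sum_cte; ring|].
    intros k _. rewrite Rmult_0_r, Rminus_0_l, cos_neg.
    replace (cos (INR (2 * n + 3) * PI / 2)) with 0; [unfold Rdiv; ring|].
    symmetry. apply cos_eq_0_1. exists (Z.of_nat (n + 1)). rewrite <- INR_IZR_INZ, !plus_INR, mult_INR.
    simpl (INR 2); simpl (INR 3); simpl (INR 1). field. }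
  apply is_lim_seq_unique in H, H0. rewrite H0 in H. apply (f_equal real) in H.
  change (0 = - (bernoulli (2 * n + 3) * ((2 * PI) ^ (2 * n + 3) / (2 * INR (fact (2 * n + 3)))))) in H.
  assert (Hp : 0 < (2 * PI) ^ (2 * n + 3) / (2 * INR (fact (2 * n + 3)))).
  { apply Rdiv_lt_0_compat; [apply pow_lt; assert (A := PI_RGT_0); lra|].
    assert (A := INR_fact_lt_0 (2 * n + 3)). lra. }
  apply Rmult_eq_reg_r with ((2 * PI) ^ (2 * n + 3) / (2 * INR (fact (2 * n + 3)))); lra.
Qed.

(** Euler's evaluation: at 0 the cosines of even level are all equal to one sign. *)
Lemma zeta_even_lim N :
  is_lim_seq (fun M => sum_f_R0 (fun k => / INR (S k) ^ (2 * N + 2)) M)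
    ((-1) ^ N * bernoulli (2 * N + 2) * ((2 * PI) ^ (2 * N + 2) / (2 * INR (fact (2 * N + 2))))).
Proof.
  assert (H := fourier_sum_0_lim (2 * N)).
  assert (E : forall M, fourier_sum (2 * N + 2) M 0
     = - (-1) ^ N * sum_f_R0 (fun k => / INR (S k) ^ (2 * N + 2)) M).
  { intros M. unfold fourier_sum. rewrite scal_sum. apply sum_eq. intros k _.
    rewrite Rmult_0_r, Rminus_0_l, cos_neg.
    replace (INR (2 * N + 2) * PI / 2) with (INR (S N) * PI)
      by (rewrite plus_INR, mult_INR, S_INR; simpl (INR 2); field).
    replace (cos (INR (S N) * PI)) with (- (-1) ^ N); [unfold Rdiv; ring|].
    clear. induction N as [|N IH].
    - simpl. rewrite Rmult_1_l, cos_PI. ring.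
    - rewrite (S_INR (S N)), Rmult_plus_distr_r, Rmult_1_l, neg_cos, <- IH. simpl. ring. }
  assert (Hs : (-1) ^ N * (-1) ^ N = 1).
  { rewrite <- Rpow_mult_distr. replace (-1 * -1) with 1 by ring. apply pow1. }
  apply is_lim_seq_ext with (fun M => - (-1) ^ N * fourier_sum (2 * N + 2) M 0).
  { intros M. rewrite E. ring_simplify.
    replace (((-1) ^ N) ^ 2) with 1 by (rewrite <- Hs; ring). ring. }
  match goal with |- is_lim_seq _ (Finite ?l) => replace l with
    (- (-1) ^ N * - (bernoulli (2 * N + 2) * ((2 * PI) ^ (2 * N + 2) / (2 * INR (fact (2 * N + 2)))))) by ring end.
  apply is_lim_seq_mult'; [apply is_lim_seq_const|exact H].
Qed.

(** * Euler-Maclaurin summation *)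

Definition bper (n : nat) (t : R) : R := bernoulli_poly n (frac_part t).

Lemma frac_part_nat j t : INR j <= t < INR j + 1 -> frac_part t = t - INR j.
Proof.
  intros H. unfold frac_part. rewrite <- (Int_part_spec t (Z.of_nat j)).
  - now rewrite <- INR_IZR_INZ.
  - rewrite <- INR_IZR_INZ. lra.
Qed.

Lemma bper_bound n : exists B, 0 <= B /\ forall t, Rabs (bper n t) <= B.
Proof.
  exists (sum_f_R0 (fun k => Rabs (Binomial.C n k * bernoulli k)) n). split.
  - apply cond_pos_sum. intros; apply Rabs_pos.
  - intros t. unfold bper, bernoulli_poly.
    eapply Rle_trans; [apply Rabs_triang_gen|]. apply sum_Rle. intros k Hk.
    rewrite Rabs_mult. rewrite <- (Rmult_1_r (Rabs (Binomial.C n k * bernoulli k))) at 2.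
    apply Rmult_le_compat_l; [apply Rabs_pos|].
    destruct (base_fp t) as [H1 H2].
    rewrite Rabs_pos_eq by (apply pow_le; lra).
    rewrite <- (pow1 (n - k)). apply pow_incr. lra.
Qed.

Lemma cint_bper_unit n f j I :
  cint (fun t => RtoC (bernoulli_poly n (t - INR j)) * f t)%C (INR j) (INR (S j)) I ->
  cint (fun t => RtoC (bper n t) * f t)%C (INR j) (INR (S j)) I.
Proof.
  apply cint_ext. rewrite S_INR. intros x. rewrite Rmin_left, Rmax_right by lra.
  intros Hx. unfold bper. now rewrite (frac_part_nat j) by lra.
Qed.

Lemma is_derive_bernoulli_shift n c x :
  is_derive (fun t => bernoulli_poly (S n) (t - c)) x (INR (S n) * bernoulli_poly n (x - c)).
Proof.
  eapply is_derive_eq.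
  - apply (is_derive_comp (bernoulli_poly (S n)) (fun t => t - c)).
    + apply is_derive_bernoulli_poly.
    + apply is_derive_Rminus; [apply (is_derive_id (K := R_AbsRing))|apply is_derive_Rconst].
  - unfold scal; simpl; unfold mult; simpl. unfold one; simpl. to_R. ring.
Qed.

Lemma continuous_bernoulli_shift n c x : continuous (fun t => bernoulli_poly n (t - c)) x.
Proof.
  apply (continuous_comp (fun t => t - c) (bernoulli_poly n)).
  - apply ex_derive_Rcontinuous.
    auto_derive; exact I.
  - apply continuous_bernoulli_poly.
Qed.

Lemma cintegrable_bper_nat n f m : (forall t, 0 <= t -> ccont f t) ->
  cintegrable (fun t => RtoC (bper n t) * f t)%C 0 (INR m).
Proof.
  intros Hf. induction m as [|m [I HI]].
  - exists 0; apply cint_point.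
  - destruct (cintegrable_cont (fun t => RtoC (bernoulli_poly n (t - INR m)) * f t)%C
                (INR m) (INR (S m))) as [J HJ].
    + assert (H0 := pos_INR m). rewrite S_INR. intros x. rewrite Rmin_left by lra.
      intros Hx. apply ccont_mult; [apply ccont_R, continuous_bernoulli_shift|apply Hf; lra].
    + exists (I + J)%C. eapply cint_Chasles; [exact HI|]. now apply cint_bper_unit.
Qed.

Lemma cintegrable_bper n f T : (forall t, 0 <= t -> ccont f t) -> 0 <= T ->
  cintegrable (fun t => RtoC (bper n t) * f t)%C 0 T.
Proof.
  intros Hf HT. destruct (filterlim_INR_large T) as [m Hm].
  apply cintegrable_sub with (INR m).
  - split; [exact HT|apply Hm; lia].
  - now apply cintegrable_bper_nat.
Qed.

(** One integration by parts on each unit interval; for n >= 1 the boundary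
    values of the next Bernoulli polynomial agree, so they telescope. *)
Lemma cint_bper_parts n f df m I : (1 <= n)%nat ->
  (forall t, 0 <= t -> cder f t (df t)) -> (forall t, 0 <= t -> ccont df t) ->
  cint (fun t => RtoC (bper (S n) t) * df t)%C 0 (INR m) I ->
  cint (fun t => RtoC (bper n t) * f t)%C 0 (INR m)
    ((RtoC (bernoulli (S n)) * (f (INR m) - f 0) - I) / RtoC (INR (S n)))%C.
Proof.
  intros Hn Hd Hc HI.
  assert (HN : RtoC (INR (S n)) <> RtoC 0).
  { intros E. apply RtoC_inj in E. apply (not_0_INR (S n)); [lia|exact E]. }
  assert (H : forall m, cint (fun t => RtoC (INR (S n)) * (RtoC (bper n t) * f t)
      + RtoC (bper (S n) t) * df t)%C 0 (INR m) (RtoC (bernoulli (S n)) * (f (INR m) - f 0))%C).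
  { clear I m HI. induction m as [|m IH].
    - eapply cint_eq; [apply cint_point|]. simpl. ring.
    - eapply cint_eq.
      + eapply cint_Chasles; [exact IH|].
        apply cint_ext with (fun t => RtoC (INR (S n)) * (RtoC (bernoulli_poly n (t - INR m)) * f t)
           + RtoC (bernoulli_poly (S n) (t - INR m)) * df t)%C.
        { rewrite S_INR. intros x. rewrite Rmin_left, Rmax_right by lra.
          intros Hx. unfold bper. now rewrite (frac_part_nat m) by lra. }
        apply (cint_derive (fun t => RtoC (bernoulli_poly (S n) (t - INR m)) * f t)%C);
          assert (H0 := pos_INR m); rewrite S_INR; intros x; rewrite Rmin_left by lra; intros Hx.
        * eapply cder_eq; [apply cder_mult; [apply cder_R, is_derive_bernoulli_shift|apply Hd; lra]|].
          rewrite RtoC_mult. ring.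
        * apply ccont_plus.
          -- apply ccont_mult; [apply ccont_const|]. apply ccont_mult.
             ++ apply ccont_R, continuous_bernoulli_shift.
             ++ eapply cder_ccont, Hd; lra.
          -- apply ccont_mult; [apply ccont_R, continuous_bernoulli_shift|apply Hc; lra].
      + rewrite Rminus_diag, bernoulli_poly_0. rewrite (S_INR m).
        replace (INR m + 1 - INR m) with 1 by ring. rewrite bernoulli_poly_1 by lia. ring. }
  apply cint_ext with (fun t => / RtoC (INR (S n)) *
     ((RtoC (INR (S n)) * (RtoC (bper n t) * f t) + RtoC (bper (S n) t) * df t)
       - RtoC (bper (S n) t) * df t))%C.
  - intros x _. field. exact HN.
  - eapply cint_eq; [apply cint_scal, cint_minus; [apply H|exact HI]|]. field. exact HN.
Qed.

Fixpoint Csum (f : nat -> C) (m : nat) : C :=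
  match m with O => RtoC 0 | S k => (Csum f k + f (S k))%C end.

Lemma trapezoid_sum f df F m I : 
  (forall t, 0 <= t -> cder F t (f t)) -> (forall t, 0 <= t -> cder f t (df t)) ->
  (forall t, 0 <= t -> ccont df t) ->
  cint (fun t => RtoC (bper 1 t) * df t)%C 0 (INR m) I ->
  (Csum (fun k => f (INR k)) m = F (INR m) - F 0 + (f (INR m) - f 0) / 2 + I)%C.
Proof.
  intros HF Hd Hc. revert I. induction m as [|m IH]; intros I HI.
  - rewrite (cint_unique _ _ _ _ _ HI (cint_point _ _)). simpl. field.
  - destruct (cintegrable_bper_nat 1 df m Hc) as [J HJ].
    assert (HK : cint (fun t => RtoC (bper 1 t) * df t)%C (INR m) (INR (S m))
       ((f (INR (S m)) + f (INR m)) / 2 - (F (INR (S m)) - F (INR m)))%C).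
    { apply cint_bper_unit. eapply cint_eq.
      - apply (cint_derive (fun t => RtoC (bernoulli_poly 1 (t - INR m)) * f t - F t)%C);
          assert (H0 := pos_INR m); rewrite S_INR; intros x; rewrite Rmin_left by lra; intros Hx.
        + eapply cder_eq; [apply cder_minus; [apply cder_mult;
            [apply cder_R, is_derive_bernoulli_shift|apply Hd; lra]|apply HF; lra]|].
          rewrite bernoulli_poly_0_E. simpl (INR 1). rewrite Rmult_1_r. ring.
        + apply ccont_mult; [apply ccont_R, continuous_bernoulli_shift|apply Hc; lra].
      - rewrite Rminus_diag, !bernoulli_poly_1_E. rewrite S_INR.
        replace (INR m + 1 - INR m - / 2) with (/ 2) by field.
        replace (0 - / 2) with (- / 2) by ring. rewrite RtoC_opp, RtoC_inv by lra. field. }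
    rewrite (cint_unique _ _ _ _ _ HI (cint_Chasles _ _ _ _ _ _ HJ HK)).
    cbn [Csum]. rewrite (IH J HJ). field.
Qed.

Lemma RtoC_nz x : x <> 0 -> RtoC x <> RtoC 0.
Proof. intros H E. apply H. now apply RtoC_inj. Qed.

(** Three integrations by parts, against B_1, B_2 and B_3; there is no f2 term because
    B_3 = 0. *)
Lemma euler_maclaurin F f f1 f2 f3 m :
  (forall t, 0 <= t -> cder F t (f t)) -> (forall t, 0 <= t -> cder f t (f1 t)) ->
  (forall t, 0 <= t -> cder f1 t (f2 t)) -> (forall t, 0 <= t -> cder f2 t (f3 t)) ->
  (forall t, 0 <= t -> ccont f3 t) ->
  exists I, cint (fun t => RtoC (bper 3 t) * f3 t)%C 0 (INR m) I /\
  (Csum (fun k => f (INR k)) m = F (INR m) - F 0 + (f (INR m) - f 0) / 2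
     + (f1 (INR m) - f1 0) / 12 + I / 6)%C.
Proof.
  intros H0 H1 H2 H3 H4.
  destruct (cintegrable_bper_nat 3 f3 m H4) as [I HI]. exists I; split; [exact HI|].
  assert (A := cint_bper_parts 2 f2 f3 m I ltac:(lia) H3 H4 HI).
  assert (B := cint_bper_parts 1 f1 f2 m _ ltac:(lia) H2 (fun t Ht => cder_ccont _ _ _ (H3 t Ht)) A).
  rewrite (trapezoid_sum f f1 F m _ H0 H1 (fun t Ht => cder_ccont _ _ _ (H2 t Ht)) B).
  rewrite (bernoulli_odd 0 : bernoulli 3 = 0), bernoulli_2.
  simpl (INR 3). simpl (INR 2).
  replace (1 + 1 + 1) with 3 by ring. replace (1 + 1) with 2 by ring. rewrite RtoC_inv by lra.
  field.
Qed.

(** * The kernel integrals of periodic Bernoulli functions *)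

Definition kint (n q : nat) (z : C) (I : C) : Prop :=
  cint_inf (fun t => RtoC (bper n t) / (RtoC t + z) ^ q)%C I.

Lemma cder_shift z t : cder (fun u => RtoC u + z)%C t 1.
Proof.
  eapply cder_eq; [apply cder_plus; [apply cder_id|apply cder_const]|]. ring.
Qed.

Lemma slit_shift_nz z t : slit_plane z -> 0 <= t -> (RtoC t + z)%C <> RtoC 0.
Proof. intros Hz Ht. apply slit_plane_nz. now apply slit_plane_add. Qed.

Lemma cder_shift_pow z q t : slit_plane z -> 0 <= t ->
  cder (fun u => / (RtoC u + z) ^ q)%C t (- RtoC (INR q) / (RtoC t + z) ^ S q)%C.
Proof.
  intros Hz Ht. eapply cder_eq; [apply cder_inv_pow; [apply cder_shift|now apply slit_shift_nz]|].
  f_equal. ring.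
Qed.

Lemma shift_pow_bound z q : slit_plane z -> (2 <= q)%nat ->
  exists B, 0 <= B /\ forall t, 0 <= t -> Cmod (/ (RtoC t + z) ^ q) <= B / (1 + t) ^ 2.
Proof.
  intros Hz Hq. destruct (slit_plane_lower z Hz) as [c [Hc Hb]].
  exists (/ c ^ q). split; [left; apply Rinv_0_lt_compat, pow_lt, Hc|].
  intros t Ht. assert (Hn := slit_shift_nz z t Hz Ht).
  rewrite Cmod_inv by (apply Cpow_nz, Hn). rewrite Cmod_pow.
  specialize (Hb t 1 Ht ltac:(lra)). replace (RtoC 1 * z)%C with z in Hb by ring.
  unfold Rdiv. rewrite <- Rinv_mult. apply Rinv_le_contravar.
  - apply Rmult_lt_0_compat; apply pow_lt; lra.
  - eapply Rle_trans; [|apply pow_incr; split; [|exact Hb]; nra].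
    rewrite Rpow_mult_distr. apply Rmult_le_compat_l; [apply pow_le; lra|].
    rewrite (Rplus_comm t 1). apply Rle_pow; [lra|exact Hq].
Qed.

Lemma kint_ex n q z : slit_plane z -> (2 <= q)%nat -> exists I, kint n q z I.
Proof.
  intros Hz Hq. destruct (shift_pow_bound z q Hz Hq) as [B [HB HB1]].
  destruct (bper_bound n) as [D [HD HD1]].
  destruct (cint_inf_dom2 (fun t => RtoC (bper n t) / (RtoC t + z) ^ q)%C (D * B)) as [I [HI _]].
  - intros T HT. apply cintegrable_bper; [|exact HT].
    intros t Ht. eapply cder_ccont, cder_shift_pow; assumption.
  - intros t Ht. unfold Cdiv. rewrite Cmod_mult, Cmod_R.
    replace (D * B / (1 + t) ^ 2) with (D * (B / (1 + t) ^ 2)) by (unfold Rdiv; ring).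
    apply Rmult_le_compat; [apply Rabs_pos|apply Cmod_ge_0|apply HD1|apply HB1; lra].
  - exists I; exact HI.
Qed.

Lemma is_lim_seq_inv_INR : is_lim_seq (fun n => / (1 + INR n)) 0.
Proof.
  apply is_lim_seq_ext with (fun n => / INR (S n)); [|apply is_lim_seq_inv_INR_S].
  intros n. rewrite S_INR. f_equal. ring.
Qed.

Lemma shift_pow_lim z q : slit_plane z -> (2 <= q)%nat ->
  cseq (fun m => / (RtoC (INR m) + z) ^ q)%C 0.
Proof.
  intros Hz Hq. destruct (shift_pow_bound z q Hz Hq) as [B [HB HB1]].
  apply cseq_squeeze with (fun m => B * / (1 + INR m)).
  - intros m. replace (/ (RtoC (INR m) + z) ^ q - 0)%C with (/ (RtoC (INR m) + z) ^ q)%C by ring.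
    eapply Rle_trans; [apply HB1, pos_INR|]. unfold Rdiv. apply Rmult_le_compat_l; [exact HB|].
    assert (H := pos_INR m). apply Rinv_le_contravar; nra.
  - replace (Finite 0) with (Finite (B * 0)) by (f_equal; ring).
    apply is_lim_seq_mult'; [apply is_lim_seq_const|apply is_lim_seq_inv_INR].
Qed.

(** The boundary term at infinity vanishes, so raising the level and the exponent
    together costs only a Bernoulli number over z^q, a term of the asymptotic series. *)
Lemma kint_parts n q z I J : slit_plane z -> (1 <= n)%nat -> (2 <= q)%nat ->
  kint n q z I -> kint (S n) (S q) z J ->
  I = ((RtoC (INR q) * J - RtoC (bernoulli (S n)) / z ^ q) / RtoC (INR (S n)))%C.
Proof.
  intros Hz Hn Hq HI HJ.
  assert (HN : RtoC (INR (S n)) <> RtoC 0) by (apply RtoC_nz, not_0_INR; lia).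
  set (Jm m := cRInt (fun t => RtoC (bper (S n) t) / (RtoC t + z) ^ S q)%C 0 (INR m)).
  assert (HJm : forall m, cint (fun t => RtoC (bper (S n) t) / (RtoC t + z) ^ S q)%C 0 (INR m) (Jm m)).
  { intros m. apply cRInt_correct, cintegrable_bper; [|apply pos_INR].
    intros t Ht. eapply cder_ccont, cder_shift_pow; assumption. }
  assert (HIm : forall m, cint (fun t => RtoC (bper n t) / (RtoC t + z) ^ q)%C 0 (INR m)
     ((RtoC (bernoulli (S n)) * (/ (RtoC (INR m) + z) ^ q - / z ^ q) + RtoC (INR q) * Jm m)
        / RtoC (INR (S n)))%C).
  { intros m. eapply cint_eq.
    - apply (cint_bper_parts n (fun t => / (RtoC t + z) ^ q)%C
               (fun t => - RtoC (INR q) / (RtoC t + z) ^ S q)%C m); [exact Hn| | |].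
      + intros t Ht; now apply cder_shift_pow.
      + intros t Ht. apply ccont_mult; [apply ccont_const|].
        eapply cder_ccont, cder_shift_pow; assumption.
      + apply cint_ext with (fun t => - RtoC (INR q) * (RtoC (bper (S n) t) / (RtoC t + z) ^ S q))%C.
        * intros x _. unfold Cdiv. ring.
        * apply cint_scal, HJm.
    - replace (RtoC 0 + z)%C with z by ring. unfold Cdiv. ring. }
  assert (A := cint_inf_seq _ _ _ HI HIm).
  assert (B := cint_inf_seq _ _ _ HJ HJm).
  apply (cseq_unique _ _ _ A).
  apply cseq_ext with (fun m => / RtoC (INR (S n)) *
     (RtoC (bernoulli (S n)) * (/ (RtoC (INR m) + z) ^ q - / z ^ q) + RtoC (INR q) * Jm m))%C.
  { intros m; unfold Cdiv; ring. }
  eapply cseq_eq.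
  - apply cseq_scal, cseq_plus; apply cseq_scal; [|exact B].
    apply cseq_minus; [apply shift_pow_lim; assumption|apply cseq_const].
  - unfold Cdiv. ring.
Qed.

(** * Asymptotics of the elementary sums *)

Lemma Csum_plus f g m : Csum (fun k => f k + g k)%C m = (Csum f m + Csum g m)%C.
Proof. induction m as [|m IH]; cbn [Csum]; [ring|rewrite IH; ring]. Qed.

Lemma Csum_scal c f m : Csum (fun k => c * f k)%C m = (c * Csum f m)%C.
Proof. induction m as [|m IH]; cbn [Csum]; [ring|rewrite IH; ring]. Qed.

Lemma Csum_ext f g m : (forall k, (1 <= k <= m)%nat -> f k = g k) -> Csum f m = Csum g m.
Proof.
  induction m as [|m IH]; intros H; cbn [Csum]; [reflexivity|].
  rewrite IH by (intros; apply H; lia). rewrite H by lia. reflexivity.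
Qed.

Lemma Csum_const c m : Csum (fun _ => c) m = (RtoC (INR m) * c)%C.
Proof. induction m as [|m IH]; cbn [Csum]; [simpl; ring|rewrite IH, S_INR, RtoC_plus; ring]. Qed.

Lemma Csum_shift f m : Csum (fun k => f (S k)) m = (Csum f (S m) - f 1%nat)%C.
Proof. induction m as [|m IH]; cbn [Csum] in *; [ring|rewrite IH; ring]. Qed.

Lemma Csum_RtoC g n :
  Csum (fun k => RtoC (g k)) (S n) = RtoC (sum_f_R0 (fun k => g (S k)) n).
Proof.
  induction n as [|n IH]; [cbn [Csum sum_f_R0]; ring|].
  rewrite tech5, RtoC_plus, <- IH. reflexivity.
Qed.

Lemma cder_Clog_shift z t : slit_plane z -> 0 <= t ->
  cder (fun u => Clog (RtoC u + z)) t (/ (RtoC t + z))%C.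
Proof.
  intros Hz Ht. eapply cder_eq; [apply cder_Clog; [apply cder_shift|now apply slit_plane_add]|].
  cbv beta; field. now apply slit_shift_nz.
Qed.

Lemma cder_inv_shift z t : slit_plane z -> 0 <= t ->
  cder (fun u => / (RtoC u + z))%C t (- / (RtoC t + z) ^ 2)%C.
Proof.
  intros Hz Ht. assert (Hn := slit_shift_nz z t Hz Ht).
  eapply cder_eq; [apply cder_inv; [apply cder_shift|exact Hn]|]. cbv beta; field. exact Hn.
Qed.

(** The logarithmic sums have third derivatives that are multiples of a power of t+z, so
    one family of kernel integrals absorbs all their remainders. *)
Lemma euler_maclaurin_kernel F f f1 f2 c q z I : slit_plane z -> (2 <= q)%nat -> kint 3 q z I ->
  (forall t, 0 <= t -> cder F t (f t)) -> (forall t, 0 <= t -> cder f t (f1 t)) ->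
  (forall t, 0 <= t -> cder f1 t (f2 t)) ->
  (forall t, 0 <= t -> cder f2 t (c * / (RtoC t + z) ^ q)%C) ->
  exists J, cseq J I /\ forall m,
  (Csum (fun k => f (INR k)) m = F (INR m) - F 0 + (f (INR m) - f 0) / 2
     + (f1 (INR m) - f1 0) / 12 + c * J m / 6)%C.
Proof.
  intros Hz Hq HI H0 H1 H2 H3.
  assert (Hc : forall t, 0 <= t -> ccont (fun t => / (RtoC t + z) ^ q)%C t).
  { intros t Ht. eapply cder_ccont, cder_shift_pow; assumption. }
  set (J m := cRInt (fun t => RtoC (bper 3 t) / (RtoC t + z) ^ q)%C 0 (INR m)).
  assert (HJ : forall m, cint (fun t => RtoC (bper 3 t) / (RtoC t + z) ^ q)%C 0 (INR m) (J m)).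
  { intros m. apply cRInt_correct, cintegrable_bper; [exact Hc|apply pos_INR]. }
  exists J. split; [exact (cint_inf_seq _ _ _ HI HJ)|]. intros m.
  destruct (euler_maclaurin F f f1 f2 (fun t => c * / (RtoC t + z) ^ q)%C m H0 H1 H2 H3) as [K [HK E]].
  - intros t Ht. apply ccont_mult; [apply ccont_const|now apply Hc].
  - rewrite E. replace K with (c * J m)%C; [reflexivity|].
    apply (cint_unique (fun t => c * (RtoC (bper 3 t) / (RtoC t + z) ^ q))%C 0 (INR m)).
    + apply cint_scal, HJ.
    + apply cint_ext with (2 := HK). intros t _. unfold Cdiv. ring.
Qed.

Lemma sum_xlogx z I : slit_plane z -> kint 3 2 z I ->
  exists J, cseq J I /\ forall m, let W := (RtoC (INR m) + z)%C in
  (Csum (fun k => (RtoC (INR k) + z) * Clog (RtoC (INR k) + z)) m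
   = W ^ 2 / 2 * Clog W - W ^ 2 / 4 - (z ^ 2 / 2 * Clog z - z ^ 2 / 4)
     + (W * Clog W - z * Clog z) / 2 + (Clog W - Clog z) / 12 - J m / 6)%C.
Proof.
  intros Hz HI.
  destruct (euler_maclaurin_kernel
     (fun t => (RtoC t + z) ^ 2 * / 2 * Clog (RtoC t + z) - (RtoC t + z) ^ 2 * / 4)%C
     (fun t => (RtoC t + z) * Clog (RtoC t + z))%C
     (fun t => Clog (RtoC t + z) + 1)%C (fun t => / (RtoC t + z))%C (- (1))%C 2 z I Hz (le_n 2) HI)
    as [J [HJ E]].
  - intros t Ht. assert (Hn := slit_shift_nz z t Hz Ht).
    assert (Hs := cder_pow _ _ _ 2 (cder_shift z t)).
    eapply cder_eq.
    + apply cder_minus.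
      * apply cder_mult; [|now apply cder_Clog_shift].
        apply (cder_mult (fun t => (RtoC t + z) ^ 2)%C (fun _ => / 2)%C); [exact Hs|apply cder_const].
      * apply (cder_mult (fun t => (RtoC t + z) ^ 2)%C (fun _ => / 4)%C); [exact Hs|apply cder_const].
    + simpl (INR 2). simpl pred. replace (1 + 1) with 2 by ring. cbv beta; field. exact Hn.
  - intros t Ht. assert (Hn := slit_shift_nz z t Hz Ht).
    eapply cder_eq; [apply cder_mult; [apply cder_shift|now apply cder_Clog_shift]|].
    cbv beta; field. exact Hn.
  - intros t Ht. eapply cder_eq; [apply cder_plus; [now apply cder_Clog_shift|apply cder_const]|]. ring.
  - intros t Ht. eapply cder_eq; [now apply cder_inv_shift|]. ring.
  - exists J. split; [exact HJ|]. intros m W. rewrite E. unfold W.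
    replace (RtoC 0 + z)%C with z by ring. field.
Qed.

Lemma sum_log z I : slit_plane z -> kint 3 3 z I ->
  exists J, cseq J I /\ forall m, let W := (RtoC (INR m) + z)%C in
  (Csum (fun k => Clog (RtoC (INR k) + z)) m
   = W * Clog W - W - (z * Clog z - z) + (Clog W - Clog z) / 2 + (/ W - / z) / 12 + J m / 3)%C.
Proof.
  intros Hz HI.
  destruct (euler_maclaurin_kernel
     (fun t => (RtoC t + z) * Clog (RtoC t + z) - (RtoC t + z))%C
     (fun t => Clog (RtoC t + z))%C (fun t => / (RtoC t + z))%C
     (fun t => - / (RtoC t + z) ^ 2)%C 2 3 z I Hz ltac:(lia) HI) as [J [HJ E]].
  - intros t Ht. assert (Hn := slit_shift_nz z t Hz Ht).
    eapply cder_eq; [apply cder_minus; [apply cder_mult; [apply cder_shift|now apply cder_Clog_shift]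
      |apply cder_shift]|]. cbv beta; field. exact Hn.
  - intros t Ht. now apply cder_Clog_shift.
  - intros t Ht. now apply cder_inv_shift.
  - intros t Ht. assert (Hn := slit_shift_nz z t Hz Ht).
    eapply cder_eq; [apply cder_opp, cder_shift_pow; assumption|].
    simpl (INR 2). replace (1 + 1) with 2 by ring. field. exact Hn.
  - exists J. split; [exact HJ|]. intros m W. rewrite E. unfold W.
    replace (RtoC 0 + z)%C with z by ring. field.
    split; [now apply slit_plane_nz|apply slit_shift_nz; [exact Hz|apply pos_INR]].
Qed.

Lemma slit_plane_1 : slit_plane 1.
Proof. apply Re_pos_slit. simpl; lra. Qed.

Lemma RtoC_INR_S k : (RtoC (INR k) + 1)%C = RtoC (INR (S k)).
Proof. rewrite S_INR, RtoC_plus. reflexivity. Qed.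

Lemma Clog_INR_S k : Clog (RtoC (INR k) + 1) = RtoC (ln (INR (S k))).
Proof. rewrite RtoC_INR_S. apply Clog_R, INR_S_pos. Qed.

Lemma Clog_1 : Clog 1 = 0.
Proof. rewrite Clog_R by lra. now rewrite ln_1. Qed.

Lemma is_lim_seq_INR_S_inv_c : cseq (fun m => / RtoC (INR (S m)))%C 0.
Proof.
  apply cseq_ext with (fun m => RtoC (/ INR (S m))).
  - intros m. apply RtoC_inv, Rgt_not_eq, INR_S_pos.
  - apply cseq_R, is_lim_seq_inv_INR_S.
Qed.

(** The constant is left as a kernel integral; the same integral comes out of the
    continuation of zeta at -1, which identifies it as log A. *)
Lemma hyperfactorial_lim I : kint 3 2 1 I ->
  cseq (fun m => let M := RtoC (INR (S m)) in let l := RtoC (ln (INR (S m))) in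
     Csum (fun k => RtoC (INR k * ln (INR k))) (S m)
      - ((M ^ 2 / 2 + M / 2 + / 12) * l - M ^ 2 / 4))%C (/ 4 - I / 6)%C.
Proof.
  intros HI. destruct (sum_xlogx 1 I slit_plane_1 HI) as [J [HJ E]].
  apply cseq_ext with (fun m => / 4 - / 6 * J m)%C.
  - intros m. cbv zeta. specialize (E m). cbv zeta in E.
    rewrite (Csum_ext _ (fun k => RtoC (INR (S k) * ln (INR (S k))))) in E.
    2:{ intros k _. rewrite Clog_INR_S, RtoC_INR_S, RtoC_mult. reflexivity. }
    rewrite (Csum_shift (fun k => RtoC (INR k * ln (INR k)))) in E.
    rewrite Clog_INR_S, RtoC_INR_S, Clog_1 in E. simpl (INR 1) in E. rewrite ln_1, Rmult_0_r in E.
    apply (f_equal (fun c => c + RtoC 0)%C) in E.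
    match type of E with (?a - ?b + ?c = _)%C => replace (a - b + c)%C with a in E by ring end.
    rewrite E. cbv beta; field.
  - eapply cseq_eq; [apply cseq_minus; [apply cseq_const|apply cseq_scal, HJ]|]. cbv beta; field.
Qed.

(** Only the existence of the limit is taken from Euler-Maclaurin; its value comes from
    Wallis' product. *)
Lemma logfact_lim_ex : exists s, 
  cseq (fun m => let M := RtoC (INR (S m)) in let l := RtoC (ln (INR (S m))) in
     Csum (fun k => RtoC (ln (INR k))) (S m) - ((M + / 2) * l - M))%C s.
Proof.
  destruct (kint_ex 3 3 1 slit_plane_1 ltac:(lia)) as [I HI].
  destruct (sum_log 1 I slit_plane_1 HI) as [J [HJ E]].
  eexists.
  apply cseq_ext with (fun m => 1 - / 12 + (/ 12 * / RtoC (INR (S m)) + / 3 * J m))%C.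
  - intros m. cbv zeta. specialize (E m). cbv zeta in E.
    rewrite (Csum_ext _ (fun k => RtoC (ln (INR (S k))))) in E.
    2:{ intros k _. apply Clog_INR_S. }
    rewrite (Csum_shift (fun k => RtoC (ln (INR k)))) in E.
    rewrite Clog_INR_S, RtoC_INR_S, Clog_1 in E. simpl (INR 1) in E. rewrite ln_1 in E.
    match type of E with (?a - ?b = _)%C => replace (a - b)%C with a in E by ring end.
    rewrite E. cbv beta; field. apply RtoC_nz, Rgt_not_eq, INR_S_pos.
  - apply cseq_plus; [apply cseq_const|].
    apply cseq_plus; apply cseq_scal; [apply is_lim_seq_INR_S_inv_c|exact HJ].
Qed.

(** ** Euler's constant *)

Lemma harmonic_lim : cseq (fun m => Csum (fun k => RtoC (/ INR k)) (S m)
   - RtoC (ln (INR (S m))))%C (RtoC euler_gamma).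
Proof.
  assert (Hs := slit_plane_1).
  destruct (kint_ex 3 4 1 Hs ltac:(lia)) as [I HI].
  destruct (euler_maclaurin_kernel (fun t => Clog (RtoC t + 1)) (fun t => / (RtoC t + 1))%C
     (fun t => - / (RtoC t + 1) ^ 2)%C (fun t => 2 * / (RtoC t + 1) ^ 3)%C (- (6))%C 4 1 I Hs ltac:(lia) HI)
    as [J [HJl EJ]].
  { intros t Ht. now apply cder_Clog_shift. }
  { intros t Ht. now apply cder_inv_shift. }
  { intros t Ht. assert (Hn := slit_shift_nz 1 t Hs Ht).
    eapply cder_eq; [apply cder_opp, cder_shift_pow; assumption|].
    simpl (INR 2). replace (1 + 1) with 2 by ring. field. exact Hn. }
  { intros t Ht. assert (Hn := slit_shift_nz 1 t Hs Ht).
    eapply cder_eq; [apply cder_scal, cder_shift_pow; assumption|].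
    simpl (INR 3). replace (1 + 1 + 1) with 3 by ring. field. exact Hn. }
  assert (E : forall m, (Csum (fun k => RtoC (/ INR k)) (S m) - RtoC (ln (INR (S m)))
     = / 2 + / 12 + (/ 2 * / RtoC (INR (S m)) - (/ 12 * (/ RtoC (INR (S m)) * / RtoC (INR (S m)))) - J m))%C).
  { intros m. assert (E := EJ m).
    rewrite (Csum_ext _ (fun k => RtoC (/ INR (S k)))) in E.
    2:{ intros k _. rewrite RtoC_INR_S. symmetry. apply RtoC_inv, Rgt_not_eq, INR_S_pos. }
    rewrite (Csum_shift (fun k => RtoC (/ INR k))) in E.
    rewrite Clog_INR_S, RtoC_INR_S in E. replace (RtoC 0 + 1)%C with (RtoC 1) in E by ring.
    rewrite Clog_1 in E. simpl (INR 1) in E. rewrite Rinv_1 in E.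
    apply (f_equal (fun c => c + 1)%C) in E.
    match type of E with (?a - ?b + ?c = _)%C => replace (a - b + c)%C with a in E by ring end.
    rewrite E. field. apply RtoC_nz, Rgt_not_eq, INR_S_pos. }
  assert (HL : exists l, cseq (fun m => Csum (fun k => RtoC (/ INR k)) (S m)
     - RtoC (ln (INR (S m))))%C l).
  { eexists. apply cseq_ext with (1 := fun m => eq_sym (E m)).
    assert (Hi := is_lim_seq_INR_S_inv_c).
    apply cseq_plus; [apply cseq_const|]. apply cseq_minus; [|exact HJl].
    apply cseq_minus; [apply cseq_scal, Hi|apply cseq_scal, cseq_mult; exact Hi]. }
  destruct HL as [l Hl]. eapply cseq_eq; [exact Hl|].
  assert (HR : forall m, (Csum (fun k => RtoC (/ INR k)) (S m) - RtoC (ln (INR (S m))))%C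
     = RtoC (sum_f_R0 (fun k => / INR (S k)) m - ln (INR (S m)))).
  { intros m. rewrite (Csum_RtoC (fun k => / INR k)), <- RtoC_minus. reflexivity. }
  apply cseq_ext with (1 := HR) in Hl. apply C_ext.
  - assert (A := is_lim_seq_unique _ _ (cseq_Re _ _ Hl)).
    unfold euler_gamma. simpl Re in A. cbv beta in A. simpl. rewrite A. reflexivity.
  - assert (A := is_lim_seq_unique _ _ (cseq_Im _ _ Hl)). simpl in A.
    rewrite Lim_seq_const in A. injection A as A. simpl. unfold Im. symmetry; exact A.
Qed.

(** ** Wallis and Stirling *)

Definition wallis (n : nat) : R := RInt (fun x => sin x ^ n) 0 (PI / 2).

Lemma wallis_correct n : is_RInt (fun x => sin x ^ n) 0 (PI / 2) (wallis n).
Proof.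
  apply (RInt_correct (V := R_CompleteNormedModule)).
  apply (ex_RInt_continuous (V := R_CompleteNormedModule)). intros x _.
  apply ex_derive_Rcontinuous.
  auto_derive. exact I.
Qed.

Lemma wallis_rec n : INR (n + 2) * wallis (n + 2) = INR (n + 1) * wallis n.
Proof.
  assert (H : is_RInt (fun x => INR (n + 2) * sin x ^ (n + 2) - INR (n + 1) * sin x ^ n) 0 (PI / 2)
    (- cos (PI / 2) * sin (PI / 2) ^ (n + 1) - (- cos 0 * sin 0 ^ (n + 1)))).
  { apply (is_RInt_derive (V := R_CompleteNormedModule) (fun x => - cos x * sin x ^ (n + 1))).
    - intros x _. eapply is_derive_eq.
      + apply is_derive_Rmult.
        * apply (is_derive_opp (K := R_AbsRing) (V := R_NormedModule)), is_derive_cos.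
        * apply is_derive_Reals, (derivable_pt_lim_comp sin (fun y => y ^ (n + 1)));
            [apply derivable_pt_lim_sin|apply derivable_pt_lim_pow].
      + replace (pred (n + 1)) with n by lia. unfold opp; simpl. to_R.
        replace (n + 1)%nat with (S n) by lia. replace (n + 2)%nat with (S (S n)) by lia.
        assert (E : cos x * cos x = 1 - sin x * sin x).
        { assert (A := sin2_cos2 x). unfold Rsqr in A. lra. }
        rewrite <- !tech_pow_Rmult, !S_INR.
        replace (- cos x * ((INR n + 1) * sin x ^ n * cos x))
          with (- (INR n + 1) * sin x ^ n * (cos x * cos x)) by ring.
        rewrite E. ring.
    - intros x _. apply ex_derive_Rcontinuous.
      auto_derive. repeat split. }
  assert (H2 : is_RInt (fun x => INR (n + 2) * sin x ^ (n + 2) - INR (n + 1) * sin x ^ n) 0 (PI / 2)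
    (INR (n + 2) * wallis (n + 2) - INR (n + 1) * wallis n)).
  { apply (is_RInt_minus (V := R_NormedModule)); apply is_RInt_Rscal, wallis_correct. }
  assert (A := is_RInt_unique (V := R_CompleteNormedModule) _ _ _ _ H).
  rewrite (is_RInt_unique (V := R_CompleteNormedModule) _ _ _ _ H2) in A.
  rewrite cos_PI2, sin_0, pow_i in A by lia. lra.
Qed.

Lemma wallis_0 : wallis 0 = PI / 2.
Proof.
  apply (is_RInt_unique (V := R_CompleteNormedModule)). simpl.
  eapply is_RInt_eq; [apply (is_RInt_const (V := R_NormedModule))|].
  unfold scal; simpl; unfold mult; simpl; to_R; ring.
Qed.

Lemma wallis_1 : wallis 1 = 1.
Proof.
  apply (is_RInt_unique (V := R_CompleteNormedModule)).
  eapply is_RInt_eq.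
  - apply (is_RInt_derive (V := R_CompleteNormedModule) (fun x => - cos x)).
    + intros x _. auto_derive; [exact I|]. ring.
    + intros x _. apply ex_derive_Rcontinuous.
      auto_derive. repeat split.
  - unfold minus, plus, opp; simpl. rewrite cos_PI2, cos_0. to_R. ring.
Qed.

Lemma wallis_decr n : wallis (S n) <= wallis n.
Proof.
  apply (is_RInt_le (fun x => sin x ^ S n) (fun x => sin x ^ n) 0 (PI / 2)).
  - assert (A := PI_RGT_0). lra.
  - apply wallis_correct.
  - apply wallis_correct.
  - intros x Hx. assert (A := PI_RGT_0). assert (0 <= sin x) by (apply sin_ge_0; lra).
    assert (B := SIN_bound x). rewrite <- tech_pow_Rmult.
    assert (0 <= sin x ^ n) by now apply pow_le. nra.
Qed.

(** The central ratio  m!^2 4^m / (2m)!, written so that both Wallis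
    integrals are multiples of it or of its inverse. *)
Definition central (m : nat) : R := INR (fact m) ^ 2 * 4 ^ m / INR (fact (2 * m)).

Lemma central_pos m : 0 < central m.
Proof.
  apply Rdiv_lt_0_compat; [|apply INR_fact_lt_0].
  apply Rmult_lt_0_compat; apply pow_lt; [apply INR_fact_lt_0|lra].
Qed.

Lemma central_S m : central (S m) = central m * ((2 * INR m + 2) / (2 * INR m + 1)).
Proof.
  unfold central. replace (2 * S m)%nat with (S (S (2 * m))) by lia.
  rewrite !fact_simpl, !mult_INR, !S_INR, mult_INR. simpl (INR 2).
  assert (A := INR_fact_neq_0 m). assert (B := INR_fact_neq_0 (2 * m)). assert (C := pos_INR m).
  rewrite <- (tech_pow_Rmult 4). cbv beta; field. repeat split; try assumption; lra.
Qed.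

Lemma wallis_even m : wallis (2 * m) = PI / 2 / central m.
Proof.
  induction m as [|m IH].
  - simpl (2 * 0)%nat. rewrite wallis_0. unfold central; simpl. cbv beta; field.
  - assert (R := wallis_rec (2 * m)). rewrite IH in R.
    replace (2 * S m)%nat with (2 * m + 2)%nat by lia.
    rewrite central_S. assert (A := central_pos m). assert (B := pos_INR m).
    rewrite !plus_INR, mult_INR in R. simpl (INR 2) in R. simpl (INR 1) in R.
    apply Rmult_eq_reg_l with (2 * INR m + 2); [|lra].
    replace (2 * INR m + 2) with ((1 + 1) * INR m + (1 + 1)) at 1 by ring. rewrite R.
    cbv beta; field. lra.
Qed.

Lemma wallis_odd m : wallis (2 * m + 1) = central m / (2 * INR m + 1).
Proof.
  induction m as [|m IH].
  - simpl (2 * 0 + 1)%nat. rewrite wallis_1. unfold central; simpl. cbv beta; field.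
  - assert (R := wallis_rec (2 * m + 1)). rewrite IH in R.
    replace (2 * S m + 1)%nat with (2 * m + 1 + 2)%nat by lia.
    rewrite central_S. assert (A := central_pos m). assert (B := pos_INR m).
    rewrite !plus_INR, mult_INR in R. simpl (INR 2) in R. simpl (INR 1) in R.
    rewrite S_INR.
    apply Rmult_eq_reg_l with (2 * INR m + 3); [|lra].
    replace (2 * INR m + 3) with ((1 + 1) * INR m + 1 + (1 + 1)) at 1 by ring. rewrite R.
    cbv beta; field. lra.
Qed.

(** The Wallis integrals decrease, which squeezes each even one between two odd ones. *)
Lemma wallis_lim : is_lim_seq (fun m => central (S m) ^ 2 / INR (S m)) PI.
Proof.
  apply is_lim_seq_of_abs with (fun m => 2 * PI * / INR (S m)).
  - intros m. assert (H1 := wallis_decr (2 * S m)).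
    assert (H2 := wallis_decr (2 * m + 1)).
    replace (S (2 * m + 1)) with (2 * S m)%nat in H2 by lia.
    replace (S (2 * S m)) with (2 * S m + 1)%nat in H1 by lia.
    rewrite wallis_even, wallis_odd in H1. rewrite wallis_even, wallis_odd in H2.
    assert (Hc : central m = central (S m) * ((2 * INR m + 1) / (2 * INR m + 2))).
    { rewrite central_S. assert (B := pos_INR m). cbv beta; field. lra. }
    rewrite Hc in H2. assert (A := central_pos (S m)). assert (B := pos_INR m).
    replace (central (S m) * ((2 * INR m + 1) / (2 * INR m + 2)) / (2 * INR m + 1))
      with (central (S m) / (2 * INR m + 2)) in H2 by (field; lra).
    rewrite S_INR in *. set (x := INR m) in *. set (c := central (S m)) in *.
    assert (Hpi := PI_RGT_0).
    assert (G1 : PI * (x + 1) <= c ^ 2).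
    { apply Rmult_le_compat_r with (r := c * (2 * x + 2)) in H2; [|nra].
      replace (PI / 2 / c * (c * (2 * x + 2))) with (PI * (x + 1)) in H2 by (field; lra).
      replace (c / (2 * x + 2) * (c * (2 * x + 2))) with (c ^ 2) in H2 by (field; lra). exact H2. }
    assert (G2 : c ^ 2 <= PI * (x + 1) + PI / 2).
    { apply Rmult_le_compat_r with (r := c * (2 * (x + 1) + 1)) in H1; [|nra].
      replace (PI / 2 / c * (c * (2 * (x + 1) + 1))) with (PI * (x + 1) + PI / 2) in H1 by (field; lra).
      replace (c / (2 * (x + 1) + 1) * (c * (2 * (x + 1) + 1))) with (c ^ 2) in H1 by (field; lra).
      exact H1. }
    replace (c ^ 2 / (x + 1) - PI) with ((c ^ 2 - PI * (x + 1)) * / (x + 1)) by (field; lra).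
    assert (Hi : 0 < / (x + 1)) by (apply Rinv_0_lt_compat; lra).
    rewrite Rabs_pos_eq by (apply Rmult_le_pos; lra).
    apply Rmult_le_compat_r; lra.
  - replace (Finite 0) with (Finite (2 * PI * 0)) by (f_equal; ring).
    apply is_lim_seq_mult'; [apply is_lim_seq_const|apply is_lim_seq_inv_INR_S].
Qed.

Lemma sum_ln_fact n : sum_f_R0 (fun k => ln (INR (S k))) n = ln (INR (fact (S n))).
Proof.
  induction n as [|n IH]; [simpl; now rewrite Rmult_1_l || reflexivity|].
  rewrite tech5, IH, (fact_simpl (S n)), mult_INR, ln_mult;
    [ring|apply INR_S_pos|apply INR_fact_lt_0].
Qed.

(** The combination of log m! and log (2m)! in the Wallis ratio determines the limit s of
    the previous asymptotics from 4s - 2s - ln 2 = ln pi. *)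
Lemma stirling_lim :
  cseq (fun m => let M := RtoC (INR (S m)) in let l := RtoC (ln (INR (S m))) in
     Csum (fun k => RtoC (ln (INR k))) (S m) - ((M + / 2) * l - M))%C (RtoC (ln (2 * PI)) / 2)%C.
Proof.
  destruct logfact_lim_ex as [s Hs]. eapply cseq_eq; [exact Hs|].
  set (sg m := ln (INR (fact (S m))) - ((INR (S m) + / 2) * ln (INR (S m)) - INR (S m))).
  assert (HR : forall m, (let M := RtoC (INR (S m)) in let l := RtoC (ln (INR (S m))) in
     Csum (fun k => RtoC (ln (INR k))) (S m) - ((M + / 2) * l - M))%C = RtoC (sg m)).
  { intros m. cbv zeta. rewrite (Csum_RtoC (fun k => ln (INR k))), sum_ln_fact. unfold sg.
    rewrite !RtoC_minus, RtoC_mult, RtoC_plus, RtoC_inv by lra. reflexivity. }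
  apply cseq_ext with (1 := HR) in Hs.
  assert (H1 := cseq_Re _ _ Hs). simpl Re in H1.
  assert (Him : Im s = 0).
  { assert (A := is_lim_seq_unique _ _ (cseq_Im _ _ Hs)). simpl in A.
    rewrite Lim_seq_const in A. injection A as A. symmetry; exact A. }
  assert (HW := wallis_lim).
  assert (HL : is_lim_seq (fun m => ln (central (S m) ^ 2 / INR (S m))) (ln PI)).
  { apply is_lim_seq_continuous; [|exact HW].
    apply derivable_continuous_pt. exists (/ PI). apply derivable_pt_lim_ln, PI_RGT_0. }
  assert (HE : forall m, ln (central (S m) ^ 2 / INR (S m)) = 4 * sg m - 2 * sg (2 * m + 1)%nat - ln 2).
  { intros m. unfold central, sg. replace (S (2 * m + 1)) with (2 * S m)%nat by lia.
    assert (A := INR_fact_lt_0 (S m)). assert (B := INR_fact_lt_0 (2 * S m)).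
    assert (D := INR_S_pos m). assert (P4 : 0 < 4 ^ S m) by (apply pow_lt; lra).
    assert (P2 : 0 < INR (fact (S m)) ^ 2) by now apply pow_lt.
    assert (P1 : 0 < INR (fact (S m)) ^ 2 * 4 ^ S m) by now apply Rmult_lt_0_compat.
    assert (P3 : 0 < INR (fact (S m)) ^ 2 * 4 ^ S m / INR (fact (2 * S m))) by now apply Rdiv_lt_0_compat.
    rewrite ln_div by (try apply pow_lt; assumption).
    rewrite (ln_pow _ _ P3), ln_div, ln_mult, (ln_pow _ _ A), (ln_pow 4) by (assumption || lra).
    rewrite (mult_INR 2 (S m)). simpl (INR 2). replace (1 + 1) with 2 by ring.
    rewrite ln_mult by lra. replace 4 with (2 * 2) at 1 by ring. rewrite ln_mult by lra. cbv beta; field. }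
  assert (HS : is_lim_seq (fun m => sg (2 * m + 1)%nat) (Re s)).
  { apply (is_lim_seq_subseq sg (Re s) (fun m => (2 * m + 1)%nat)); [|exact H1].
    intros P [N HN]. exists N. intros n Hn. apply HN. lia. }
  assert (HT : is_lim_seq (fun m => ln (central (S m) ^ 2 / INR (S m))) (4 * Re s - 2 * Re s - ln 2)).
  { apply is_lim_seq_ext with (fun m => 4 * sg m - 2 * sg (2 * m + 1)%nat - ln 2);
      [intros; now rewrite HE|].
    apply is_lim_seq_minus'; [|apply is_lim_seq_const].
    apply is_lim_seq_minus'; (apply is_lim_seq_mult'; [apply is_lim_seq_const|assumption]). }
  apply is_lim_seq_unique in HL, HT. rewrite HL in HT. injection HT as HT.
  assert (Hre : Re s = ln (2 * PI) / 2) by (rewrite ln_mult by (apply PI_RGT_0 || lra); lra).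
  rewrite <- RtoC_div by lra.
  apply C_ext; simpl; [exact Hre|exact Him].
Qed.

(** * The infinite products for Gamma and G *)

Lemma Clog_scal r w : 0 < r -> w <> RtoC 0 -> Clog (RtoC r * w) = (RtoC (ln r) + Clog w)%C.
Proof.
  intros Hr Hw. assert (Hm := proj1 (Cmod_gt_0 w) Hw). unfold Clog, Carg.
  rewrite Cmod_mult, Cmod_R, Rabs_pos_eq, Re_RtoC_mult, Im_RtoC_mult by lra.
  rewrite ln_mult by assumption.
  replace (r * Re w / (r * Cmod w)) with (Re w / Cmod w) by (field; lra).
  destruct (Rle_dec 0 (r * Im w)) as [H|H]; destruct (Rle_dec 0 (Im w)) as [H'|H']; try nra;
    apply C_ext; unfold Re, Im; simpl; ring.
Qed.

(** The derivative of log(1 + uz) - uz + (uz)^2/2 in u is (uz)^2 z/(1 + uz), and the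
    denominator stays away from 0 on the slit plane: integrate from 0 to u = 1/m. *)
Lemma Clog_expand z : slit_plane z -> exists B, forall m,
  Cmod (Clog (1 + z / RtoC (INR (S m))) - z / RtoC (INR (S m))
        + z ^ 2 / (2 * RtoC (INR (S m)) ^ 2)) <= B * / INR (S m) ^ 3.
Proof.
  intros Hz. destruct (slit_plane_lower z Hz) as [c [Hc Hb]].
  exists (Cmod z ^ 3 / (3 * c)). intros m. assert (Hm := INR_S_pos m). set (h := / INR (S m)).
  assert (Hh : 0 < h) by (apply Rinv_0_lt_compat; exact Hm).
  assert (Hs : forall u, 0 <= u -> slit_plane (1 + RtoC u * z)).
  { intros u Hu. apply slit_plane_comb; auto; lra. }
  set (F u := (Clog (1 + RtoC u * z) - RtoC u * z + RtoC (u * u) * (z ^ 2 / 2))%C).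
  assert (HF : forall u, 0 <= u -> cder F u (z ^ 3 * RtoC (u * u) / (1 + RtoC u * z))%C).
  { intros u Hu. assert (Hn := slit_plane_nz _ (Hs u Hu)).
    assert (Hl : cder (fun u => RtoC u * z)%C u (1 * z + RtoC u * 0)%C)
      by (apply (cder_mult (fun u => RtoC u) (fun _ => z)); [apply cder_id|apply cder_const]).
    eapply cder_eq.
    - apply cder_plus; [apply cder_minus|].
      + apply cder_Clog; [apply cder_plus; [apply cder_const|exact Hl]|now apply Hs].
      + exact Hl.
      + apply (cder_mult (fun u => RtoC (u * u)) (fun _ => z ^ 2 / 2)%C);
          [apply cder_R, is_derive_Rmult; apply (is_derive_id (K := R_AbsRing))|apply cder_const].
    - cbv beta. change (@one R_AbsRing) with 1. rewrite RtoC_plus, !RtoC_mult. field. exact Hn. }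
  assert (A := cder_le F (fun u => z ^ 3 * RtoC (u * u) / (1 + RtoC u * z))%C
     (fun u => Cmod z ^ 3 * u ^ 3 / (3 * c)) (fun u => Cmod z ^ 3 * u ^ 2 / c) 0 h).
  assert (E0 : F 0 = RtoC 0).
  { unfold F. replace (1 + RtoC 0 * z)%C with (RtoC 1) by ring. rewrite Clog_1.
    rewrite Rmult_0_l. field. }
  assert (Eh : F h = (Clog (1 + z / RtoC (INR (S m))) - z / RtoC (INR (S m))
        + z ^ 2 / (2 * RtoC (INR (S m)) ^ 2))%C).
  { assert (Hn := RtoC_nz _ (Rgt_not_eq _ _ Hm)).
    unfold F, h. rewrite RtoC_mult, RtoC_inv by lra.
    replace (/ RtoC (INR (S m)) * z)%C with (z / RtoC (INR (S m)))%C by (field; exact Hn).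
    f_equal. field. exact Hn. }
  rewrite E0, Eh in A. unfold Cminus in A at 1. rewrite Copp_0, Cplus_0_r in A.
  eapply Rle_trans; [apply A|].
  - lra.
  - intros x Hx. apply HF; lra.
  - intros x Hx. auto_derive; [exact I|]. field. lra.
  - intros x Hx. eapply cder_ccont, HF; lra.
  - intros x Hx. apply ex_derive_Rcontinuous.
    auto_derive. exact I.
  - intros x Hx. assert (Hn := slit_plane_nz _ (Hs x ltac:(lra))).
    rewrite Cmod_div by exact Hn. rewrite Cmod_mult, Cmod_pow, Cmod_R, Rabs_pos_eq by nra.
    specialize (Hb 1 x ltac:(lra) ltac:(lra)).
    assert (Hz3 : 0 <= Cmod z ^ 3) by (apply pow_le, Cmod_ge_0).
    unfold Rdiv. apply Rmult_le_compat.
    + apply Rmult_le_pos; nra.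
    + left. apply Rinv_0_lt_compat, Cmod_gt_0, Hn.
    + right; ring.
    + apply Rinv_le_contravar; nra.
  - right. unfold h. field. lra.
Qed.

Lemma is_lim_seq_inv_INR_S_pow k : is_lim_seq (fun m => / INR (S m) ^ S k) 0.
Proof.
  apply is_lim_seq_le_le with (fun _ => 0) (fun m => / INR (S m)).
  - intros m. assert (H := INR_S_pos m). split; [left; apply Rinv_0_lt_compat, pow_lt, H|].
    apply Rinv_le_contravar; [exact H|]. rewrite <- tech_pow_Rmult.
    assert (1 <= INR (S m)) by (rewrite S_INR; assert (A := pos_INR m); lra).
    assert (1 <= INR (S m) ^ k) by now apply pow_R1_Rle. nra.
  - apply is_lim_seq_const.
  - apply is_lim_seq_inv_INR_S.
Qed.

Lemma log_expand_2 z : slit_plane z -> cseq (fun m => RtoC (INR (S m)) ^ 2 * Clog (1 + z / RtoC (INR (S m))) - RtoC (INR (S m)) * z)%C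
  (- (z ^ 2 / 2))%C.
Proof.
  intros Hz.
  destruct (Clog_expand z Hz) as [B HB].
  apply cseq_squeeze with (fun m => B * / INR (S m) ^ 1).
  - intros m. assert (Hm := INR_S_pos m). assert (Hn := RtoC_nz _ (Rgt_not_eq _ _ Hm)).
    replace (RtoC (INR (S m)) ^ 2 * Clog (1 + z / RtoC (INR (S m))) - RtoC (INR (S m)) * z - - (z ^ 2 / 2))%C
      with (RtoC (INR (S m)) ^ 2 * (Clog (1 + z / RtoC (INR (S m))) - z / RtoC (INR (S m))
        + z ^ 2 / (2 * RtoC (INR (S m)) ^ 2)))%C by (field; exact Hn).
    rewrite Cmod_mult, Cmod_pow, Cmod_R, Rabs_pos_eq by lra.
    eapply Rle_trans; [apply Rmult_le_compat_l; [nra|apply HB]|]. right; field; lra.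
  - replace (Finite 0) with (Finite (B * 0)) by (f_equal; ring).
    apply is_lim_seq_mult'; [apply is_lim_seq_const|apply (is_lim_seq_inv_INR_S_pow 0)].
Qed.

Lemma log_expand_1 z : slit_plane z -> cseq (fun m => RtoC (INR (S m)) * Clog (1 + z / RtoC (INR (S m))))%C z.
Proof.
  intros Hz.
  apply cseq_ext with (fun m => (RtoC (INR (S m)) ^ 2 * Clog (1 + z / RtoC (INR (S m))) - RtoC (INR (S m)) * z)
     * / RtoC (INR (S m)) + z)%C.
  - intros m. field. apply RtoC_nz, Rgt_not_eq, INR_S_pos.
  - eapply cseq_eq.
    + apply cseq_plus; [apply cseq_mult; [now apply log_expand_2|apply is_lim_seq_INR_S_inv_c]|apply cseq_const].
    + ring.
Qed.

Lemma log_expand_0 z : slit_plane z -> cseq (fun m => Clog (1 + z / RtoC (INR (S m)))) 0.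
Proof.
  intros Hz.
  apply cseq_ext with (fun m => RtoC (INR (S m)) * Clog (1 + z / RtoC (INR (S m))) * / RtoC (INR (S m)))%C.
  - intros m. field. apply RtoC_nz, Rgt_not_eq, INR_S_pos.
  - eapply cseq_eq; [apply cseq_mult; [now apply log_expand_1|apply is_lim_seq_INR_S_inv_c]|]. ring.
Qed.

Lemma Clog_shift_S z m : slit_plane z -> Clog (RtoC (INR (S m)) + z) = (RtoC (ln (INR (S m))) + Clog (1 + z / RtoC (INR (S m))))%C.
Proof.
  intros Hz.
  assert (Hm := INR_S_pos m). assert (Hn := RtoC_nz _ (Rgt_not_eq _ _ Hm)).
  rewrite <- Clog_scal; [f_equal; field; exact Hn|exact Hm|].
  intros E. apply (slit_shift_nz z (INR (S m)) Hz (pos_INR _)).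
  replace (RtoC (INR (S m)) + z)%C with (RtoC (INR (S m)) * (1 + z / RtoC (INR (S m))))%C
    by (field; exact Hn). rewrite E; ring.
Qed.

(** Termwise logarithms of the partial products of 1/Gamma(z+1) and of G(z+1), without
    the exponentials in front of the products. *)
Definition lgamma_sum (z : C) (m : nat) : C :=
  Csum (fun n => Clog (1 + z / RtoC (INR n)) - z / RtoC (INR n))%C m.

Definition lbarnes_sum (z : C) (m : nat) : C :=
  Csum (fun n => RtoC (INR n) * Clog (1 + z / RtoC (INR n)) - z + z ^ 2 / (2 * RtoC (INR n)))%C m.

(** The values of log Gamma(z+1) and log G(z+1) given by Euler-Maclaurin; [J], [I]
    and [I1] are the kernel integrals of B_3 against (t+z)^-3, (t+z)^-2 and (t+1)^-2. *)
Definition lgamma_val (z J : C) : C :=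
  (RtoC (ln (2 * PI)) / 2 + (z + / 2) * Clog z - z + / (12 * z) - J / 3)%C.

Definition lbarnes_val (z J I I1 : C) : C :=
  (z ^ 2 / 4 + z * lgamma_val z J - (z * (z + 1) / 2 + / 12) * Clog z - (/ 4 - I1 / 6) - I / 6)%C.

Lemma Clog_ratio z k : slit_plane z ->
  Clog (1 + z / RtoC (INR (S k))) = (Clog (RtoC (INR (S k)) + z) - RtoC (ln (INR (S k))))%C.
Proof. intros Hz. rewrite Clog_shift_S by exact Hz. ring. Qed.

Lemma cseq_inv_shift z : slit_plane z -> cseq (fun m => / (RtoC (INR (S m)) + z))%C 0.
Proof.
  intros Hz. destruct (slit_plane_lower z Hz) as [c [Hc Hb]].
  apply cseq_squeeze with (fun m => / c * / INR (S m)).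
  - intros m. assert (Hn := slit_shift_nz z (INR (S m)) Hz (pos_INR _)).
    assert (Hm := INR_S_pos m).
    replace (/ (RtoC (INR (S m)) + z) - 0)%C with (/ (RtoC (INR (S m)) + z))%C by ring.
    rewrite Cmod_inv by exact Hn. rewrite <- Rinv_mult. apply Rinv_le_contravar; [nra|].
    specialize (Hb (INR (S m)) 1 ltac:(lra) ltac:(lra)).
    replace (RtoC 1 * z)%C with z in Hb by ring. nra.
  - replace (Finite 0) with (Finite (/ c * 0)) by (f_equal; ring).
    apply is_lim_seq_mult'; [apply is_lim_seq_const|apply is_lim_seq_inv_INR_S].
Qed.

(** Writing log(1 + z/n) as log(n+z) - log n reduces the sum to those of log(n+z), log n
    and 1/n, whose asymptotics are known up to o(1). *)
Lemma lgamma_lim z J : slit_plane z -> kint 3 3 z J ->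
  cseq (fun m => - RtoC euler_gamma * z - lgamma_sum z (S m))%C (lgamma_val z J).
Proof.
  intros Hz HJ. assert (Hzn := slit_plane_nz z Hz).
  destruct (sum_log z J Hz HJ) as [Jm [HJl E]].
  set (d m := Clog (1 + z / RtoC (INR (S m)))).
  assert (D0 := log_expand_0 z Hz). assert (D1 := log_expand_1 z Hz).
  assert (HH := harmonic_lim). assert (HS := stirling_lim). cbv zeta in HS.
  assert (Hw := cseq_inv_shift z Hz).
  assert (ES : forall m, lgamma_sum z m = (Csum (fun k => Clog (RtoC (INR k) + z)) m
     - Csum (fun k => RtoC (ln (INR k))) m - z * Csum (fun k => RtoC (/ INR k)) m)%C).
  { intros m. unfold lgamma_sum. 
    rewrite (Csum_ext _ (fun k => Clog (RtoC (INR k) + z) + ((-1) * RtoC (ln (INR k)) + (- z) * RtoC (/ INR k)))%C).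
    - rewrite !Csum_plus, !Csum_scal. ring.
    - intros k Hk. destruct k as [|k]; [lia|]. rewrite Clog_ratio by exact Hz.
      rewrite RtoC_inv by (apply Rgt_not_eq, INR_S_pos). unfold Cdiv. ring. }
  apply cseq_ext with (fun m =>
     (Csum (fun k => RtoC (ln (INR k))) (S m)
        - ((RtoC (INR (S m)) + / 2) * RtoC (ln (INR (S m))) - RtoC (INR (S m))))
     + z * ((Csum (fun k => RtoC (/ INR k)) (S m) - RtoC (ln (INR (S m)))) - RtoC euler_gamma)
     + (z * Clog z - z + Clog z / 2 + / (12 * z) + z)
     - (RtoC (INR (S m)) * d m + (z + / 2) * d m)
     - / 12 * / (RtoC (INR (S m)) + z) - / 3 * Jm (S m))%C.
  - intros m. rewrite ES, E. cbv zeta. rewrite (Clog_shift_S z m Hz). fold (d m).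
    field. repeat split; try exact Hzn. apply slit_shift_nz; [exact Hz|apply pos_INR].
  - eapply cseq_eq.
    + apply cseq_minus; [apply cseq_minus; [apply cseq_minus; [apply cseq_plus; [apply cseq_plus|]|]|]|].
      * exact HS.
      * apply cseq_scal, cseq_minus; [exact HH|apply cseq_const].
      * apply cseq_const.
      * apply cseq_plus; [exact D1|apply cseq_scal, D0].
      * apply cseq_scal, Hw.
      * apply cseq_scal. apply cseq_shift, HJl.
    + unfold lgamma_val. field. exact Hzn.
Qed.

(** Since n log(n+z) = (n+z) log(n+z) - z log(n+z), adding z times the sum for Gamma leaves
    only sums of (n+z) log(n+z), n log n, log n and 1/n. Their divergent parts cancel, up to
    products of powers of m with log(1 + z/m), which is needed to second order. *)
Lemma lbarnes_lim z J I I1 : slit_plane z -> kint 3 3 z J -> kint 3 2 z I -> kint 3 2 1 I1 ->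
  cseq (fun m => z / 2 * RtoC (ln (2 * PI)) - (z * (z + 1) + RtoC euler_gamma * z ^ 2) / 2
                 + lbarnes_sum z (S m))%C (lbarnes_val z J I I1).
Proof.
  intros Hz HJ HI HI1. assert (Hzn := slit_plane_nz z Hz).
  destruct (sum_xlogx z I Hz HI) as [Im [HIl E]].
  set (d m := Clog (1 + z / RtoC (INR (S m)))).
  assert (D0 := log_expand_0 z Hz). assert (D1 := log_expand_1 z Hz).
  assert (D2 := log_expand_2 z Hz).
  assert (HH := harmonic_lim). assert (HS := stirling_lim). cbv zeta in HS.
  assert (HA := hyperfactorial_lim I1 HI1). cbv zeta in HA.
  assert (HG := lgamma_lim z J Hz HJ).
  assert (ES : forall m, (lbarnes_sum z m + z * lgamma_sum z m
     = Csum (fun k => (RtoC (INR k) + z) * Clog (RtoC (INR k) + z)) m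
       - Csum (fun k => RtoC (INR k * ln (INR k))) m - z * Csum (fun k => RtoC (ln (INR k))) m
       - RtoC (INR m) * z - z ^ 2 / 2 * Csum (fun k => RtoC (/ INR k)) m)%C).
  { intros m. unfold lbarnes_sum, lgamma_sum. rewrite <- !Csum_scal, <- Csum_plus.
    rewrite (Csum_ext _ (fun k => (RtoC (INR k) + z) * Clog (RtoC (INR k) + z)
      + ((-1) * RtoC (INR k * ln (INR k)) + ((- (1)) * (z * RtoC (ln (INR k))) + (- z + 
        (-1) * (z ^ 2 / 2 * RtoC (/ INR k))))))%C).
    - rewrite !Csum_plus, !Csum_scal, Csum_const. ring.
    - intros k Hk. destruct k as [|k]; [lia|]. rewrite Clog_ratio by exact Hz.
      rewrite RtoC_mult, RtoC_inv by (apply Rgt_not_eq, INR_S_pos). field.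
      apply RtoC_nz, Rgt_not_eq, INR_S_pos. }
  apply cseq_ext with (fun m =>
     z * (- RtoC euler_gamma * z - lgamma_sum z (S m))
     + (z / 2 * RtoC (ln (2 * PI)) - z * (z + 1) / 2
        - (z ^ 2 / 2 * Clog z - z ^ 2 / 4) - z * Clog z / 2 - Clog z / 12 - z ^ 2 / 4)
     - (Csum (fun k => RtoC (INR k * ln (INR k))) (S m)
         - ((RtoC (INR (S m)) ^ 2 / 2 + RtoC (INR (S m)) / 2 + / 12) * RtoC (ln (INR (S m)))
            - RtoC (INR (S m)) ^ 2 / 4))
     - z * (Csum (fun k => RtoC (ln (INR k))) (S m)
        - ((RtoC (INR (S m)) + / 2) * RtoC (ln (INR (S m))) - RtoC (INR (S m))))
     - z ^ 2 / 2 * ((Csum (fun k => RtoC (/ INR k)) (S m) - RtoC (ln (INR (S m)))) - RtoC euler_gamma)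
     + (/ 2 * (RtoC (INR (S m)) ^ 2 * d m - RtoC (INR (S m)) * z)
        + (z + / 2) * (RtoC (INR (S m)) * d m) + (z ^ 2 / 2 + z / 2 + / 12) * d m)
     - / 6 * Im (S m))%C.
  - intros m. assert (ESm := ES (S m)). rewrite E in ESm. cbv zeta in ESm.
    rewrite (Clog_shift_S z m Hz) in ESm. fold (d m) in ESm.
    match type of ESm with (?a + ?b = ?c)%C =>
      replace a with (c - b)%C by (rewrite <- ESm; ring) end.
    field.
  - eapply cseq_eq.
    + apply cseq_minus; [apply cseq_plus; [apply cseq_minus; [apply cseq_minus; [apply cseq_minus; [apply cseq_plus|]|]|]|]|].
      * apply cseq_scal, HG.
      * apply cseq_const.
      * exact HA.
      * apply cseq_scal, HS.
      * apply cseq_scal, cseq_minus; [exact HH|apply cseq_const].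
      * apply cseq_plus; [apply cseq_plus|]; apply cseq_scal; [exact D2|exact D1|exact D0].
      * apply cseq_scal. apply cseq_shift, HIl.
    + unfold lbarnes_val. field.
Qed.

Lemma Cprod_Cexp u f m : (forall k, u (S k) = Cexp (f (S k))) -> Cprod u m = Cexp (Csum f m).
Proof.
  intros H. induction m as [|m IH]; cbn [Cprod Csum]; [now rewrite Cexp_0|].
  now rewrite IH, H, Cexp_plus.
Qed.

Lemma one_plus_div_nz z k : slit_plane z -> (1 + z / RtoC (INR (S k)))%C <> RtoC 0.
Proof.
  intros Hz E. assert (Hm := INR_S_pos k). assert (Hn := RtoC_nz _ (Rgt_not_eq _ _ Hm)).
  apply (slit_shift_nz z (INR (S k)) Hz (pos_INR _)).
  replace (RtoC (INR (S k)) + z)%C with (RtoC (INR (S k)) * (1 + z / RtoC (INR (S k))))%C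
    by (field; exact Hn). rewrite E; ring.
Qed.

Lemma BarnesG_val z J I I1 : slit_plane z -> kint 3 3 z J -> kint 3 2 z I -> kint 3 2 1 I1 ->
  BarnesG (z + 1) = Cexp (lbarnes_val z J I I1).
Proof.
  intros Hz HJ HI HI1. unfold BarnesG. cbv zeta. replace (z + 1 - 1)%C with z by ring.
  apply (cseq_unique (fun m => Cexp (z / 2 * RtoC (ln (2 * PI)) 
     - (z * (z + 1) + RtoC euler_gamma * z ^ 2) / 2 + lbarnes_sum z (S m))))%C.
  2:{ apply cseq_Cexp. now apply lbarnes_lim. }
  assert (HP : forall m, Cprod (fun n => (1 + z / RtoC (INR n)) ^ n *
     Cexp (- z + z ^ 2 / (2 * RtoC (INR n))))%C m = Cexp (lbarnes_sum z m)).
  { intros m. apply Cprod_Cexp. intros k.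
    rewrite <- (Cexp_Clog (1 + z / RtoC (INR (S k)))) at 1 by now apply one_plus_div_nz.
    rewrite <- Cexp_nat, <- Cexp_plus. f_equal. ring. }
  assert (HL : cseq (Cprod (fun n => (1 + z / RtoC (INR n)) ^ n *
     Cexp (- z + z ^ 2 / (2 * RtoC (INR n))))%C)
     (Cexp (lbarnes_val z J I I1 - (z / 2 * RtoC (ln (2 * PI))
        - (z * (z + 1) + RtoC euler_gamma * z ^ 2) / 2)))%C).
  { apply cseq_incr_1. apply cseq_ext with (fun m => Cexp
      ((z / 2 * RtoC (ln (2 * PI)) - (z * (z + 1) + RtoC euler_gamma * z ^ 2) / 2 + lbarnes_sum z (S m))
        - (z / 2 * RtoC (ln (2 * PI)) - (z * (z + 1) + RtoC euler_gamma * z ^ 2) / 2))%C).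
    - intros m. rewrite HP. f_equal. ring.
    - apply cseq_Cexp, cseq_minus; [now apply lbarnes_lim|apply cseq_const]. }
  unfold Cinfprod. rewrite (cseq_CLim _ _ HL).
  rewrite <- !Cexp_plus. apply cseq_Cexp. eapply cseq_eq; [apply (lbarnes_lim z J I I1); assumption|].
  field.
Qed.

(** Shifting the argument by one in the partial products: the quotient of the
    Weierstrass products at z+1 and at z is (m+1+z) exp(-H_m) up to the factor z+1. *)
Lemma Gamma_prod_shift z m : slit_plane z ->
  ((z + 1) * Cprod (fun n => (1 + (z + 1) / RtoC (INR n)) * Cexp (- (z + 1) / RtoC (INR n))) m
   = Cexp (lgamma_sum z m) * (RtoC (INR (S m)) + z) * Cexp (- Csum (fun k => RtoC (/ INR k)) m))%C.
Proof.
  intros Hz. induction m as [|m IH].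
  - unfold lgamma_sum; cbn [Cprod Csum]. replace (- RtoC 0)%C with (RtoC 0) by ring.
    rewrite !Cexp_0. simpl (INR 1). ring.
  - assert (Hm := INR_S_pos m). assert (Hn := RtoC_nz _ (Rgt_not_eq _ _ Hm)).
    cbn [Cprod]. rewrite Cmult_assoc, IH. unfold lgamma_sum. cbn [Csum].
    rewrite Cexp_plus. unfold Cminus. rewrite Cexp_plus, Cexp_Clog by now apply one_plus_div_nz.
    rewrite (Copp_plus_distr (Csum _ _)), Cexp_plus.
    replace (Cexp (- (z + 1) / RtoC (INR (S m)))) with
      (Cexp (- (z / RtoC (INR (S m)))) * Cexp (- RtoC (/ INR (S m))))%C.
    2:{ rewrite <- Cexp_plus. f_equal. rewrite RtoC_inv by lra. field. exact Hn. }
    rewrite (S_INR (S m)), RtoC_plus. field. exact Hn.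
Qed.

Lemma Gamma_val z J : slit_plane z -> kint 3 3 z J -> Gamma (z + 1) = Cexp (lgamma_val z J).
Proof.
  intros Hz HJ.
  assert (Hz1 : (z + 1)%C <> RtoC 0).
  { replace (z + 1)%C with (RtoC 1 + z)%C by ring. apply slit_shift_nz; [exact Hz|lra]. }
  set (P := Cprod (fun n => (1 + (z + 1) / RtoC (INR n)) * Cexp (- (z + 1) / RtoC (INR n)))%C).
  assert (HG := lgamma_lim z J Hz HJ).
  assert (HL : cseq P (/ (z + 1) * / Cexp (RtoC euler_gamma * (z + 1)) * / Cexp (lgamma_val z J))%C).
  { apply cseq_incr_1.
    apply cseq_ext with (fun m => / (z + 1) *
      (Cexp (- (RtoC euler_gamma * z) - (- RtoC euler_gamma * z - lgamma_sum z (S m)))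
       * ((1 + z * / RtoC (INR (S m)) + / RtoC (INR (S m)))
          * Cexp (- (Csum (fun k => RtoC (/ INR k)) (S m) - RtoC (ln (INR (S m))))))))%C.
    - intros m. assert (Hm := INR_S_pos m). assert (Hn := RtoC_nz _ (Rgt_not_eq _ _ Hm)).
      replace (P (S m)) with (/ (z + 1) * ((z + 1) * P (S m)))%C by (field; exact Hz1).
      unfold P. rewrite Gamma_prod_shift by exact Hz. f_equal.
      replace (- (RtoC euler_gamma * z) - (- RtoC euler_gamma * z - lgamma_sum z (S m)))%C
        with (lgamma_sum z (S m)) by ring.
      rewrite <- !Cmult_assoc. f_equal.
      rewrite Copp_minus_distr. unfold Cminus. rewrite Cexp_plus, Cexp_RtoC, exp_ln by exact Hm.
      rewrite (S_INR (S m)), RtoC_plus. field. exact Hn.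
    - eapply cseq_eq.
      + apply cseq_scal, cseq_mult.
        * apply cseq_Cexp, cseq_minus; [apply cseq_const|exact HG].
        * apply cseq_mult.
          -- apply cseq_plus; [apply cseq_plus; [apply cseq_const|apply cseq_scal]|]; apply is_lim_seq_INR_S_inv_c.
          -- apply cseq_Cexp, cseq_opp, harmonic_lim.
      + replace (RtoC euler_gamma * (z + 1))%C with (RtoC euler_gamma * z + RtoC euler_gamma)%C by ring.
        unfold Cminus. rewrite !Cexp_plus, !Cexp_opp. field.
        repeat split; try apply Cexp_nz. exact Hz1. }
  unfold Gamma, Cinfprod. fold P. rewrite (cseq_CLim _ _ HL). field.
  repeat split; try apply Cexp_nz. exact Hz1.
Qed.

(** * Analytic functions along lines *)

Lemma pow_n_C (w : C) k : pow_n (K := C_Ring) w k = (w ^ k)%C.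
Proof. induction k as [|k IH]; [reflexivity|]. simpl pow_n. rewrite IH. reflexivity. Qed.

Lemma pow_n_R (x : R) k : pow_n (K := R_Ring) x k = x ^ k.
Proof. induction k as [|k IH]; [reflexivity|]. simpl pow_n. rewrite IH. reflexivity. Qed.

Lemma Re_sum_n (a : nat -> C) n :
  Re (sum_n (G := C_AbelianMonoid) a n) = sum_n (G := R_AbelianMonoid) (fun k => Re (a k)) n.
Proof. induction n as [|n IH]; [now rewrite !sum_O|]. rewrite !sum_Sn, <- IH. reflexivity. Qed.

Lemma Im_sum_n (a : nat -> C) n :
  Im (sum_n (G := C_AbelianMonoid) a n) = sum_n (G := R_AbelianMonoid) (fun k => Im (a k)) n.
Proof. induction n as [|n IH]; [now rewrite !sum_O|]. rewrite !sum_Sn, <- IH. reflexivity. Qed.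

Lemma is_series_components (a : nat -> C) (l : C) :
  is_series (K := C_AbsRing) (V := C_NormedModule) a l ->
  is_series (fun k => Re (a k)) (Re l) /\ is_series (fun k => Im (a k)) (Im l).
Proof.
  intros H. split; intros P [eps HP].
  - destruct (H (ball (M := C_UniformSpace) l eps)) as [N HN]; [exists eps; auto|].
    exists N. intros n Hn. apply HP. rewrite <- Re_sum_n. apply (HN n Hn).
  - destruct (H (ball (M := C_UniformSpace) l eps)) as [N HN]; [exists eps; auto|].
    exists N. intros n Hn. apply HP. rewrite <- Im_sum_n. apply (HN n Hn).
Qed.

Lemma is_pseries_line (a : nat -> C) (y : R) (e l : C) :
  is_pseries (K := C_AbsRing) (V := C_NormedModule) a (RtoC y * e)%C l ->
  is_pseries (fun k => Re (e ^ k * a k)%C) y (Re l) /\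
  is_pseries (fun k => Im (e ^ k * a k)%C) y (Im l).
Proof.
  intros H. apply is_series_components in H. 
  assert (E : forall k, scal (K := C_AbsRing) (V := C_NormedModule)
      (pow_n (K := C_AbsRing) (RtoC y * e)%C k) (a k) = (RtoC (y ^ k) * (e ^ k * a k))%C).
  { intros k. change (pow_n (K := C_Ring) (RtoC y * e)%C k * a k = RtoC (y ^ k) * (e ^ k * a k))%C.
    etransitivity; [apply (f_equal (fun p => (p * a k)%C)), pow_n_C|].
    rewrite Cpow_mult_l, <- RtoC_pow. ring. }
  destruct H as [H1 H2]. split; unfold is_pseries.
  - eapply is_series_ext; [|exact H1]. intros k. cbv beta. rewrite E, Re_RtoC_mult.
    change (y ^ k * Re (e ^ k * a k)%C = pow_n (K := R_Ring) y k * Re (e ^ k * a k)%C).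
    apply (f_equal (fun p => p * _)). symmetry; apply pow_n_R.
  - eapply is_series_ext; [|exact H2]. intros k. cbv beta. rewrite E, Im_RtoC_mult.
    change (y ^ k * Im (e ^ k * a k)%C = pow_n (K := R_Ring) y k * Im (e ^ k * a k)%C).
    apply (f_equal (fun p => p * _)). symmetry; apply pow_n_R.
Qed.

(** An analytic function of a complex variable restricts to two of these on each line;
    continuity, derivatives and the identity theorem are then those of real power series. *)
Definition ran (f : R -> R) : Prop := exists (a : nat -> R) (r : R), 0 < r /\
  Rbar_lt r (CV_radius a) /\ forall y, Rabs y < r -> f y = PSeries a y.

Lemma CV_radius_of_pseries (a : nat -> R) r : 0 < r ->
  (forall y, Rabs y < r -> exists l, is_pseries a y l) -> Rbar_lt (r / 2) (CV_radius a).
Proof.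
  intros Hr H. apply Rbar_not_le_lt. intros Hle.
  assert (Hlt : Rbar_lt (CV_radius a) (Rabs (3 * r / 4))).
  { eapply Rbar_le_lt_trans; [exact Hle|]. simpl. rewrite Rabs_pos_eq; lra. }
  apply (CV_disk_outside _ _ Hlt).
  destruct (H (3 * r / 4)) as [l Hl]; [rewrite Rabs_pos_eq; lra|].
  assert (A := ex_series_lim_0 _ (ex_intro _ l Hl)).
  eapply is_lim_seq_ext; [|exact A]. intros n. cbv beta.
  change (pow_n (K := R_Ring) (3 * r / 4) n * a n = a n * (3 * r / 4) ^ n).
  etransitivity; [apply (f_equal (fun p => p * a n)), pow_n_R|ring].
Qed.

Lemma ran_of_pseries f (a : nat -> R) r : 0 < r ->
  (forall y, Rabs y < r -> is_pseries a y (f y)) -> ran f.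
Proof.
  intros Hr H. exists a, (r / 2). split; [lra|]. split.
  - apply CV_radius_of_pseries; [exact Hr|]. intros y Hy. eexists; now apply H.
  - intros y Hy. symmetry. apply is_pseries_unique, H. lra.
Qed.

Lemma analytic_line f z0 e : analytic_at f z0 ->
  ran (fun y => Re (f (z0 + RtoC y * e)%C)) /\ ran (fun y => Im (f (z0 + RtoC y * e)%C)).
Proof.
  intros [a [r [Hr H]]]. assert (He := Cmod_ge_0 e).
  set (r' := r / (Cmod e + 1)). assert (Hr' : 0 < r') by (apply Rdiv_lt_0_compat; lra).
  assert (A : forall y, Rabs y < r' ->
    is_pseries (K := C_AbsRing) (V := C_NormedModule) a (RtoC y * e)%C (f (z0 + RtoC y * e)%C)).
  { intros y Hy. replace (RtoC y * e)%C with (z0 + RtoC y * e - z0)%C at 1 by ring. apply H.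
    replace (z0 + RtoC y * e - z0)%C with (RtoC y * e)%C by ring. rewrite Cmod_mult, Cmod_R.
    apply Rlt_div_r in Hy; [|lra]. assert (B := Rabs_pos y). nra. }
  split; eapply ran_of_pseries; try exact Hr'; intros y Hy; apply (is_pseries_line _ _ _ _ (A y Hy)).
Qed.

Lemma ran_continuous f : ran f -> continuous f 0.
Proof.
  intros [a [r [Hr [Hc H]]]].
  apply continuous_ext_loc with (PSeries a).
  - exists (mkposreal r Hr). intros y Hy. symmetry. apply H.
    replace y with (y - 0) by ring. exact Hy.
  - apply continuity_pt_filterlim, PSeries_continuity. rewrite Rabs_R0.
    eapply Rbar_lt_trans; [|exact Hc]. exact Hr.
Qed.

(** * Uniqueness of the branches *)

Lemma ccont_comp f g t : ccont f (g t) -> continuous g t -> ccont (fun u => f (g u)) t.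
Proof.
  intros [H1 H2] Hg. split;
    [apply (continuous_comp g (fun v => Re (f v)))|apply (continuous_comp g (fun v => Im (f v)))];
    assumption.
Qed.

Lemma continuous_lipschitz (f : R -> R) L t :
  (forall u, Rabs (f u - f t) <= L * Rabs (u - t)) -> continuous f t.
Proof.
  intros H. apply continuity_pt_filterlim. intros eps Heps.
  assert (HL : 0 < Rabs L + 1) by (generalize (Rabs_pos L); lra).
  exists (eps / (Rabs L + 1)). split; [apply Rdiv_lt_0_compat; lra|].
  intros u [_ Hu]. simpl in *. unfold Rdist in *.
  apply Rlt_div_r in Hu; [|lra]. specialize (H u).
  assert (A := Rle_abs L). assert (B := Rabs_pos (u - t)). nra.
Qed.

Lemma ccont_lipschitz f L t :
  (forall u, Cmod (f u - f t) <= L * Rabs (u - t)) -> ccont f t.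
Proof.
  intros H. split; apply continuous_lipschitz with L; intros u;
    (eapply Rle_trans; [|apply H]).
  - apply Re_minus_le.
  - apply Im_minus_le.
Qed.

Definition clamp (u : R) : R := Rmax 0 (Rmin 1 u).

Lemma clamp_range u : 0 <= clamp u <= 1.
Proof.
  unfold clamp. split; [apply Rmax_l|]. apply Rmax_lub; [lra|apply Rmin_l].
Qed.

Lemma clamp_id u : 0 <= u <= 1 -> clamp u = u.
Proof. intros H. unfold clamp. rewrite Rmin_right, Rmax_right; lra. Qed.

Lemma clamp_lip u v : Rabs (clamp u - clamp v) <= 1 * Rabs (u - v).
Proof.
  unfold clamp, Rmax, Rmin.
  repeat destruct Rle_dec; unfold Rabs; repeat destruct Rcase_abs; lra.
Qed.

(** The slit plane is star-shaped about 1, so it contains this segment from 1 to z. *)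
Definition seg (z : C) (u : R) : C := (RtoC (1 - u) + RtoC u * z)%C.

Lemma seg_slit z u : slit_plane z -> 0 <= u <= 1 -> slit_plane (seg z u).
Proof. intros Hz Hu. apply slit_plane_comb; auto; lra. Qed.

Lemma seg_0 z : seg z 0 = 1.
Proof. unfold seg. rewrite Rminus_0_r. ring. Qed.

Lemma seg_1 z : seg z 1 = z.
Proof. unfold seg. rewrite Rminus_diag. ring. Qed.

(** Otherwise the intermediate value theorem would produce a value strictly between two
    neighbouring multiples of 2 pi. *)
Lemma continuous_2pi_const (g : R -> R) : (forall u, continuous g u) ->
  (forall u, exists k : Z, g u = 2 * PI * IZR k) -> g 1 = g 0.
Proof.
  intros Hc Hk. assert (Hpi := PI_RGT_0).
  assert (W : forall a b, g a < g b -> False).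
  { intros a b Hab.
    destruct (Hk a) as [ka Ea]. destruct (Hk b) as [kb Eb].
    assert (Hkk : (ka + 1 <= kb)%Z).
    { assert (ka < kb)%Z by (apply lt_IZR; nra). lia. }
    apply IZR_le in Hkk. rewrite plus_IZR in Hkk.
    destruct (IVT_gen g a b (g a + PI)) as [x [_ Hx]].
    - intros x. apply continuity_pt_filterlim, Hc.
    - rewrite Rmin_left, Rmax_right by lra. nra.
    - destruct (Hk x) as [k E]. rewrite E, Ea in Hx.
      assert (Hz : 2 * (IZR k - IZR ka) = 1) by nra.
      rewrite <- minus_IZR, <- mult_IZR in Hz. apply eq_IZR in Hz. lia. }
  destruct (Rtotal_order (g 1) (g 0)) as [H|[H|H]]; [|exact H|]; exfalso; eapply W; exact H.
Qed.

Lemma Cexp_eq a b : Cexp a = Cexp b -> Re a = Re b /\ exists k : Z, Im a - Im b = 2 * PI * IZR k.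
Proof.
  intros H. assert (E : Re a = Re b).
  { apply exp_inv. rewrite <- !Cmod_Cexp. now rewrite H. }
  split; [exact E|].
  assert (H1 := f_equal Re H). assert (H2 := f_equal Im H).
  unfold Cexp in H1, H2; simpl in H1, H2. rewrite E in H1, H2. assert (He := exp_pos (Re b)).
  assert (Hc : cos (Im a) = cos (Im b)) by (apply Rmult_eq_reg_l with (exp (Re b)); [exact H1|lra]).
  assert (Hs : sin (Im a) = sin (Im b)) by (apply Rmult_eq_reg_l with (exp (Re b)); [exact H2|lra]).
  assert (Hc1 : cos (Im a - Im b) = 1).
  { rewrite cos_minus, Hc, Hs. assert (A := sin2_cos2 (Im b)). unfold Rsqr in A. lra. }
  assert (Hs1 : sin ((Im a - Im b) / 2) = 0).
  { replace (Im a - Im b) with (2 * ((Im a - Im b) / 2)) in Hc1 by field.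
    rewrite cos_2a_sin in Hc1. nra. }
  destruct (sin_eq_0_0 _ Hs1) as [k Hk]. exists k. lra.
Qed.

(** Along the segment from 1 to z, f - V is continuous with values in 2 pi i Z, so it keeps
    its value at 1, which is 0. *)
Lemma branch_unique (f V : C -> C) z : slit_plane z ->
  (forall w, slit_plane w -> analytic_at f w /\ Cexp (f w) = Cexp (V w)) ->
  (forall u, ccont (fun v => V (seg z (clamp v))) u) ->
  Im (f 1) = 0 -> Im (V 1) = 0 -> f z = V z.
Proof.
  intros Hz Hf HV H1 HV1.
  assert (HE : forall u, slit_plane (seg z (clamp u))) by (intros u; apply seg_slit, clamp_range; exact Hz).
  assert (Hfc : forall u, ccont (fun v => f (seg z (clamp v))) u).
  { intros u. apply (ccont_comp (fun v => f (seg z v)) clamp).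
    - destruct (Hf _ (HE u)) as [Ha _]. set (u0 := clamp u) in *.
      destruct (analytic_line f (seg z u0) (z - 1) Ha) as [A B].
      apply ran_continuous in A. apply ran_continuous in B.
      assert (E : forall v, (seg z u0 + RtoC (v - u0) * (z - 1))%C = seg z v).
      { intros v. unfold seg. rewrite !RtoC_minus. ring. }
      assert (Hs : continuous (fun v => v - u0) u0).
      { apply ex_derive_Rcontinuous. auto_derive; exact I. }
      split.
      + apply continuous_ext with (fun v => Re (f (seg z u0 + RtoC (v - u0) * (z - 1))%C)).
        * intros v; now rewrite E.
        * apply (continuous_comp (fun v => v - u0)
            (fun y => Re (f (seg z u0 + RtoC y * (z - 1))%C))); [exact Hs|].
          rewrite Rminus_diag. exact A.
      + apply continuous_ext with (fun v => Im (f (seg z u0 + RtoC (v - u0) * (z - 1))%C)).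
        * intros v; now rewrite E.
        * apply (continuous_comp (fun v => v - u0)
            (fun y => Im (f (seg z u0 + RtoC y * (z - 1))%C))); [exact Hs|].
          rewrite Rminus_diag. exact B.
    - apply continuous_lipschitz with 1. intros v. apply clamp_lip. }
  assert (Hg := continuous_2pi_const (fun u => Im (f (seg z (clamp u))) - Im (V (seg z (clamp u))))).
  cbv beta in Hg. rewrite !clamp_id, seg_1, seg_0 in Hg by lra.
  destruct (Hf z Hz) as [_ Ez]. apply Cexp_eq in Ez. destruct Ez as [Ez _].
  apply C_ext; [exact Ez|].
  enough (Im (f z) - Im (V z) = Im (f 1) - Im (V 1)) by lra.
  apply Hg.
  - intros u. apply (continuous_minus (K := R_AbsRing) (V := R_NormedModule)
      (fun u => Im (f (seg z (clamp u)))) (fun u => Im (V (seg z (clamp u))))).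
    + apply Hfc.
    + apply HV.
  - intros u. destruct (Hf _ (HE u)) as [_ E]. apply Cexp_eq in E. apply E.
Qed.

(** * The kernel integrals as functions of z *)

Definition kval (n q : nat) (z : C) : C :=
  improper (fun t => RtoC (bper n t) / (RtoC t + z) ^ q)%C.

Lemma kval_correct n q z : slit_plane z -> (2 <= q)%nat -> kint n q z (kval n q z).
Proof.
  intros Hz Hq. destruct (kint_ex n q z Hz Hq) as [I HI].
  exact (improper_correct _ _ HI).
Qed.

Lemma seg_lower z c t u : 0 <= u <= 1 -> 0 <= t ->
  (forall a b, 0 <= a -> 0 <= b -> c * (a + b) <= Cmod (RtoC a + RtoC b * z)) ->
  c * (1 + t) <= Cmod (RtoC t + seg z u).
Proof.
  intros Hu Ht H. specialize (H (t + (1 - u)) u ltac:(lra) ltac:(lra)).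
  replace (RtoC t + seg z u)%C with (RtoC (t + (1 - u)) + RtoC u * z)%C
    by (unfold seg; rewrite RtoC_plus; ring).
  replace (1 + t) with (t + (1 - u) + u) by ring. exact H.
Qed.

Lemma Cpow_diff_bound (a b : C) q M : Cmod a <= M -> Cmod b <= M ->
  Cmod (a ^ S q - b ^ S q) <= INR (S q) * M ^ q * Cmod (a - b).
Proof.
  intros Ha Hb. assert (HM : 0 <= M) by (eapply Rle_trans; [apply Cmod_ge_0|exact Ha]).
  induction q as [|q IH].
  - simpl. rewrite !Cmult_1_r. lra.
  - replace (a ^ S (S q) - b ^ S (S q))%C with (a * (a ^ S q - b ^ S q) + b ^ S q * (a - b))%C
      by (rewrite !(Cpow_S _ (S q)); ring).
    eapply Rle_trans; [apply Cmod_triangle|]. rewrite !Cmod_mult, Cmod_pow.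
    assert (Hp : Cmod b ^ S q <= M ^ S q) by (apply pow_incr; split; [apply Cmod_ge_0|exact Hb]).
    assert (Hd := Cmod_ge_0 (a - b)).
    assert (Hd2 := Cmod_ge_0 (a ^ S q - b ^ S q)).
    assert (Hq : 0 <= INR (S q) * M ^ q * Cmod (a - b)).
    { apply Rmult_le_pos; [apply Rmult_le_pos; [apply pos_INR|now apply pow_le]|exact Hd]. }
    rewrite (S_INR (S q)).
    replace ((INR (S q) + 1) * M ^ S q * Cmod (a - b)) with
      (M * (INR (S q) * M ^ q * Cmod (a - b)) + M ^ S q * Cmod (a - b))
      by (rewrite <- (tech_pow_Rmult M q); ring).
    apply Rplus_le_compat.
    + apply Rmult_le_compat; auto. apply Cmod_ge_0.
    + now apply Rmult_le_compat_r.
Qed.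

(** The kernel is Lipschitz in the base point along the segment, with a constant that is
    integrable in t. *)
Lemma kval_ccont n q z u : slit_plane z -> (2 <= q)%nat ->
  ccont (fun v => kval n q (seg z (clamp v))) u.
Proof.
  intros Hz Hq. destruct (slit_plane_lower z Hz) as [c [Hc Hb]].
  destruct (bper_bound n) as [D [HD HD1]]. destruct q as [|q]; [lia|].
  set (L := D * (INR (S q) * (/ c) ^ q * (Cmod (z - 1) / (c * c)))).
  apply ccont_lipschitz with L. intros v.
  set (a := clamp v). set (b := clamp u).
  assert (Ha := clamp_range v). assert (Hb' := clamp_range u). fold a in Ha. fold b in Hb'.
  assert (Sa := seg_slit z a Hz Ha). assert (Sb := seg_slit z b Hz Hb').
  assert (HL : 0 <= L).
  { unfold L. apply Rmult_le_pos; [exact HD|]. apply Rmult_le_pos.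
    - apply Rmult_le_pos; [apply pos_INR|]. apply pow_le. left; now apply Rinv_0_lt_compat.
    - apply Rdiv_le_0_compat; [apply Cmod_ge_0|nra]. }
  apply Rle_trans with (L * Rabs (a - b)).
  2:{ apply Rmult_le_compat_l; [exact HL|]. rewrite <- (Rmult_1_l (Rabs (v - u))). apply clamp_lip. }
  apply (cint_inf_dom2_le (fun t => RtoC (bper n t) / (RtoC t + seg z a) ^ S q
           - RtoC (bper n t) / (RtoC t + seg z b) ^ S q)%C).
  { apply cint_inf_minus;
      [exact (kval_correct n (S q) _ Sa Hq)|exact (kval_correct n (S q) _ Sb Hq)]. }
  intros t Ht.
  assert (La := seg_lower z c t a Ha ltac:(lra) Hb). assert (Lb := seg_lower z c t b Hb' ltac:(lra) Hb).
  assert (Na := slit_shift_nz _ t Sa ltac:(lra)). assert (Nb := slit_shift_nz _ t Sb ltac:(lra)).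
  set (x := (RtoC t + seg z a)%C) in *. set (y := (RtoC t + seg z b)%C) in *.
  replace (RtoC (bper n t) / x ^ S q - RtoC (bper n t) / y ^ S q)%C
    with (RtoC (bper n t) * ((/ x) ^ S q - (/ y) ^ S q))%C
    by (rewrite !Cpow_inv by assumption; unfold Cdiv; ring).
  rewrite Cmod_mult, Cmod_R.
  assert (Hx : Cmod (/ x) <= / c) by (rewrite Cmod_inv by exact Na; apply Rinv_le_contravar; nra).
  assert (Hy : Cmod (/ y) <= / c) by (rewrite Cmod_inv by exact Nb; apply Rinv_le_contravar; nra).
  assert (Hxy : Cmod (/ x - / y) <= Cmod (z - 1) / (c * c) * Rabs (a - b) / (1 + t) ^ 2).
  { replace (/ x - / y)%C with (RtoC (b - a) * (z - 1) * (/ x * / y))%C.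
    2:{ assert (E : (y - x)%C = (RtoC (b - a) * (z - 1))%C).
        { unfold x, y, seg. rewrite !RtoC_minus. ring. }
        rewrite <- E. field. split; assumption. }
    rewrite !Cmod_mult, Cmod_R, !Cmod_inv by assumption. rewrite (Rabs_minus_sym b a).
    replace (Cmod (z - 1) / (c * c) * Rabs (a - b) / (1 + t) ^ 2)
      with (Rabs (a - b) * Cmod (z - 1) * (/ (c * (1 + t)) * / (c * (1 + t)))) by (field; lra).
    apply Rmult_le_compat_l; [apply Rmult_le_pos; [apply Rabs_pos|apply Cmod_ge_0]|].
    assert (P : 0 < c * (1 + t)) by nra.
    apply Rmult_le_compat; try (apply Rinv_le_contravar; lra); left; apply Rinv_0_lt_compat; lra. }
  assert (HP := Cpow_diff_bound (/ x) (/ y) q (/ c) Hx Hy).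
  assert (HQ : 0 <= INR (S q) * (/ c) ^ q).
  { apply Rmult_le_pos; [apply pos_INR|]. apply pow_le. left; now apply Rinv_0_lt_compat. }
  replace (L * Rabs (a - b) / (1 + t) ^ 2) with
    (D * (INR (S q) * (/ c) ^ q * (Cmod (z - 1) / (c * c) * Rabs (a - b) / (1 + t) ^ 2)))
    by (unfold L, Rdiv; ring).
  apply Rmult_le_compat; [apply Rabs_pos|apply Cmod_ge_0|apply HD1|].
  eapply Rle_trans; [exact HP|]. now apply Rmult_le_compat_l.
Qed.

Lemma kval_real n q x : 0 < x -> (2 <= q)%nat -> Im (kval n q (RtoC x)) = 0.
Proof.
  intros Hx Hq.
  transitivity (real (Lim_seq (fun m =>
    RInt (fun t => Im (RtoC (bper n t) / (RtoC t + RtoC x) ^ q)%C) 0 (INR m)))); [reflexivity|].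
  rewrite (Lim_seq_ext _ (fun _ => 0)); [now rewrite Lim_seq_const|]. intros m.
  apply (is_RInt_unique (V := R_CompleteNormedModule)).
  apply is_RInt_ext with (fun _ => 0).
  - assert (H0 := pos_INR m). intros t. rewrite Rmin_left by exact H0. intros Ht.
    rewrite <- RtoC_plus, <- RtoC_pow, <- RtoC_div; [reflexivity|].
    apply Rgt_not_eq, pow_lt. lra.
  - eapply is_RInt_eq; [apply (is_RInt_const (V := R_NormedModule))|].
    unfold scal; simpl; unfold mult; simpl; to_R; ring.
Qed.

Lemma ccont_ext f g t : (forall u, f u = g u) -> ccont f t -> ccont g t.
Proof.
  intros E [A B]; split.
  - apply continuous_ext with (fun u => Re (f u)); [intros u; now rewrite E|exact A].
  - apply continuous_ext with (fun u => Im (f u)); [intros u; now rewrite E|exact B].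
Qed.

Lemma lgamma_val_ccont z u : slit_plane z ->
  ccont (fun v => let w := seg z (clamp v) in lgamma_val w (kval 3 3 w)) u /\
  ccont (fun v => let w := seg z (clamp v) in Clog w) u /\
  ccont (fun v => seg z (clamp v)) u.
Proof.
  intros Hz. assert (Hcl : continuous clamp u).
  { apply continuous_lipschitz with 1. intros v. apply clamp_lip. }
  assert (Hs := seg_slit z (clamp u) Hz (clamp_range u)).
  assert (D1 : forall v, cder (seg z) v (z - 1)%C).
  { intros v. unfold seg. eapply cder_eq.
    - apply cder_plus.
      + apply cder_R. apply is_derive_Rminus; [apply is_derive_Rconst|apply (is_derive_id (K := R_AbsRing))].
      + apply (cder_mult (fun u => RtoC u) (fun _ => z)); [apply cder_id|apply cder_const].
    - cbv beta. change (@one R_AbsRing) with 1. rewrite RtoC_minus. ring. }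
  assert (C1 : ccont (fun v => seg z (clamp v)) u).
  { apply (ccont_comp (seg z) clamp); [eapply cder_ccont, D1|exact Hcl]. }
  assert (C2 : ccont (fun v => Clog (seg z (clamp v))) u).
  { apply (ccont_comp (fun v => Clog (seg z v)) clamp); [|exact Hcl].
    eapply cder_ccont, cder_Clog; [apply D1|exact Hs]. }
  assert (C3 : ccont (fun v => / (12 * seg z (clamp v)))%C u).
  { apply (ccont_comp (fun v => / (12 * seg z v))%C clamp); [|exact Hcl].
    eapply cder_ccont, cder_inv; [apply cder_scal, D1|].
    apply Cmult_neq_0; [apply RtoC_nz; lra|now apply slit_plane_nz]. }
  split; [|split; assumption]. cbv zeta. unfold lgamma_val, Cminus, Cdiv.
  apply ccont_plus; [apply ccont_plus; [apply ccont_plus; [apply ccont_plus|]|]|].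
  - apply ccont_const.
  - apply ccont_mult; [apply ccont_plus; [exact C1|apply ccont_const]|exact C2].
  - apply ccont_ext with (fun v => RtoC (-1) * seg z (clamp v))%C; [intros; ring|].
    apply ccont_mult; [apply ccont_const|exact C1].
  - exact C3.
  - apply ccont_ext with (fun v => - / 3 * kval 3 3 (seg z (clamp v)))%C; [intros; ring|].
    apply ccont_mult; [apply ccont_const|]. apply kval_ccont; [exact Hz|lia].
Qed.

Lemma lbarnes_val_ccont z I1 u : slit_plane z ->
  ccont (fun v => let w := seg z (clamp v) in lbarnes_val w (kval 3 3 w) (kval 3 2 w) I1) u.
Proof.
  intros Hz. destruct (lgamma_val_ccont z u Hz) as [C1 [C2 C3]]. cbv zeta in *.
  assert (C4 := kval_ccont 3 2 z u Hz ltac:(lia)).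
  apply ccont_ext with (fun v => / 4 * (seg z (clamp v) * seg z (clamp v))
    + (seg z (clamp v) * lgamma_val (seg z (clamp v)) (kval 3 3 (seg z (clamp v)))
    + ((- / 2 * (seg z (clamp v) * (seg z (clamp v) + 1)) + - / 12) * Clog (seg z (clamp v))
    + (- (/ 4 - I1 / 6) + - / 6 * kval 3 2 (seg z (clamp v))))))%C.
  - intros v. unfold lbarnes_val. field.
  - apply ccont_plus; [apply ccont_mult; [apply ccont_const|apply ccont_mult; exact C3]|].
    apply ccont_plus; [apply ccont_mult; [exact C3|exact C1]|].
    apply ccont_plus; [apply ccont_mult; [|exact C2]|].
    + apply ccont_plus; [|apply ccont_const].
      apply ccont_mult; [apply ccont_const|].
      apply ccont_mult; [exact C3|apply ccont_plus; [exact C3|apply ccont_const]].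
    + apply ccont_plus; [apply ccont_const|]. apply ccont_mult; [apply ccont_const|exact C4].
Qed.

Lemma logGamma_value logGamma z :
  is_log_branch (fun z => Gamma (z + 1)%C) logGamma -> slit_plane z ->
  logGamma z = lgamma_val z (kval 3 3 z).
Proof.
  intros [H1 H2] Hz.
  apply (branch_unique logGamma (fun w => lgamma_val w (kval 3 3 w)) z Hz).
  - intros w Hw. destruct (H1 w Hw) as [A B]. split; [exact A|]. rewrite B.
    apply Gamma_val; [exact Hw|apply kval_correct; [exact Hw|lia]].
  - intros u. apply (lgamma_val_ccont z u Hz).
  - apply H2; lra.
  - unfold lgamma_val. rewrite Clog_1.
    assert (R3 := kval_real 3 3 1 ltac:(lra) ltac:(lia)).
    set (K := kval 3 3 1) in *. destruct K as [k1 k2]. unfold Im in R3. simpl in R3. subst k2.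
    unfold Im; simpl. field.
Qed.

Lemma logG_value logG z :
  is_log_branch (fun z => BarnesG (z + 1)%C) logG -> slit_plane z ->
  logG z = lbarnes_val z (kval 3 3 z) (kval 3 2 z) (kval 3 2 1).
Proof.
  intros [H1 H2] Hz.
  apply (branch_unique logG (fun w => lbarnes_val w (kval 3 3 w) (kval 3 2 w) (kval 3 2 1)) z Hz).
  - intros w Hw. destruct (H1 w Hw) as [A B]. split; [exact A|]. rewrite B.
    apply BarnesG_val; [exact Hw| | |]; apply kval_correct; auto; try apply slit_plane_1.
  - intros u. apply (lbarnes_val_ccont z _ u Hz).
  - apply H2; lra.
  - unfold lbarnes_val, lgamma_val. rewrite Clog_1.
    assert (R3 := kval_real 3 3 1 ltac:(lra) ltac:(lia)).
    assert (R2 := kval_real 3 2 1 ltac:(lra) ltac:(lia)).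
    set (K := kval 3 3 1) in *. set (K' := kval 3 2 1) in *.
    destruct K as [k1 k2], K' as [k1' k2']. unfold Im in R3, R2. simpl in R3, R2. subst k2 k2'.
    unfold Im; simpl. field.
Qed.

(** * The identity theorem on a line *)

Lemma PSeries_zero_head (a : nat -> R) r : 0 < r -> Rbar_lt 0 (CV_radius a) ->
  (forall y, 0 < y < r -> PSeries a y = 0) -> a 0%nat = 0.
Proof.
  intros Hr Hc H. rewrite <- PSeries_0.
  assert (C : continuity_pt (PSeries a) 0) by (apply PSeries_continuity; rewrite Rabs_R0; exact Hc).
  destruct (Req_dec (PSeries a 0) 0) as [E|E]; [exact E|]. exfalso.
  destruct (C (Rabs (PSeries a 0)) (Rabs_pos_lt _ E)) as [d [Hd Hd2]].
  set (y := Rmin (d / 2) (r / 2)).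
  assert (Hy : 0 < y) by (apply Rmin_glb_lt; lra).
  assert (Y1 : y <= d / 2) by apply Rmin_l. assert (Y2 : y <= r / 2) by apply Rmin_r.
  specialize (Hd2 y). simpl in Hd2. unfold Rdist in Hd2. rewrite (H y) in Hd2 by lra.
  rewrite Rminus_0_l, Rabs_Ropp in Hd2. apply (Rlt_irrefl (Rabs (PSeries a 0))). apply Hd2.
  split; [split; [exact I|lra]|]. rewrite Rminus_0_r, Rabs_pos_eq; lra.
Qed.

Lemma PSeries_zero_right (a : nat -> R) r : 0 < r -> Rbar_lt 0 (CV_radius a) ->
  (forall y, 0 < y < r -> PSeries a y = 0) -> forall n, a n = 0.
Proof.
  intros Hr Hc H n. revert a Hc H. induction n as [|n IH]; intros a Hc H.
  - now apply PSeries_zero_head with r.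
  - apply (IH (PS_decr_1 a)); [now rewrite CV_radius_decr_1|].
    intros y Hy. assert (E := H y Hy).
    rewrite (PSeries_decr_1_aux a y (PSeries_zero_head a r Hr Hc H)) in E.
    apply Rmult_integral in E. destruct E as [E|E]; [lra|exact E].
Qed.

Lemma ran_zero f r : 0 < r -> ran f -> (forall y, 0 < y < r -> f y = 0) ->
  exists d, 0 < d /\ forall y, Rabs y < d -> f y = 0.
Proof.
  intros Hr [a [s [Hs [Hc H]]]] H0. exists s. split; [exact Hs|].
  assert (Ha : forall n, a n = 0).
  { apply (PSeries_zero_right a (Rmin r s)).
    - apply Rmin_glb_lt; assumption.
    - eapply Rbar_lt_trans; [|exact Hc]. exact Hs.
    - intros y [Hy1 Hy2]. assert (A1 := Rmin_l r s). assert (A2 := Rmin_r r s).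
      rewrite <- H by (rewrite Rabs_pos_eq; lra). apply H0; lra. }
  intros y Hy. rewrite (H y Hy). rewrite (PSeries_ext a (fun _ => 0) y Ha). apply PSeries_const_0.
Qed.

(** The supremum of the set where f does not vanish would be an interior point with zeros
    on its right; the power series there is then zero on the left as well. *)
Lemma identity_line f al p be : al < p < be ->
  (forall x, al < x < be -> ran (fun y => f (x + y))) ->
  (forall x, p < x < be -> f x = 0) -> forall x, al < x < be -> f x = 0.
Proof.
  intros Hp Hr Hz x Hx. apply NNPP. intros Hn.
  set (E := fun u => al < u < be /\ f u <> 0).
  destruct (completeness E) as [m [Hm1 Hm2]].
  - exists p. intros u [Hu Hu2]. apply Rnot_lt_le. intros Hlt. apply Hu2, Hz. lra.
  - exists x. split; assumption.
  - assert (Hxm : x <= m) by (apply Hm1; split; assumption).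
    assert (Hmp : m <= p).
    { apply Hm2. intros u [Hu Hu2]. apply Rnot_lt_le. intros Hlt. apply Hu2, Hz. lra. }
    destruct (ran_zero (fun y => f (m + y)) (be - m)) as [d [Hd Hd2]].
    + lra.
    + apply Hr; lra.
    + intros y Hy. apply NNPP. intros Hne.
      assert (m + y <= m) by (apply Hm1; split; [lra|exact Hne]). lra.
    + assert (Hb : m <= m - d); [|lra]. apply Hm2. intros u [Hu Hu2].
      apply Rnot_lt_le. intros Hlt. apply Hu2.
      assert (Hum : u <= m) by (apply Hm1; split; assumption).
      replace u with (m + (u - m)) by ring. apply Hd2.
      rewrite Rabs_left1; lra.
Qed.

(** * Operations on analytic functions *)

Lemma analytic_const c s : analytic_at (fun _ => c) s.
Proof.
  exists (fun n => match n with O => c | _ => RtoC 0 end), 1. split; [lra|].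
  intros z _. unfold is_pseries. intros P HP.
  exists 0%nat. intros n _.
  replace (sum_n (G := C_AbelianMonoid) _ n) with c; [destruct HP as [e He]; apply He, ball_center|].
  induction n as [|n IH].
  - rewrite sum_O. simpl. symmetry. apply Cmult_1_l.
  - rewrite sum_Sn, <- IH. symmetry.
    transitivity (c + RtoC 0)%C; [|ring].
    apply (f_equal (fun d => (c + d)%C)). apply Cmult_0_r.
Qed.

Lemma analytic_plus f g s : analytic_at f s -> analytic_at g s ->
  analytic_at (fun w => f w + g w)%C s.
Proof.
  intros [a [r [Hr H]]] [b [r' [Hr' H']]]. exists (PS_plus a b), (Rmin r r').
  split; [now apply Rmin_glb_lt|]. intros z Hz.
  assert (A1 := Rmin_l r r'). assert (A2 := Rmin_r r r').
  apply (is_pseries_plus (K := C_AbsRing) (V := C_NormedModule)); [apply H|apply H']; lra.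
Qed.

Lemma analytic_scal c f s : analytic_at f s -> analytic_at (fun w => c * f w)%C s.
Proof.
  intros [a [r [Hr H]]]. exists (PS_scal c a), r. split; [exact Hr|]. intros z Hz.
  apply (is_pseries_scal (K := C_AbsRing) (V := C_NormedModule)); [apply Cmult_comm|now apply H].
Qed.

Lemma analytic_ext f g s : (forall w, f w = g w) -> analytic_at f s -> analytic_at g s.
Proof.
  intros E [a [r [Hr H]]]. exists a, r. split; [exact Hr|]. intros z Hz. rewrite <- E. now apply H.
Qed.

Lemma analytic_lin c f s : analytic_at f s -> analytic_at (fun w => (w - c) * f w)%C s.
Proof.
  intros Hf. apply analytic_ext with (fun w => (w - s) * f w + (s - c) * f w)%C; [intros; ring|].
  apply analytic_plus; [|now apply analytic_scal].
  destruct Hf as [a [r [Hr H]]].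
  exists (PS_incr_1 (K := C_AbsRing) (V := C_NormedModule) a), r. split; [exact Hr|]. intros z Hz.
  apply (is_pseries_incr_1 (K := C_AbsRing) (V := C_NormedModule)). now apply H.
Qed.

(** * The powers (1+t)^(-s) *)

Definition cpw (s : C) (t : R) : C := Cexp (- s * RtoC (ln (1 + t))).

Lemma cpw_plus a b t : cpw (a + b) t = (cpw a t * cpw b t)%C.
Proof. unfold cpw. rewrite <- Cexp_plus. f_equal. ring. Qed.

Lemma cpw_0 s : cpw s 0 = 1.
Proof. unfold cpw. rewrite Rplus_0_r, ln_1, Cmult_0_r. apply Cexp_0. Qed.

Lemma cpw_1 t : 0 <= t -> cpw 1 t = (/ (1 + RtoC t))%C.
Proof.
  intros Ht. unfold cpw. replace (- (1) * RtoC (ln (1 + t)))%C with (RtoC (- ln (1 + t)))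
    by (rewrite RtoC_opp; ring).
  rewrite Cexp_RtoC, exp_Ropp, exp_ln, RtoC_inv, RtoC_plus by lra. reflexivity.
Qed.

Lemma is_derive_ln1 t : 0 <= t -> is_derive (fun u => ln (1 + u)) t (/ (1 + t)).
Proof. intros Ht. auto_derive; [lra|]. field. lra. Qed.

Lemma cder_cpw s t : 0 <= t -> cder (cpw s) t (- s * cpw (s + 1) t)%C.
Proof.
  intros Ht. eapply cder_eq.
  - apply cder_Cexp, cder_scal, cder_R, is_derive_ln1, Ht.
  - rewrite cpw_plus, cpw_1 by exact Ht. rewrite RtoC_inv, RtoC_plus by lra. unfold cpw. ring.
Qed.

Lemma Cmod_cpw s t : Cmod (cpw s t) = exp (- Re s * ln (1 + t)).
Proof.
  unfold cpw. rewrite Cmod_Cexp. f_equal. destruct s; unfold Re; simpl; ring.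
Qed.

Lemma is_lim_pw c : 0 < c -> is_lim (fun t => exp (- c * ln (1 + t))) p_infty 0.
Proof.
  intros Hc. apply (is_lim_comp exp (fun t => - c * ln (1 + t)) p_infty 0 m_infty).
  - apply is_lim_exp_m.
  - apply is_lim_ext with (fun t => (- c) * ln (t + 1)).
    { intros t; f_equal; f_equal; ring. }
    replace m_infty with (Rbar_mult (- c) p_infty).
    + apply is_lim_scal_l. apply (is_lim_comp ln (fun t => t + 1) p_infty p_infty p_infty).
      * apply is_lim_ln_p.
      * replace p_infty with (Rbar_plus p_infty 1) by reflexivity.
        eapply is_lim_plus; [apply is_lim_id|apply is_lim_const|reflexivity].
      * exists 0. intros; discriminate.
    + simpl. destruct (Rle_dec 0 (- c)); [exfalso; lra|reflexivity].
  - exists 0. intros; discriminate.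
Qed.

Lemma is_derive_pw D c t : 0 < c -> 0 <= t ->
  is_derive (fun u => - (D / c) * exp (- c * ln (1 + u))) t (D * exp (- (c + 1) * ln (1 + t))).
Proof.
  intros Hc Ht. replace (- (c + 1) * ln (1 + t)) with (- c * ln (1 + t) + - ln (1 + t)) by ring.
  rewrite exp_plus, exp_Ropp, exp_ln by lra. auto_derive; [lra|]. field. lra.
Qed.

Lemma continuous_pw D c t : 0 <= t -> continuous (fun u => D * exp (- (c + 1) * ln (1 + u))) t.
Proof.
  intros Ht. apply ex_derive_Rcontinuous. auto_derive. lra.
Qed.

Lemma pw_dom f D c : 0 < c -> (forall T, 0 <= T -> cintegrable f 0 T) ->
  (forall t, 0 < t -> Cmod (f t) <= D * exp (- (c + 1) * ln (1 + t))) ->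
  exists I, cint_inf f I.
Proof.
  intros Hc Hi Hb.
  destruct (cint_inf_dom_pt f (fun t => D * exp (- (c + 1) * ln (1 + t)))
    (fun t => - (D / c) * exp (- c * ln (1 + t))) 0) as [I [HI _]].
  - exact Hi.
  - replace (Finite 0) with (Rbar_mult (- (D / c)) 0) by (simpl; f_equal; ring).
    apply is_lim_scal_l, is_lim_pw, Hc.
  - intros t Ht. now apply is_derive_pw.
  - intros t Ht. now apply continuous_pw.
  - exact Hb.
  - exists I; exact HI.
Qed.

Lemma pw_bound f D c I : 0 < c -> cint_inf f I ->
  (forall t, 0 < t -> Cmod (f t) <= D * exp (- (c + 1) * ln (1 + t))) -> Cmod I <= D / c.
Proof.
  intros Hc HI Hb.
  assert (HD : 0 <= D).
  { specialize (Hb 1 ltac:(lra)). assert (A := Cmod_ge_0 (f 1)).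
    assert (B := exp_pos (- (c + 1) * ln (1 + 1))). nra. }
  apply (cint_inf_bound f I _ HI). intros T J HT HJ.
  assert (Hi : is_RInt (fun t => D * exp (- (c + 1) * ln (1 + t))) 0 T
     (- (D / c) * exp (- c * ln (1 + T)) - - (D / c) * exp (- c * ln (1 + 0)))).
  { apply (is_RInt_derive (V := R_CompleteNormedModule) (fun t => - (D / c) * exp (- c * ln (1 + t))));
      rewrite Rmin_left by lra; intros x Hx; [apply is_derive_pw; lra|apply continuous_pw; lra]. }
  eapply Rle_trans; [apply (cint_le f _ 0 T J _ HT HJ Hi)|].
  - intros x Hx; apply Hb; lra.
  - rewrite Rplus_0_r, ln_1, Rmult_0_r, exp_0.
    assert (A := exp_pos (- c * ln (1 + T))). assert (0 <= D / c) by (apply Rdiv_le_0_compat; lra). nra.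
Qed.

(** Euler-Maclaurin applied to (1+t)^(-s) leaves the integral of this kernel. It
    converges for Re s > -2, far enough to differentiate zeta at -1. *)
Definition zker (s : C) (t : R) : C := (RtoC (bper 3 t) * cpw (s + 3) t)%C.

Definition zval (s : C) : C := improper (zker s).

Lemma cintegrable_zker s T : 0 <= T -> cintegrable (zker s) 0 T.
Proof.
  intros HT. apply cintegrable_bper; [|exact HT]. intros t Ht. eapply cder_ccont, cder_cpw, Ht.
Qed.

Lemma zker_bound s D t : (forall u, Rabs (bper 3 u) <= D) ->
  Cmod (zker s t) <= D * exp (- (Re s + 2 + 1) * ln (1 + t)).
Proof.
  intros HD. unfold zker. rewrite Cmod_mult, Cmod_R, Cmod_cpw.
  apply Rmult_le_compat; [apply Rabs_pos|left; apply exp_pos|apply HD|].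
  right. do 2 f_equal. destruct s; unfold Re; simpl; ring.
Qed.

Lemma zval_correct s : -2 < Re s -> cint_inf (zker s) (zval s).
Proof.
  intros Hs. destruct (bper_bound 3) as [D [HD HD1]].
  destruct (pw_dom (zker s) D (Re s + 2)) as [I HI].
  - lra.
  - intros T HT; now apply cintegrable_zker.
  - intros t _. now apply zker_bound.
  - exact (improper_correct _ _ HI).
Qed.

(** ** Power series of the kernel integral *)

Fixpoint Ctay (n : nat) (u : C) : C :=
  match n with O => RtoC 0 | S k => (Ctay k u + u ^ k / RtoC (INR (fact k)))%C end.

Lemma cder_Ctay n u x : cder (fun y => Ctay (S n) (RtoC y * u)) x (u * Ctay n (RtoC x * u))%C.
Proof.
  assert (Hl : cder (fun y => RtoC y * u)%C x u).
  { eapply cder_eq; [apply (cder_mult (fun u => RtoC u) (fun _ => u)); [apply cder_id|apply cder_const]|].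
    cbv beta. ring. }
  induction n as [|n IH].
  - cbn [Ctay]. apply cder_ext with (fun _ => RtoC 0 + 1 / RtoC (INR (fact 0)))%C; [reflexivity|].
    eapply cder_eq; [apply cder_const|]. ring.
  - change (Ctay (S (S n))) with (fun v => Ctay (S n) v + v ^ (S n) / RtoC (INR (fact (S n))))%C.
    cbv beta. eapply cder_eq.
    + apply cder_plus; [exact IH|].
      apply (cder_mult (fun y => (RtoC y * u) ^ S n)%C (fun _ => / RtoC (INR (fact (S n))))%C);
        [apply cder_pow, Hl|apply cder_const].
    + cbn [Ctay]. cbv beta. simpl pred. rewrite fact_simpl, mult_INR, RtoC_mult.
      assert (A := RtoC_nz _ (INR_fact_neq_0 n)).
      assert (B := RtoC_nz _ (Rgt_not_eq _ _ (INR_S_pos n))). field. split; assumption.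
Qed.

Lemma exp_monotone x y : x <= y -> exp x <= exp y.
Proof. intros [H|H]; [left; now apply exp_increasing|subst; lra]. Qed.

(** By induction: the derivative of the error of order n+1 is u times the error of
    order n. *)
Lemma Cexp_taylor n u x : 0 <= x ->
  Cmod (Cexp (RtoC x * u) - Ctay n (RtoC x * u)) <= (x * Cmod u) ^ n / INR (fact n) * exp (x * Cmod u).
Proof.
  assert (Hm := Cmod_ge_0 u).
  assert (Hl : forall x, cder (fun y => RtoC y * u)%C x u).
  { intros y. eapply cder_eq; [apply (cder_mult (fun u => RtoC u) (fun _ => u)); [apply cder_id|apply cder_const]|].
    cbv beta. ring. }
  revert x; induction n as [|n IH]; intros x Hx.
  - cbn [Ctay]. replace (Cexp (RtoC x * u) - RtoC 0)%C with (Cexp (RtoC x * u)) by ring.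
    rewrite Cmod_Cexp. change ((x * Cmod u) ^ 0 / INR (fact 0)) with (1 / 1).
    rewrite Rdiv_1_r, Rmult_1_l. apply exp_monotone. rewrite Re_RtoC_mult.
    assert (A := re_le_Cmod u). assert (B := Rle_abs (Re u)). nra.
  - assert (Hd : forall y, cder (fun y => Cexp (RtoC y * u) - Ctay (S n) (RtoC y * u))%C y
        (u * (Cexp (RtoC y * u) - Ctay n (RtoC y * u)))%C).
    { intros y. eapply cder_eq; [apply cder_minus; [apply cder_Cexp, Hl|apply cder_Ctay]|]. cbv beta. ring. }
    assert (Hg : forall y, is_derive (fun y => (y * Cmod u) ^ S n / INR (fact (S n)) * exp (y * Cmod u)) y
       (Cmod u * ((y * Cmod u) ^ n / INR (fact n)) * exp (y * Cmod u)
          + (y * Cmod u) ^ S n / INR (fact (S n)) * (Cmod u * exp (y * Cmod u)))).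
    { intros y. assert (A := INR_fact_neq_0 n). assert (B := Rgt_not_eq _ _ (INR_S_pos n)).
      rewrite fact_simpl, mult_INR.
      apply (is_derive_Rmult (fun y => (y * Cmod u) ^ S n / (INR (S n) * INR (fact n)))
               (fun y => exp (y * Cmod u))).
      - eapply is_derive_eq.
        + apply (is_derive_Rmult (fun y => (y * Cmod u) ^ S n) (fun _ => / (INR (S n) * INR (fact n))));
            [|apply is_derive_Rconst].
          apply (is_derive_pow (fun y => y * Cmod u) (S n) y (Cmod u)). auto_derive; [exact I|ring].
        + simpl pred. to_R. field. split; assumption.
      - auto_derive; [exact I|ring]. }
    assert (A := cder_le _ _ _ _ 0 x Hx (fun y _ => Hd y) (fun y _ => Hg y)
       (fun y _ => cder_ccont _ _ _ (Hd y))
       (fun y _ => ex_derive_Rcontinuous _ _ (ex_intro _ _ (Hg y)))).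
    cbv beta in A.
    assert (E0 : (Cexp (RtoC 0 * u) - Ctay (S n) (RtoC 0 * u))%C = RtoC 0).
    { replace (RtoC 0 * u)%C with (RtoC 0) by ring. rewrite Cexp_0.
      assert (T : forall k, Ctay (S k) 0 = 1).
      { induction k as [|k IHk]; [cbn [Ctay]; simpl; field|].
        change (Ctay (S (S k)) 0) with (Ctay (S k) 0 + RtoC 0 ^ S k / RtoC (INR (fact (S k))))%C.
        rewrite IHk, Cpow_S. unfold Cdiv. ring. }
      rewrite T. ring. }
    rewrite E0 in A. rewrite Rmult_0_l, pow_i in A by lia.
    match type of A with context [Cmod (?X - RtoC 0)] =>
      replace (X - RtoC 0)%C with X in A by ring end.
    replace (0 / INR (fact (S n)) * exp 0) with 0 in A by (unfold Rdiv; ring).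
    rewrite Rminus_0_r in A. apply A. intros y Hy. rewrite Cmod_mult.
    assert (P1 : 0 <= (y * Cmod u) ^ S n / INR (fact (S n)) * (Cmod u * exp (y * Cmod u))).
    { apply Rmult_le_pos.
      - apply Rdiv_le_0_compat; [apply pow_le; nra|apply INR_fact_lt_0].
      - apply Rmult_le_pos; [exact Hm|left; apply exp_pos]. }
    specialize (IH y ltac:(lra)). rewrite Rmult_assoc.
    assert (Cmod u * Cmod (Cexp (RtoC y * u) - Ctay n (RtoC y * u)) <=
      Cmod u * ((y * Cmod u) ^ n / INR (fact n) * exp (y * Cmod u))) by now apply Rmult_le_compat_l.
    lra.
Qed.

Lemma pow_fact_le_exp y n : 0 <= y -> y ^ n / INR (fact n) <= exp y.
Proof.
  intros Hy. assert (H := exp_ge_taylor y n Hy).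
  eapply Rle_trans; [|exact H]. destruct n as [|n]; [simpl; lra|].
  rewrite tech5. assert (0 <= sum_f_R0 (fun k => y ^ k / INR (fact k)) n); [|lra].
  apply cond_pos_sum. intros k. apply Rdiv_le_0_compat; [now apply pow_le|apply INR_fact_lt_0].
Qed.

Definition zcoef_ker (s : C) (k : nat) (t : R) : C :=
  (RtoC (bper 3 t) * (cpw (s + 3) t * ((- RtoC (ln (1 + t))) ^ k / RtoC (INR (fact k)))))%C.

Definition zcoef (s : C) (k : nat) : C := improper (zcoef_ker s k).

Lemma cintegrable_zcoef s k T : 0 <= T -> cintegrable (zcoef_ker s k) 0 T.
Proof.
  intros HT. apply cintegrable_bper; [|exact HT]. intros t Ht.
  apply ccont_mult; [eapply cder_ccont, cder_cpw, Ht|].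
  apply (ccont_mult (fun t => (- RtoC (ln (1 + t))) ^ k)%C (fun _ => / RtoC (INR (fact k)))%C);
    [|apply ccont_const].
  eapply cder_ccont, cder_pow, cder_opp, cder_R, is_derive_ln1, Ht.
Qed.

Lemma ln1_pos t : 0 <= t -> 0 <= ln (1 + t).
Proof.
  intros Ht. destruct (Req_dec t 0) as [E|E]; [subst; rewrite Rplus_0_r, ln_1; lra|].
  rewrite <- ln_1. left. apply ln_increasing; lra.
Qed.

Lemma zcoef_correct s k : -2 < Re s -> cint_inf (zcoef_ker s k) (zcoef s k).
Proof.
  intros Hs. destruct (bper_bound 3) as [D [HD HD1]]. set (c := Re s + 2).
  assert (Hc : 0 < c) by (unfold c; lra).
  destruct (pw_dom (zcoef_ker s k) (D * (2 / c) ^ k) (c / 2)) as [I HI].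
  - lra.
  - intros T HT; now apply cintegrable_zcoef.
  - intros t Ht. unfold zcoef_ker. set (L := ln (1 + t)). assert (HL : 0 <= L) by (apply ln1_pos; lra).
    rewrite !Cmod_mult, Cmod_R, Cmod_cpw. fold L. rewrite Cmod_div by apply RtoC_nz, INR_fact_neq_0.
    rewrite Cmod_pow, Cmod_opp, !Cmod_R, (Rabs_pos_eq L), (Rabs_pos_eq (INR _)) by (assumption || apply pos_INR).
    assert (HP := pow_fact_le_exp (c / 2 * L) k ltac:(nra)).
    replace ((c / 2 * L) ^ k / INR (fact k)) with ((c / 2) ^ k * (L ^ k / INR (fact k))) in HP
      by (rewrite Rpow_mult_distr; unfold Rdiv; ring).
    assert (Hq : (2 / c) ^ k * (c / 2) ^ k = 1).
    { rewrite <- Rpow_mult_distr. replace (2 / c * (c / 2)) with 1 by (field; lra). apply pow1. }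
    assert (Hq2 : 0 < (2 / c) ^ k) by (apply pow_lt, Rdiv_lt_0_compat; lra).
    assert (HP2 : L ^ k / INR (fact k) <= (2 / c) ^ k * exp (c / 2 * L)).
    { apply Rmult_le_compat_l with (r := (2 / c) ^ k) in HP; [|lra].
      rewrite <- Rmult_assoc, Hq, Rmult_1_l in HP. exact HP. }
    rewrite Rmult_assoc. apply Rmult_le_compat; [apply Rabs_pos| |apply HD1|].
    { apply Rmult_le_pos; [left; apply exp_pos|]. apply Rdiv_le_0_compat; [now apply pow_le|apply INR_fact_lt_0]. }
    apply Rle_trans with (exp (- Re (s + 3) * L) * ((2 / c) ^ k * exp (c / 2 * L))).
    { apply Rmult_le_compat_l; [left; apply exp_pos|exact HP2]. }
    right. replace (- (c / 2 + 1) * L) with (- Re (s + 3) * L + c / 2 * L).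
    + rewrite exp_plus. ring.
    + unfold c. destruct s; unfold Re; simpl; field.
  - exact (improper_correct _ _ HI).
Qed.

Fixpoint csum_n (f : nat -> C) (n : nat) : C :=
  match n with O => RtoC 0 | S k => (csum_n f k + f k)%C end.

Lemma sum_n_csum (f : nat -> C) n : sum_n (G := C_AbelianMonoid) f n = csum_n f (S n).
Proof.
  induction n as [|n IH].
  - rewrite sum_O. cbn [csum_n]. symmetry. apply Cplus_0_l.
  - rewrite sum_Sn, IH. reflexivity.
Qed.

Lemma is_series_of_cseq (f : nat -> C) l : cseq (fun n => csum_n f (S n)) l ->
  is_series (K := C_AbsRing) (V := C_NormedModule) f l.
Proof.
  intros H P [eps HP]. apply is_lim_seq_spec in H.
  destruct (H eps) as [N HN]. exists N. intros n Hn. apply HP.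
  rewrite sum_n_csum. apply C_NormedModule_mixin_compat1.
  specialize (HN n Hn). cbv beta in HN. rewrite Rminus_0_r, Rabs_pos_eq in HN by apply Cmod_ge_0. exact HN.
Qed.

Lemma zcoef_partial s w n : -2 < Re s ->
  cint_inf (fun t => RtoC (bper 3 t) * (cpw (s + 3) t * Ctay n (w * - RtoC (ln (1 + t)))))%C
    (csum_n (fun k => w ^ k * zcoef s k)%C n).
Proof.
  intros Hs. induction n as [|n IH].
  - cbn [csum_n Ctay]. apply cint_inf_ext with (fun t => 0 * zker s t)%C; [intros; unfold zker; ring|].
    eapply cint_inf_eq; [apply cint_inf_scal, zval_correct, Hs|]. ring.
  - cbn [csum_n Ctay].
    apply cint_inf_ext with (fun t => RtoC (bper 3 t) * (cpw (s + 3) t * Ctay n (w * - RtoC (ln (1 + t))))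
       + w ^ n * zcoef_ker s n t)%C.
    { intros t _. unfold zcoef_ker. rewrite Cpow_mult_l. unfold Cdiv. ring. }
    apply cint_inf_plus; [exact IH|]. apply cint_inf_scal, zcoef_correct, Hs.
Qed.

(** Expanding exp(-w log(1+t)) under the integral; the exponential remainder is
    absorbed by a fraction of the decay (1+t)^(-c-1), c = Re s + 2. *)
Lemma analytic_zval s : -2 < Re s -> analytic_at zval s.
Proof.
  intros Hs. set (c := Re s + 2). assert (Hc : 0 < c) by (unfold c; lra).
  exists (zcoef s), (c / 8). split; [lra|]. intros z Hz. set (w := (z - s)%C) in *.
  destruct (bper_bound 3) as [D [HD HD1]].
  assert (Hzr : -2 < Re z).
  { replace z with (s + w)%C by (unfold w; ring). assert (A := re_le_Cmod w).
    apply Rabs_le_between in A. rewrite re_plus. unfold c in *. lra. }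
  apply is_series_of_cseq.
  apply cseq_ext with (fun n => csum_n (fun k => w ^ k * zcoef s k)%C (S n)).
  { intros n. generalize (S n). intros m. induction m as [|m IH]; cbn [csum_n]; [reflexivity|].
    rewrite IH. reflexivity. }
  apply cseq_squeeze with (fun n => D * (/ 2) ^ S n / (5 * c / 8)).
  - intros n. rewrite Cmod_minus_sym.
    apply (pw_bound (fun t => zker z t
       - RtoC (bper 3 t) * (cpw (s + 3) t * Ctay (S n) (w * - RtoC (ln (1 + t)))))%C).
    + lra.
    + apply cint_inf_minus; [apply zval_correct, Hzr|apply zcoef_partial, Hs].
    + intros t Ht. set (L := ln (1 + t)). assert (HL : 0 <= L) by (apply ln1_pos; lra).
      assert (Ez : zker z t = (RtoC (bper 3 t) * (cpw (s + 3) t * Cexp (RtoC L * - w)))%C).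
      { unfold zker. f_equal. replace (z + 3)%C with (s + 3 + w)%C by (unfold w; ring).
        rewrite cpw_plus. f_equal. unfold cpw. f_equal. fold L. ring. }
      rewrite Ez. replace (w * - RtoC L)%C with (RtoC L * - w)%C by ring.
      replace (RtoC (bper 3 t) * (cpw (s + 3) t * Cexp (RtoC L * - w))
         - RtoC (bper 3 t) * (cpw (s + 3) t * Ctay (S n) (RtoC L * - w)))%C
        with (RtoC (bper 3 t) * (cpw (s + 3) t * (Cexp (RtoC L * - w) - Ctay (S n) (RtoC L * - w))))%C by ring.
      rewrite !Cmod_mult, Cmod_R, Cmod_cpw. fold L.
      assert (HT := Cexp_taylor (S n) (- w) L HL). rewrite Cmod_opp in HT.
      set (m := Cmod w) in *. assert (Hm : 0 <= m) by apply Cmod_ge_0.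
      assert (HP := pow_fact_le_exp (c / 4 * L) (S n) ltac:(nra)).
      assert (HQ : (L * m) ^ S n / INR (fact (S n)) <= (/ 2) ^ S n * exp (c / 4 * L)).
      { apply Rle_trans with ((/ 2) ^ S n * ((c / 4 * L) ^ S n / INR (fact (S n)))).
        - replace ((/ 2) ^ S n * ((c / 4 * L) ^ S n / INR (fact (S n))))
            with ((/ 2 * (c / 4 * L)) ^ S n / INR (fact (S n)))
            by (rewrite (Rpow_mult_distr (/ 2)); unfold Rdiv; ring).
          apply Rmult_le_compat_r; [left; apply Rinv_0_lt_compat, INR_fact_lt_0|].
          apply pow_incr. split; [nra|]. nra.
        - apply Rmult_le_compat_l; [apply pow_le; lra|exact HP]. }
      assert (HE : exp (L * m) <= exp (c / 8 * L)).
      { apply exp_monotone. nra. }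
      rewrite (Rmult_assoc D). apply Rmult_le_compat; [apply Rabs_pos| |apply HD1|].
      { apply Rmult_le_pos; [left; apply exp_pos|apply Cmod_ge_0]. }
      apply Rle_trans with (exp (- Re (s + 3) * L) * ((/ 2) ^ S n * exp (c / 4 * L) * exp (c / 8 * L))).
      { apply Rmult_le_compat_l; [left; apply exp_pos|]. eapply Rle_trans; [exact HT|].
        apply Rmult_le_compat; try assumption; [|left; apply exp_pos].
        apply Rdiv_le_0_compat; [apply pow_le; nra|apply INR_fact_lt_0]. }
      right. replace (- (5 * c / 8 + 1) * L) with (- Re (s + 3) * L + (c / 4 * L + c / 8 * L)).
      * rewrite !exp_plus. ring.
      * unfold c. destruct s; unfold Re; simpl; field.
  - apply is_lim_seq_ext with (fun n => (D / 2 / (5 * c / 8)) * (/ 2) ^ n).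
    { intros n. simpl. field. lra. }
    replace (Finite 0) with (Finite (D / 2 / (5 * c / 8) * 0)) by (f_equal; ring).
    apply is_lim_seq_mult'; [apply is_lim_seq_const|].
    apply is_lim_seq_geom. rewrite Rabs_pos_eq; lra.
Qed.

(** * The zeta function and the Glaisher-Kinkelin constant *)

Lemma cpw_lim s : 0 < Re s -> cseq (fun m => cpw s (INR m)) 0.
Proof.
  intros Hs. apply cseq_squeeze with (fun m => exp (- Re s * ln (1 + INR m))).
  - intros m. replace (cpw s (INR m) - 0)%C with (cpw s (INR m)) by ring.
    rewrite Cmod_cpw. lra.
  - apply (is_lim_comp_seq (fun t => exp (- Re s * ln (1 + t))) INR p_infty 0 (is_lim_pw _ Hs)).
    + exists 0%nat. intros; discriminate.
    + apply is_lim_seq_INR.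
Qed.

Lemma zeta_series_sum zeta s : is_riemann_zeta zeta -> 1 < Re s ->
  cseq (fun m => 1 + Csum (fun k => cpw s (INR k)) m)%C (zeta s).
Proof.
  intros [_ Hz] Hs. specialize (Hz s Hs). apply is_series_components in Hz.
  destruct Hz as [H1 H2].
  set (a := fun n => Cexp (- s * RtoC (ln (INR (S n))))) in *.
  assert (E : forall m, (1 + Csum (fun k => cpw s (INR k)) m)%C = sum_n (G := C_AbelianMonoid) a m).
  { assert (Ea : forall n, a n = cpw s (INR n)).
    { intros n. unfold a, cpw. rewrite S_INR, (Rplus_comm (INR n) 1). reflexivity. }
    induction m as [|m IH].
    - rewrite sum_O, Ea. cbn [Csum]. simpl (INR 0). rewrite cpw_0. ring.
    - rewrite sum_Sn, <- IH, Ea. cbn [Csum]. rewrite Cplus_assoc. reflexivity. }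
  apply cseq_ext with (1 := fun m => eq_sym (E m)). apply cseq_components.
  - apply is_lim_seq_ext with (sum_n (G := R_AbelianMonoid) (fun k => Re (a k)));
      [intros n; now rewrite Re_sum_n|exact H1].
  - apply is_lim_seq_ext with (sum_n (G := R_AbelianMonoid) (fun k => Im (a k)));
      [intros n; now rewrite Im_sum_n|exact H2].
Qed.

(** For Re s > 1 all boundary terms at m in the Euler-Maclaurin formula tend to 0. *)
Lemma zeta_half_plane zeta s : is_riemann_zeta zeta -> 1 < Re s ->
  (zeta s = / (s - 1) + / 2 + s / 12 - s * (s + 1) * (s + 2) / 6 * zval s)%C.
Proof.
  intros Hz Hs.
  assert (Hn : (s - 1)%C <> RtoC 0).
  { intros E. apply (f_equal Re) in E. destruct s; unfold Re in *; simpl in *. lra. }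
  assert (Hn' : (1 - s)%C <> RtoC 0).
  { intros E. apply Hn. replace (s - 1)%C with (- (1 - s))%C by ring. rewrite E. ring. }
  set (J m := cRInt (zker s) 0 (INR m)).
  assert (HJ : forall m, cint (zker s) 0 (INR m) (J m)).
  { intros m. apply cRInt_correct, cintegrable_zker, pos_INR. }
  assert (HJl := cint_inf_seq _ _ _ (zval_correct s ltac:(lra)) HJ).
  assert (ES : forall m, (Csum (fun k => cpw s (INR k)) m =
     (cpw (s - 1) (INR m) - 1) / (1 - s) + (cpw s (INR m) - 1) / 2
     + - s * (cpw (s + 1) (INR m) - 1) / 12 - s * (s + 1) * (s + 2) / 6 * J m)%C).
  { intros m.
    destruct (euler_maclaurin (fun t => / (1 - s) * cpw (s - 1) t)%C (cpw s)
       (fun t => - s * cpw (s + 1) t)%C (fun t => s * (s + 1) * cpw (s + 2) t)%C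
       (fun t => - (s * (s + 1) * (s + 2)) * cpw (s + 3) t)%C m) as [K [HK E]].
    - intros t Ht. eapply cder_eq; [apply cder_scal, cder_cpw, Ht|].
      replace (s - 1 + 1)%C with s by ring. field. exact Hn'.
    - intros t Ht. now apply cder_cpw.
    - intros t Ht. eapply cder_eq; [apply cder_scal, cder_cpw, Ht|].
      replace (s + 1 + 1)%C with (s + 2)%C by ring. ring.
    - intros t Ht. eapply cder_eq; [apply cder_scal, cder_cpw, Ht|].
      replace (s + 2 + 1)%C with (s + 3)%C by ring. ring.
    - intros t Ht. apply ccont_mult; [apply ccont_const|eapply cder_ccont, cder_cpw, Ht].
    - cbv beta in E. rewrite E, !cpw_0.
      replace K with (- (s * (s + 1) * (s + 2)) * J m)%C.
      + field. exact Hn'.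
      + apply (cint_unique (fun t => - (s * (s + 1) * (s + 2)) * zker s t)%C 0 (INR m)).
        * apply cint_scal, HJ.
        * apply cint_ext with (2 := HK). intros t _. unfold zker. ring. }
  apply (cseq_unique _ _ _ (zeta_series_sum zeta s Hz Hs)).
  apply cseq_ext with (fun m => (1 - / (1 - s) - / 2 + s / 12) + (/ (1 - s) * cpw (s - 1) (INR m)
     + (/ 2 * cpw s (INR m) + (- s / 12 * cpw (s + 1) (INR m) + - (s * (s + 1) * (s + 2) / 6) * J m))))%C.
  { intros m. rewrite ES. field. exact Hn'. }
  eapply cseq_eq.
  - apply cseq_plus; [apply cseq_const|].
    apply cseq_plus; [|apply cseq_plus; [|apply cseq_plus]]; apply cseq_scal;
      [apply cpw_lim|apply cpw_lim|apply cpw_lim|exact HJl];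
      destruct s; unfold Re in *; simpl in *; lra.
  - field. split; assumption.
Qed.

Lemma ran_ext f g : (forall y, f y = g y) -> ran f -> ran g.
Proof.
  intros E [a [r [Hr [Hc H]]]]. exists a, r. split; [exact Hr|]. split; [exact Hc|].
  intros y Hy. rewrite <- E. now apply H.
Qed.

Lemma ran_derive f : ran f -> exists l, is_derive f 0 l.
Proof.
  intros [a [r [Hr [Hc H]]]]. exists (PSeries (PS_derive a) 0).
  apply is_derive_ext_loc with (PSeries a).
  - exists (mkposreal r Hr). intros y Hy. symmetry. apply H.
    replace y with (y - 0) by ring. exact Hy.
  - apply is_derive_PSeries. rewrite Rabs_R0. eapply Rbar_lt_trans; [|exact Hc]. exact Hr.
Qed.

Lemma C_derive_line (f : C -> C) (z0 d e : C) :
  is_derive (K := C_AbsRing) (V := C_NormedModule) f z0 d ->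
  cder (fun x => f (z0 + RtoC x * e)%C) 0 (e * d)%C.
Proof.
  intros [_ H]. specialize (H z0 (fun P HP => HP)).
  assert (He := Cmod_ge_0 e).
  apply cder_of_quotient. intros eps Heps.
  assert (Hp : 0 < eps / (2 * (Cmod e + 1))) by (apply Rdiv_lt_0_compat; lra).
    destruct (H (mkposreal _ Hp)) as [del Hdel]. simpl pos in Hdel.
    exists (del / (Cmod e + 1)). split; [apply Rdiv_lt_0_compat; [apply cond_pos|lra]|].
    intros h Hh0 Hh. rewrite Rplus_0_l. replace (z0 + RtoC 0 * e)%C with z0 by ring. assert (Hn := RtoC_nz _ Hh0). apply Rlt_div_r in Hh; [|lra].
    assert (B := Rabs_pos_lt _ Hh0).
    specialize (Hdel (z0 + RtoC h * e)%C).
    assert (A : Cmod (f (z0 + RtoC h * e)%C - f z0 - (z0 + RtoC h * e - z0) * d)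
        <= eps / (2 * (Cmod e + 1)) * Cmod (z0 + RtoC h * e - z0)).
    { apply Hdel. change (Cmod (z0 + RtoC h * e - z0) < del).
      replace (z0 + RtoC h * e - z0)%C with (RtoC h * e)%C by ring.
      rewrite Cmod_mult, Cmod_R. nra. }
    replace (z0 + RtoC h * e - z0)%C with (RtoC h * e)%C in A by ring.
    rewrite Cmod_mult, Cmod_R in A.
    replace ((f (z0 + RtoC h * e)%C - f z0) / RtoC h - e * d)%C
      with ((f (z0 + RtoC h * e)%C - f z0 - RtoC h * e * d) / RtoC h)%C by (field; exact Hn).
    rewrite Cmod_div, Cmod_R by exact Hn. apply Rlt_div_l; [exact B|].
    eapply Rle_lt_trans; [exact A|].
    replace (eps / (2 * (Cmod e + 1)) * (Rabs h * Cmod e)) with (eps * Rabs h * (Cmod e / (2 * (Cmod e + 1))))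
      by (field; lra).
    assert (Cmod e / (2 * (Cmod e + 1)) < 1) by (apply Rlt_div_l; lra).
    assert (0 < eps * Rabs h) by nra. nra.
Qed.

Lemma cder_unique f t l m : cder f t l -> cder f t m -> l = m.
Proof.
  intros [H1 H2] [H3 H4]. apply C_ext.
  - rewrite <- (is_derive_unique _ _ _ H1). exact (is_derive_unique _ _ _ H3).
  - rewrite <- (is_derive_unique _ _ _ H2). exact (is_derive_unique _ _ _ H4).
Qed.

Lemma zval_m1 : zval (-1) = kval 3 2 1.
Proof.
  apply (cint_inf_unique (zker (-1))).
  - apply zval_correct. simpl; lra.
  - apply cint_inf_ext with (2 := kval_correct 3 2 1 slit_plane_1 ltac:(lia)).
    intros t Ht. unfold zker. replace (RtoC (-1) + 3)%C with (1 + 1)%C.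
    + rewrite cpw_plus, cpw_1 by lra. assert (Hn := slit_shift_nz 1 t slit_plane_1 ltac:(lra)).
      replace (1 + RtoC t)%C with (RtoC t + 1)%C by ring. field. exact Hn.
    + rewrite <- !RtoC_plus. f_equal. ring.
Qed.

(** (s-1) zeta(s) minus its Euler-Maclaurin continuation; it vanishes for Re s > 1,
    hence along the line from there to s = -1 with direction 1+i, which avoids the pole.
    The polynomial factors are written as products of s - c, the form in which analyticity
    and derivatives can be read off factor by factor. *)
Definition zeta_defect (zeta : C -> C) (s : C) : C :=
  ((s - 1) * zeta s + ((-1) * (1 + (s - 1) * (/ 12 * ((s - (-6)) * 1)))
    + / 6 * ((s - 0) * ((s - (-1)) * ((s - (-2)) * ((s - 1) * zval s))))))%C.

Definition zline (x : R) : C := (RtoC (-1) + RtoC x * (1 + Ci))%C.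

Lemma Re_zline x : Re (zline x) = x - 1.
Proof. unfold zline, Re, Ci; simpl. ring. Qed.

Lemma Im_zline x : Im (zline x) = x.
Proof. unfold zline, Im, Ci; simpl. ring. Qed.

Lemma zeta_defect_zero zeta : is_riemann_zeta zeta ->
  forall x, - / 2 < x < 3 -> zeta_defect zeta (zline x) = 0.
Proof.
  intros Hz.
  assert (Ha : forall x, - / 2 < x < 3 -> analytic_at (zeta_defect zeta) (zline x)).
  { intros x Hx. unfold zeta_defect. apply analytic_plus; [|apply analytic_plus].
    - apply analytic_lin. apply Hz. intros E.
      assert (E1 := f_equal Re E). assert (E2 := f_equal Im E).
      rewrite Re_zline in E1. rewrite Im_zline in E2. simpl in E1, E2. lra.
    - apply analytic_scal, analytic_plus; [apply analytic_const|].
      apply analytic_lin, analytic_scal, analytic_lin, analytic_const.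
    - apply analytic_scal. do 4 apply analytic_lin. apply analytic_zval. rewrite Re_zline. lra. }
  assert (H0 : forall x, 2 < x < 3 -> zeta_defect zeta (zline x) = 0).
  { intros x Hx. assert (Hr := Re_zline x).
    unfold zeta_defect. rewrite (zeta_half_plane zeta) by (assumption || lra).
    assert (Hn : (zline x - 1)%C <> RtoC 0).
    { intros E. apply (f_equal Re) in E. unfold Cminus in E.
      rewrite re_plus, re_opp, Hr in E. simpl in E. lra. } field. exact Hn. }
  intros x Hx.
  assert (E : forall u y, (zline u + RtoC y * (1 + Ci))%C = zline (u + y)).
  { intros u y. unfold zline. rewrite RtoC_plus. ring. }
  apply C_ext; simpl.
  - apply (identity_line (fun u => Re (zeta_defect zeta (zline u))) (- / 2) 2 3); try lra.
    + intros u Hu. destruct (analytic_line _ _ (1 + Ci)%C (Ha u Hu)) as [A _].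
      eapply ran_ext; [|exact A]. intros y. cbv beta. now rewrite E.
    + intros u Hu. rewrite H0 by exact Hu. reflexivity.
  - apply (identity_line (fun u => Im (zeta_defect zeta (zline u))) (- / 2) 2 3); try lra.
    + intros u Hu. destruct (analytic_line _ _ (1 + Ci)%C (Ha u Hu)) as [_ A].
      eapply ran_ext; [|exact A]. intros y. cbv beta. now rewrite E.
    + intros u Hu. rewrite H0 by exact Hu. reflexivity.
Qed.

(** Differentiate the defect at -1 along the line. The factor s+1 in front of the kernel
    integral vanishes there, so only the value of that integral enters, not its derivative. *)
Lemma zeta_derive_m1 zeta d : is_riemann_zeta zeta ->
  is_derive (K := C_AbsRing) (V := C_NormedModule) zeta (RtoC (-1)) d ->
  d = (- / 6 + kval 3 2 1 / 6)%C.
Proof.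
  intros Hz Hd. rewrite <- zval_m1. set (e := (1 + Ci)%C).
  assert (Hzero := zeta_defect_zero zeta Hz).
  assert (E0 : zline 0 = RtoC (-1)) by (unfold zline; ring).
  assert (Hv : zeta (RtoC (-1)) = (- / 12)%C).
  { assert (A := Hzero 0 ltac:(lra)). rewrite E0 in A. unfold zeta_defect in A.
    apply Ceq_minus. match type of A with (?X = _)%C => transitivity (- / 2 * X)%C; [field|] end.
    rewrite A. ring. }
  assert (L : forall c, cder (fun x => zline x - c)%C 0 e).
  { intros c. unfold zline. eapply cder_eq.
    - apply cder_minus; [|apply cder_const]. apply cder_plus; [apply cder_const|].
      apply (cder_mult (fun x => RtoC x) (fun _ => e)); [apply cder_id|apply cder_const].
    - cbv beta. ring. }
  assert (Dz : cder (fun x => zeta (zline x)) 0 (e * d)%C) by (apply C_derive_line, Hd).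
  assert (DK : exists k, cder (fun x => zval (zline x)) 0 k).
  { assert (A : analytic_at zval (RtoC (-1))) by (apply analytic_zval; simpl; lra).
    apply (analytic_line _ _ e) in A. destruct A as [A B].
    apply ran_derive in A. apply ran_derive in B. destruct A as [a A], B as [b B].
    exists (a, b). split; assumption. }
  destruct DK as [k DK].
  assert (D1 : cder (fun x => zeta_defect zeta (zline x)) 0 0).
  { apply cder_ext_loc with (fun _ => RtoC 0); [|apply cder_const].
    exists (mkposreal (/ 2) ltac:(lra)). intros y Hy.
    assert (Hy' : Rabs (y - 0) < / 2) by exact Hy. rewrite Rminus_0_r in Hy'.
    apply Rabs_def2 in Hy'. symmetry. apply Hzero. lra. }
  assert (D2 : cder (fun x => zeta_defect zeta (zline x)) 0
     (e * (- / 12) + (RtoC (-1) - 1) * (e * d) 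
       + ((-1) * (e * (/ 12 * (RtoC (-1) - (-6))) + (RtoC (-1) - 1) * (/ 12 * e))
       + / 6 * ((RtoC (-1) - 0) * (e * ((RtoC (-1) - (-2)) * ((RtoC (-1) - 1) * zval (RtoC (-1))))))))%C).
  { unfold zeta_defect. eapply cder_eq.
    - apply cder_plus; [apply cder_mult; [apply L|exact Dz]|].
      apply cder_plus.
      + apply cder_scal, cder_plus; [apply cder_const|].
        apply cder_mult; [apply L|]. apply cder_scal. apply cder_mult; [apply L|apply cder_const].
      + apply cder_scal. apply cder_mult; [apply L|]. apply cder_mult; [apply L|].
        apply cder_mult; [apply L|]. apply cder_mult; [apply L|exact DK].
    - cbv beta. rewrite E0, Hv. ring. }
  assert (E := cder_unique _ _ _ _ D2 D1).
  assert (He : e <> RtoC 0).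
  { intros H. apply (f_equal Re) in H. unfold e, Re, Ci in H. simpl in H. lra. }
  apply Ceq_minus. match type of E with (?X = _)%C => transitivity (- / (2 * e) * X)%C; [|rewrite E; ring] end.
  field. exact He.
Qed.

Lemma glaisher_value A : is_glaisher A -> RtoC (ln A) = (/ 4 - kval 3 2 1 / 6)%C.
Proof.
  intros [_ [zeta [d [Hz [Hd E]]]]]. rewrite E, (zeta_derive_m1 zeta d Hz Hd).
  rewrite RtoC_div by lra. field.
Qed.

(** * The remainder as a kernel integral *)

Lemma RtoC_INR_nz n : (1 <= n)%nat -> RtoC (INR n) <> RtoC 0.
Proof. intros H. apply RtoC_nz, not_0_INR. lia. Qed.

Lemma remainder_step A logG logGamma N z :
  (barnes_remainder A logG logGamma (S (S N)) z = barnes_remainder A logG logGamma (S N) z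
    - RtoC (bernoulli (2 * S N + 2))
      / (RtoC (INR (2 * S N) * INR (2 * S N + 1) * INR (2 * S N + 2)) * z ^ (2 * S N)))%C.
Proof.
  unfold barnes_remainder. replace (S (S N) - 1)%nat with (S N) by lia.
  replace (S N - 1)%nat with N by lia. rewrite sum_n_Sm by lia.
  match goal with |- context [@plus C_AbelianMonoid ?a ?b] =>
    change (@plus C_AbelianMonoid a b) with (a + b)%C end.
  ring.
Qed.

(** For N = 1 this is the formula for log G. Each further term of the asymptotic series
    is two integrations by parts of the kernel integral, the second one without boundary
    term because the Bernoulli numbers of odd index at least 3 vanish. *)
Lemma remainder_kint A logG logGamma N z : is_glaisher A ->
  is_log_branch (fun z => BarnesG (z + 1)%C) logG ->
  is_log_branch (fun z => Gamma (z + 1)%C) logGamma -> slit_plane z ->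
  barnes_remainder A logG logGamma (S N) z
  = (- / (RtoC (INR (2 * S N)) * RtoC (INR (2 * S N + 1))) * kval (2 * S N + 1) (2 * S N) z)%C.
Proof.
  intros hA hG hGa Hz. assert (Hzn := slit_plane_nz z Hz).
  induction N as [|N IH].
  - unfold barnes_remainder. rewrite sum_n_m_zero by lia.
    rewrite (logG_value _ _ hG Hz), (logGamma_value _ _ hGa Hz), (glaisher_value _ hA).
    change (2 * 1 + 1)%nat with 3%nat. change (2 * 1)%nat with 2%nat.
    change (@zero C_AbelianMonoid) with (RtoC 0). unfold lbarnes_val.
    rewrite !RtoC_div by lra. simpl (INR 2). simpl (INR 3).
    replace (1 + 1 + 1) with 3 by ring. replace (1 + 1) with 2 by ring. field.
  - set (B := RtoC (bernoulli (2 * S N + 2))).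
    rewrite remainder_step, IH. fold B.
    assert (K1 := kint_parts (2 * S N + 1) (2 * S N) z _ _ Hz ltac:(lia) ltac:(lia)
      (kval_correct (2 * S N + 1) (2 * S N) z Hz ltac:(lia))
      (kval_correct (S (2 * S N + 1)) (S (2 * S N)) z Hz ltac:(lia))).
    assert (K2 := kint_parts (S (2 * S N + 1)) (S (2 * S N)) z _ _ Hz ltac:(lia) ltac:(lia)
      (kval_correct (S (2 * S N + 1)) (S (2 * S N)) z Hz ltac:(lia))
      (kval_correct (S (S (2 * S N + 1))) (S (S (2 * S N))) z Hz ltac:(lia))).
    replace (bernoulli (S (S (2 * S N + 1)))) with 0 in K2.
    2:{ symmetry. replace (S (S (2 * S N + 1))) with (2 * S N + 3)%nat by lia. apply bernoulli_odd. }
    rewrite K2 in K1. rewrite K1.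
    replace (2 * S (S N) + 1)%nat with (S (S (2 * S N + 1))) by lia.
    replace (2 * S (S N))%nat with (S (S (2 * S N))) by lia.
    replace (S (2 * S N + 1)) with (2 * S N + 2)%nat by lia. fold B.
    replace (S (2 * S N)) with (2 * S N + 1)%nat by lia.
    replace (S (2 * S N + 1)) with (2 * S N + 2)%nat by lia.
    replace (S (2 * S N + 2)) with (2 * S N + 3)%nat by lia.
    assert (Hp := Cpow_nz z (2 * S N) Hzn).
    assert (N0 := RtoC_INR_nz (2 * S N) ltac:(lia)).
    assert (N1 := RtoC_INR_nz (2 * S N + 1) ltac:(lia)).
    assert (N2 := RtoC_INR_nz (2 * S N + 2) ltac:(lia)).
    assert (N3 := RtoC_INR_nz (2 * S N + 3) ltac:(lia)).
    assert (N4 := Cpow_nz z (2 * S N + 1) Hzn).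
    rewrite !RtoC_mult.
    set (a := RtoC (INR (2 * S N))) in *. set (b := RtoC (INR (2 * S N + 1))) in *.
    set (c := RtoC (INR (2 * S N + 2))) in *. set (d := RtoC (INR (2 * S N + 3))) in *.
    set (p := (z ^ (2 * S N))%C) in *. set (q := (z ^ (2 * S N + 1))%C) in *.
    set (k := kval _ _ z). clearbody a b c d p q k B. field.
    repeat split; assumption.
Qed.

Lemma kint_0 q z : slit_plane z -> (1 <= q)%nat ->
  cint_inf (fun t => / (RtoC t + z) ^ S q)%C (/ (RtoC (INR q) * z ^ q))%C.
Proof.
  intros Hz Hq. assert (Hzn := slit_plane_nz z Hz). assert (Hn := RtoC_INR_nz q Hq).
  assert (Hc : forall t, 0 <= t -> ccont (fun t => / (RtoC t + z) ^ S q)%C t).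
  { intros t Ht. eapply cder_ccont, cder_shift_pow; assumption. }
  destruct (shift_pow_bound z (S q) Hz ltac:(lia)) as [B [HB HB1]].
  destruct (cint_inf_dom2 (fun t => / (RtoC t + z) ^ S q)%C B) as [I [HI _]].
  - intros T HT. apply cintegrable_cont. rewrite Rmin_left by exact HT. intros x Hx. apply Hc; lra.
  - intros t Ht. apply HB1; lra.
  - eapply cint_inf_eq; [exact HI|].
    assert (HIm : forall m, cint (fun t => / (RtoC t + z) ^ S q)%C 0 (INR m)
      (- / RtoC (INR q) * (/ (RtoC (INR m) + z) ^ q) - - / RtoC (INR q) * (/ (RtoC 0 + z) ^ q))%C).
    { intros m. apply (cint_derive (fun t => - / RtoC (INR q) * / (RtoC t + z) ^ q)%C);
        rewrite Rmin_left by apply pos_INR; intros x Hx; [|apply Hc; lra].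
      eapply cder_eq; [apply cder_scal, cder_shift_pow; [exact Hz|lra]|].
      field. split; [|exact Hn]. apply Cpow_nz, slit_shift_nz; [exact Hz|lra]. }
    apply (cseq_unique _ _ _ (cint_inf_seq _ _ _ HI HIm)).
    eapply cseq_eq.
    + apply cseq_minus; [apply cseq_scal|apply cseq_const].
      (* also for q = 1: a single inverse power tends to 0 *)
      instantiate (1 := RtoC 0). destruct q as [|[|q]]; [lia| |apply shift_pow_lim; [exact Hz|lia]].
      apply cseq_incr_1. apply cseq_ext with (fun m => / (RtoC (INR (S m)) + z))%C.
      * intros m. now rewrite Cpow_1_r.
      * now apply cseq_inv_shift.
    + replace (RtoC 0 + z)%C with z by ring. field. split; [now apply Cpow_nz|exact Hn].
Qed.

(** * Exponential integrals and termwise integration *)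

Lemma is_lim_of_inv_bound (u : R -> R) c : (forall T, 0 <= T -> 0 <= u T <= c / (1 + T)) ->
  is_lim u p_infty 0.
Proof.
  intros H. apply is_lim_le_le_loc with (fun _ => 0) (fun T => c / (1 + T)).
  - exists 0. intros T HT. apply H. lra.
  - apply is_lim_const.
  - apply is_lim_ext with (fun T => - (- c) / (1 + T)).
    + intros T. f_equal. ring.
    + apply is_lim_inv_shift.
Qed.

Lemma cint_inf_derive F f L c :
  (forall t, 0 <= t -> cder F t (f t)) -> (forall t, 0 <= t -> ccont f t) ->
  (forall T, 0 <= T -> Cmod (F T - L) <= c / (1 + T)) -> cint_inf f (L - F 0)%C.
Proof.
  intros HF Hf HL. apply cint_inf_lim with (fun T => F T - F 0)%C.
  - intros T HT. apply cint_derive; rewrite Rmin_left by exact HT; intros x Hx; [apply HF|apply Hf]; lra.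
  - apply is_lim_of_inv_bound with c. intros T HT.
    replace (F T - F 0 - (L - F 0))%C with (F T - L)%C by ring.
    split; [apply Cmod_ge_0|now apply HL].
Qed.

Lemma pow_exp_bound a n : 0 < a -> exists B, 0 <= B /\
  forall t, 0 <= t -> t ^ n * exp (- (a * t)) <= B / (1 + t) ^ 2.
Proof.
  intros Ha. exists (INR (fact (n + 2)) / a ^ (n + 2) * exp a).
  assert (Hf := INR_fact_lt_0 (n + 2)). assert (Hp := pow_lt a (n + 2) Ha).
  split. { apply Rmult_le_pos; [apply Rdiv_le_0_compat; lra|left; apply exp_pos]. }
  intros t Ht. assert (H := pow_fact_le_exp (a * (1 + t)) (n + 2) ltac:(nra)).
  rewrite Rpow_mult_distr in H. replace (a * (1 + t)) with (a + a * t) in H by ring.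
  rewrite exp_plus in H.
  assert (H1 : (1 + t) ^ (n + 2) <= INR (fact (n + 2)) / a ^ (n + 2) * exp a * exp (a * t)).
  { apply Rmult_le_compat_l with (r := INR (fact (n + 2)) / a ^ (n + 2)) in H.
    2:{ apply Rdiv_le_0_compat; lra. }
    replace (INR (fact (n + 2)) / a ^ (n + 2) * (a ^ (n + 2) * (1 + t) ^ (n + 2) / INR (fact (n + 2))))
      with ((1 + t) ^ (n + 2)) in H by (field; lra).
    lra. }
  rewrite pow_add in H1. rewrite exp_Ropp. assert (He := exp_pos (a * t)).
  assert (H2 : t ^ n <= (1 + t) ^ n) by (apply pow_incr; lra).
  assert (Hq : 0 < (1 + t) ^ 2) by (apply pow_lt; lra).
  apply (proj1 (Rle_div_r _ _ _ Hq)). apply Rmult_le_reg_r with (exp (a * t)); [exact He|].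
  replace (t ^ n * / exp (a * t) * (1 + t) ^ 2 * exp (a * t)) with (t ^ n * (1 + t) ^ 2)
    by (field; lra).
  eapply Rle_trans; [apply Rmult_le_compat_r; [lra|exact H2]|exact H1].
Qed.

Lemma inv_sq_le_inv B T : 0 <= B -> 0 <= T -> B / (1 + T) ^ 2 <= B / (1 + T).
Proof.
  intros HB HT. unfold Rdiv. apply Rmult_le_compat_l; [exact HB|].
  apply Rinv_le_contravar; nra.
Qed.

Lemma is_derive_exp_lin a t : is_derive (fun u => exp (- (a * u))) t (- a * exp (- (a * t))).
Proof. auto_derive; [exact I|ring]. Qed.

Lemma cder_exp_lin a t : cder (fun u => RtoC (exp (- (a * u)))) t (- RtoC a * RtoC (exp (- (a * t))))%C.
Proof.
  eapply cder_eq; [apply cder_R, is_derive_exp_lin|]. rewrite RtoC_mult, RtoC_opp. reflexivity.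
Qed.

Lemma moment_exp a n : 0 < a ->
  cint_inf (fun t => RtoC (t ^ n * exp (- (a * t)))) (RtoC (INR (fact n) / a ^ S n)).
Proof.
  intros Ha. induction n as [|n IH].
  - destruct (pow_exp_bound a 0 Ha) as [B [HB HB1]].
    eapply cint_inf_eq.
    + apply (cint_inf_derive (fun t => RtoC (- / a * exp (- (a * t)))) _ 0 (B / a)).
      * intros t Ht. apply cder_R. auto_derive; [exact I|]. field. lra.
      * intros t Ht. apply ccont_R, ex_derive_Rcontinuous.
        auto_derive. exact I.
      * intros T HT. rewrite <- RtoC_minus, Cmod_R. specialize (HB1 T HT).
        rewrite pow_O, Rmult_1_l in HB1. assert (He := exp_pos (- (a * T))).
        assert (Hi : 0 < / a) by now apply Rinv_0_lt_compat.
        rewrite Rminus_0_r, Rabs_mult, Rabs_Ropp, !Rabs_pos_eq by lra.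
        replace (B / a / (1 + T)) with (/ a * (B / (1 + T))) by (field; lra).
        apply Rmult_le_compat_l; [lra|]. eapply Rle_trans; [exact HB1|now apply inv_sq_le_inv].
    + rewrite <- RtoC_minus. f_equal. rewrite Rmult_0_r, Ropp_0, exp_0. simpl. field. lra.
  - destruct (pow_exp_bound a (S n) Ha) as [B [HB HB1]].
    assert (H0 : cint_inf (fun t => RtoC (t ^ S n * exp (- (a * t)) 
        - INR (S n) / a * (t ^ n * exp (- (a * t))))) 0).
    { eapply cint_inf_eq.
      - apply (cint_inf_derive (fun t => RtoC (- / a * (t ^ S n * exp (- (a * t))))) _ 0 (B / a)).
        + intros t Ht. apply cder_R. eapply is_derive_eq.
          * apply (is_derive_scal (fun t => t ^ S n * exp (- (a * t)))).
            apply is_derive_Rmult; [|apply is_derive_exp_lin].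
            apply is_derive_Reals, derivable_pt_lim_pow.
          * cbv beta. simpl pred. to_R. field. lra.
        + intros t Ht. apply ccont_R, ex_derive_Rcontinuous.
          auto_derive. exact I.
        + intros T HT. rewrite <- RtoC_minus, Cmod_R. specialize (HB1 T HT).
          assert (He : 0 <= T ^ S n * exp (- (a * T))).
          { apply Rmult_le_pos; [now apply pow_le|left; apply exp_pos]. }
          assert (Hi : 0 < / a) by now apply Rinv_0_lt_compat.
          rewrite Rminus_0_r, Rabs_mult, Rabs_Ropp, (Rabs_pos_eq (/ a)), (Rabs_pos_eq (_ * _)) by lra.
          replace (B / a / (1 + T)) with (/ a * (B / (1 + T))) by (field; lra).
          apply Rmult_le_compat_l; [lra|]. eapply Rle_trans; [exact HB1|now apply inv_sq_le_inv].
      - rewrite pow_i by lia. rewrite Rmult_0_l, Rmult_0_r. ring. }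
    apply cint_inf_ext with (fun t => RtoC (t ^ S n * exp (- (a * t)) 
        - INR (S n) / a * (t ^ n * exp (- (a * t))))
        + RtoC (INR (S n) / a) * RtoC (t ^ n * exp (- (a * t))))%C.
    { intros t _. rewrite <- RtoC_mult, <- RtoC_plus. f_equal. ring. }
    eapply cint_inf_eq; [apply cint_inf_plus; [exact H0|apply cint_inf_scal, IH]|].
    rewrite <- RtoC_mult, Cplus_0_l. f_equal. rewrite fact_simpl, mult_INR. simpl pow. field.
    split; [|lra]. apply pow_nonzero. lra.
Qed.

Lemma cint_inf_csum (f : nat -> R -> C) P n : (forall k, cint_inf (f k) (P k)) ->
  cint_inf (fun t => csum_n (fun k => f k t) n) (csum_n P n).
Proof.
  intros H. induction n as [|n IH]; cbn [csum_n].
  - apply cint_inf_ext with (fun t => 0 * f O t)%C; [intros; ring|].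
    eapply cint_inf_eq; [apply cint_inf_scal, H|]. ring.
  - apply cint_inf_plus; [exact IH|apply H].
Qed.

(** The remainder after M+1 terms is dominated by c/(M+1) times (1+t)^(-2), of integral 1. *)
Lemma series_interchange (f : nat -> R -> C) g P I c : cint_inf g I ->
  (forall k, cint_inf (f k) (P k)) ->
  (forall M t, 0 < t -> Cmod (g t - csum_n (fun k => f k t) (S M)) <= c * / INR (S M) / (1 + t) ^ 2) ->
  cseq (fun M => csum_n P (S M)) I.
Proof.
  intros Hg Hf Hb. apply cseq_squeeze with (fun M => c * / INR (S M)).
  - intros M. rewrite Cmod_minus_sym.
    apply (cint_inf_dom2_le (fun t => g t - csum_n (fun k => f k t) (S M))%C).
    + apply cint_inf_minus; [exact Hg|now apply cint_inf_csum].
    + intros t Ht. now apply Hb.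
  - replace (Finite 0) with (Finite (c * 0)) by (f_equal; ring).
    apply is_lim_seq_mult'; [apply is_lim_seq_const|apply is_lim_seq_inv_INR_S].
Qed.

(** * Moving the Fourier integrals to the imaginary axis *)

Lemma Re_pos_inv z d : 0 < d -> d <= Re z -> z <> RtoC 0 /\ Cmod (/ z) <= / d.
Proof.
  intros Hd Hz. assert (Hn : z <> RtoC 0) by (apply slit_plane_nz, Re_pos_slit; lra).
  split; [exact Hn|]. rewrite Cmod_inv by exact Hn. apply Rinv_le_contravar; [exact Hd|].
  eapply Rle_trans; [exact Hz|]. eapply Rle_trans; [apply Rle_abs|apply re_le_Cmod].
Qed.

(** For s = 1 or -1 and up to a constant factor, exp(i s a t)/t^q on the vertical ray
    t = z + i s y, where the oscillating exponential becomes exp(-ay). *)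
Definition rker (a s : R) (q : nat) (z : C) (y : R) : C :=
  (RtoC (exp (- (a * y))) * / (z + RtoC y * (RtoC s * Ci)) ^ q)%C.

Lemma Re_ray z s y : Re (z + RtoC y * (RtoC s * Ci)) = Re z.
Proof. destruct z; unfold Re, Ci; simpl; ring. Qed.

Lemma cder_ray z s t : cder (fun y => z + RtoC y * (RtoC s * Ci))%C t (RtoC s * Ci)%C.
Proof.
  eapply cder_eq.
  - apply cder_plus; [apply cder_const|].
    apply (cder_mult (fun y => RtoC y) (fun _ => RtoC s * Ci)%C); [apply cder_id|apply cder_const].
  - cbv beta. ring.
Qed.

Lemma rker_ccont a s q z t : 0 < Re z -> ccont (rker a s q z) t.
Proof.
  intros Hz. apply ccont_mult; [eapply cder_ccont, cder_exp_lin|].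
  eapply cder_ccont, cder_inv_pow; [apply cder_ray|].
  apply (Re_pos_inv _ (Re z)); [exact Hz|]. rewrite Re_ray. lra.
Qed.

Lemma rker_bound a s q z t : 0 < Re z ->
  Cmod (rker a s q z t) <= (/ Re z) ^ q * exp (- (a * t)).
Proof.
  intros Hz. unfold rker. destruct (Re_pos_inv (z + RtoC t * (RtoC s * Ci)) (Re z) Hz) as [Hn Hb].
  { rewrite Re_ray; lra. }
  rewrite Cmod_mult, Cmod_R, Rabs_pos_eq by (left; apply exp_pos).
  rewrite <- Cpow_inv by exact Hn. rewrite Cmod_pow, Rmult_comm.
  apply Rmult_le_compat_r; [left; apply exp_pos|]. apply pow_incr. split; [apply Cmod_ge_0|exact Hb].
Qed.

Definition rval (a s : R) (q : nat) (z : C) : C :=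
  improper (rker a s q z).

Lemma rval_correct a s q z : 0 < a -> 0 < Re z -> cint_inf (rker a s q z) (rval a s q z).
Proof.
  intros Ha Hz. destruct (pow_exp_bound a 0 Ha) as [B [HB HB1]].
  assert (Hi : forall T, cintegrable (rker a s q z) 0 T).
  { intros T. apply cintegrable_cont. intros x _. now apply rker_ccont. }
  destruct (cint_inf_dom2 (rker a s q z) ((/ Re z) ^ q * B)) as [I [HI _]].
  - intros T _. apply Hi.
  - intros t Ht. eapply Rle_trans; [now apply rker_bound|].
    specialize (HB1 t ltac:(lra)). rewrite pow_O, Rmult_1_l in HB1.
    unfold Rdiv. rewrite Rmult_assoc. apply Rmult_le_compat_l; [|exact HB1].
    apply pow_le. left; now apply Rinv_0_lt_compat.
  - exact (improper_correct _ _ HI).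
Qed.

Lemma rval_bound a s q z B : 0 < a -> 0 < Re z ->
  (forall t, 0 <= t -> t ^ 0 * exp (- (a * t)) <= B / (1 + t) ^ 2) ->
  Cmod (rval a s q z) <= (/ Re z) ^ q * B.
Proof.
  intros Ha Hz HB. apply (cint_inf_dom2_le _ _ _ (rval_correct a s q z Ha Hz)).
  intros t Ht. eapply Rle_trans; [now apply rker_bound|].
  specialize (HB t ltac:(lra)). rewrite pow_O, Rmult_1_l in HB.
  unfold Rdiv. rewrite Rmult_assoc. apply Rmult_le_compat_l; [|exact HB].
  apply pow_le. left; now apply Rinv_0_lt_compat.
Qed.

(** Integrating by parts brings the exponent 3, produced by differentiation in z, back
    to 2: this is the differential equation behind the next step. *)
Lemma rval_parts a s z : 0 < a -> 0 < Re z ->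
  (2 * (RtoC s * Ci) * rval a s 3 z = / z ^ 2 - RtoC a * rval a s 2 z)%C.
Proof.
  intros Ha Hz. destruct (pow_exp_bound a 0 Ha) as [B [HB HB1]].
  assert (H : cint_inf (fun y => - RtoC a * rker a s 2 z y + - (2 * (RtoC s * Ci)) * rker a s 3 z y)%C
     (0 - rker a s 2 z 0)%C).
  { apply (cint_inf_derive (rker a s 2 z) _ 0 ((/ Re z) ^ 2 * B)).
    - intros t Ht. destruct (Re_pos_inv (z + RtoC t * (RtoC s * Ci)) (Re z) Hz) as [Hn _].
      { rewrite Re_ray; lra. }
      eapply cder_eq.
      + apply cder_mult; [apply cder_exp_lin|apply cder_inv_pow; [apply cder_ray|exact Hn]].
      + unfold rker. simpl (INR 2). replace (1 + 1) with 2 by ring. field. exact Hn.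
    - intros t Ht. apply ccont_plus; (apply ccont_mult; [apply ccont_const|now apply rker_ccont]).
    - intros T HT. replace (rker a s 2 z T - 0)%C with (rker a s 2 z T) by ring.
      eapply Rle_trans; [now apply rker_bound|].
      specialize (HB1 T HT). rewrite pow_O, Rmult_1_l in HB1.
      unfold Rdiv. rewrite Rmult_assoc. apply Rmult_le_compat_l.
      + apply pow_le. left; now apply Rinv_0_lt_compat.
      + eapply Rle_trans; [exact HB1|]. now apply inv_sq_le_inv. }
  assert (H2 : cint_inf (fun y => - RtoC a * rker a s 2 z y + - (2 * (RtoC s * Ci)) * rker a s 3 z y)%C
     (- RtoC a * rval a s 2 z + - (2 * (RtoC s * Ci)) * rval a s 3 z)%C).
  { apply cint_inf_plus; apply cint_inf_scal, rval_correct; assumption. }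
  assert (E := cint_inf_unique _ _ _ H H2).
  assert (E0 : rker a s 2 z 0 = (/ z ^ 2)%C).
  { unfold rker. rewrite Rmult_0_r, Ropp_0, exp_0.
    replace (z + RtoC 0 * (RtoC s * Ci))%C with z by ring. ring. }
  rewrite E0 in E. apply Ceq_minus.
  match type of E with (?x = ?y)%C => transitivity (x - y)%C; [ring|rewrite E; ring] end.
Qed.

Lemma cder_of_quadratic f t l d c : 0 < d ->
  (forall h, Rabs h < d -> Cmod (f (t + h) - f t - RtoC h * l) <= c * h ^ 2) -> cder f t l.
Proof.
  intros Hd H.
  assert (Hc : 0 <= Rabs c) by apply Rabs_pos. assert (Hc2 := Rle_abs c).
  apply cder_of_quotient. intros eps Heps. exists (Rmin d (eps / (Rabs c + 1))). split.
    { apply Rmin_glb_lt; [exact Hd|]. apply Rdiv_lt_0_compat; lra. }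
    intros h Hh0 Hh. assert (Hn := RtoC_nz _ Hh0). assert (B := Rabs_pos_lt _ Hh0).
    assert (H1 : Rabs h < d) by (eapply Rlt_le_trans; [exact Hh|apply Rmin_l]).
    assert (H2 : Rabs h < eps / (Rabs c + 1)) by (eapply Rlt_le_trans; [exact Hh|apply Rmin_r]).
    apply Rlt_div_r in H2; [|lra]. specialize (H h H1).
    replace ((f (t + h)%R - f t) / RtoC h - l)%C with ((f (t + h)%R - f t - RtoC h * l) / RtoC h)%C
      by (field; exact Hn).
    rewrite Cmod_div, Cmod_R by exact Hn. apply Rlt_div_l; [exact B|].
    eapply Rle_lt_trans; [exact H|]. rewrite <- (pow2_abs h). nra.
Qed.

(** Differentiation in z under the integral sign, with an explicit quadratic
    remainder:  1/(w+h)^2 - 1/w^2 + 2h/w^3 = h^2 (1/(w(w+h))^2 + 2/(w^3 (w+h))). *)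
Lemma cder_rval a s z x : 0 < a -> 0 < Re z -> 0 <= x ->
  cder (fun u => rval a s 2 (RtoC u + z)) x (- 2 * rval a s 3 (RtoC x + z))%C.
Proof.
  intros Ha Hz Hx. destruct (pow_exp_bound a 0 Ha) as [B [HB HB1]].
  set (d := Re z) in *.
  assert (HR : forall u, Re (RtoC u + z) = u + d) by (intros u; unfold d; destruct z; unfold Re; simpl; ring).
  apply cder_of_quadratic with (d / 2) (8 / d ^ 4 * B); [lra|]. intros h Hh.
  apply Rabs_def2 in Hh.
  apply Rle_trans with (h ^ 2 * (8 / d ^ 4) * B); [|right; ring].
  apply (cint_inf_dom2_le (fun y => rker a s 2 (RtoC (x + h) + z) y - rker a s 2 (RtoC x + z) y
     - RtoC h * (- 2 * rker a s 3 (RtoC x + z) y))%C).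
  { apply cint_inf_minus; [apply cint_inf_minus|apply cint_inf_scal, cint_inf_scal];
      apply rval_correct; try exact Ha; rewrite HR; lra. }
  intros y Hy. unfold rker. set (w := (RtoC x + z + RtoC y * (RtoC s * Ci))%C).
  replace (RtoC (x + h) + z + RtoC y * (RtoC s * Ci))%C with (w + RtoC h)%C
    by (unfold w; rewrite RtoC_plus; ring).
  assert (Hw : Re w = x + d) by (unfold w; rewrite Re_ray; apply HR).
  destruct (Re_pos_inv w d Hz) as [N1 B1]; [lra|].
  destruct (Re_pos_inv (w + RtoC h) (d / 2)) as [N2 B2]; [lra|rewrite re_plus, Hw; simpl; lra|].
  set (E := RtoC (exp (- (a * y)))).
  replace (E * / (w + RtoC h) ^ 2 - E * / w ^ 2 - RtoC h * (- 2 * (E * / w ^ 3)))%C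
    with (RtoC (h ^ 2) * ((/ w * / w * (/ (w + RtoC h) * / (w + RtoC h))
            + 2 * (/ w * / w * (/ w * / (w + RtoC h)))) * E))%C
    by (rewrite RtoC_pow; field; split; assumption).
  unfold E. rewrite !Cmod_mult, !Cmod_R, (Rabs_pos_eq (h ^ 2)), (Rabs_pos_eq (exp _))
    by (try (left; apply exp_pos); apply pow2_ge_0).
  assert (P1 := Cmod_ge_0 (/ w)). assert (P2 := Cmod_ge_0 (/ (w + RtoC h))).
  set (u := Cmod (/ w)) in *. set (v := Cmod (/ (w + RtoC h))) in *.
  assert (Hi : 0 < / d) by now apply Rinv_0_lt_compat.
  replace (/ (d / 2)) with (2 * / d) in B2 by (field; lra).
  specialize (HB1 y ltac:(lra)). rewrite pow_O, Rmult_1_l in HB1.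
  assert (HE := exp_pos (- (a * y))).
  assert (HT : Cmod (/ w * / w * (/ (w + RtoC h) * / (w + RtoC h)) + 2 * (/ w * / w * (/ w * / (w + RtoC h))))
     <= 8 / d ^ 4).
  { eapply Rle_trans; [apply Cmod_triangle|]. rewrite !Cmod_mult, Cmod_R. fold u v.
    rewrite (Rabs_pos_eq 2) by lra. set (i := / d) in *.
    replace (8 / d ^ 4) with (i * i * (2 * i * (2 * i)) + 2 * (i * i * (i * (2 * i)))) by (unfold i; field; lra).
    assert (Q : u * u <= i * i) by nra. assert (Q2 : v * v <= 2 * i * (2 * i)) by nra.
    assert (Q3 : u * v <= i * (2 * i)) by nra.
    assert (0 <= u * u) by nra. assert (0 <= v * v) by nra. assert (0 <= u * v) by nra.
    apply Rplus_le_compat.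
    - apply Rmult_le_compat; assumption.
    - apply Rmult_le_compat_l; [lra|]. apply Rmult_le_compat; assumption. }
  unfold Rdiv. rewrite !Rmult_assoc. apply Rmult_le_compat_l; [apply pow2_ge_0|].
  rewrite <- !Rmult_assoc. replace (8 * / d ^ 4 * B * / (1 + y) ^ 2) with (8 / d ^ 4 * (B / (1 + y) ^ 2))
    by (unfold Rdiv; ring).
  apply Rmult_le_compat; [apply Cmod_ge_0|lra|exact HT|exact HB1].
Qed.

(** Instead of rotating the path, vary the base point: exp(i s a x) i s times the
    integral over the ray from z+x is an antiderivative of -exp(i s a x)/(x+z)^2 that
    tends to 0, so the improper integral is its value at x = 0. *)
Lemma rotated_integral a s z : 0 < a -> 0 < Re z -> s * s = 1 ->
  cint_inf (fun t => Cexp (RtoC (a * t) * (RtoC s * Ci)) / (RtoC t + z) ^ 2)%C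
    (RtoC s * Ci * rval a s 2 z)%C.
Proof.
  intros Ha Hz Hs. destruct (pow_exp_bound a 0 Ha) as [B [HB HB1]].
  set (i := (RtoC s * Ci)%C).
  assert (Hii : (i * i)%C = RtoC (-1)).
  { unfold i. replace (RtoC s * Ci * (RtoC s * Ci))%C with (RtoC (s * s) * (Ci * Ci))%C
      by (rewrite RtoC_mult; ring).
    rewrite Hs. apply C_ext; unfold Re, Im, Ci; simpl; ring. }
  assert (Hsz := Re_pos_slit z Hz).
  assert (HR : forall u, Re (RtoC u + z) = u + Re z) by (intros u; destruct z; unfold Re; simpl; ring).
  set (F x := (- i * (Cexp (RtoC (a * x) * i) * rval a s 2 (RtoC x + z)))%C).
  assert (He : forall t, cder (fun x => Cexp (RtoC (a * x) * i)) t (RtoC a * i * Cexp (RtoC (a * t) * i))%C).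
  { intros t. eapply cder_eq.
    - apply cder_Cexp. apply (cder_mult (fun x => RtoC (a * x)) (fun _ => i)); [|apply cder_const].
      apply cder_R. apply is_derive_scal, (is_derive_id (K := R_AbsRing)).
    - cbv beta. unfold one, mult; simpl. rewrite Rmult_1_r. ring. }
  assert (H : cint_inf (fun t => Cexp (RtoC (a * t) * i) / (RtoC t + z) ^ 2)%C (0 - F 0)%C).
  { apply (cint_inf_derive F _ 0 (/ Re z * B * (1 + / Re z))).
    - intros t Ht. assert (Hn := slit_shift_nz z t Hsz Ht).
      eapply cder_eq; [apply cder_scal, cder_mult; [apply He|now apply cder_rval]|].
      assert (P := rval_parts a s (RtoC t + z) Ha ltac:(rewrite HR; lra)). fold i in P.
      set (r2 := rval a s 2 (RtoC t + z)) in *. set (r3 := rval a s 3 (RtoC t + z)) in *.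
      set (e := Cexp (RtoC (a * t) * i)).
      transitivity (e * (- (i * i) * RtoC a * r2 + 2 * i * r3))%C; [ring|].
      rewrite P, Hii. field. exact Hn.
    - intros t Ht. apply ccont_mult; [eapply cder_ccont, He|].
      eapply cder_ccont, cder_shift_pow; assumption.
    - intros T HT. replace (F T - 0)%C with (F T) by ring. unfold F.
      rewrite !Cmod_mult, Cmod_opp, Cmod_Cexp.
      assert (Hi1 : Cmod i = 1).
      { assert (A : Cmod i * Cmod i = 1).
        { rewrite <- Cmod_mult, Hii, Cmod_R, Rabs_left by lra. lra. }
        assert (A2 := Cmod_ge_0 i). nra. }
      rewrite Hi1, Re_RtoC_mult. replace (Re i) with 0 by (unfold i, Re, Ci; simpl; ring).
      rewrite Rmult_0_r, exp_0, !Rmult_1_l.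
      eapply Rle_trans; [apply (rval_bound a s 2 (RtoC T + z) B Ha); [rewrite HR; lra|exact HB1]|].
      rewrite HR. set (d := Re z) in *.
      assert (Hd : 0 < / d) by now apply Rinv_0_lt_compat.
      assert (Hd2 : / (T + d) <= / d) by (apply Rinv_le_contravar; lra).
      assert (Hd3 : / (T + d) <= (1 + / d) / (1 + T)).
      { apply Rle_div_r; [lra|]. rewrite Rmult_comm. apply Rle_div_l; [lra|].
        replace ((1 + / d) * (T + d)) with (T + d + T * / d + 1) by (field; lra).
        assert (0 <= T * / d) by (apply Rmult_le_pos; lra). lra. }
      assert (Hd4 : 0 < / (T + d)) by (apply Rinv_0_lt_compat; lra).
      replace (/ d * B * (1 + / d) / (1 + T)) with (/ d * ((1 + / d) / (1 + T)) * B) by (unfold Rdiv; ring).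
      apply Rmult_le_compat_r; [exact HB|].
      replace ((/ (T + d)) ^ 2) with (/ (T + d) * / (T + d)) by ring.
      apply Rmult_le_compat; lra. }
  eapply cint_inf_eq; [exact H|]. unfold F. rewrite Rmult_0_r.
  replace (RtoC 0 * i)%C with (RtoC 0) by ring. rewrite Cexp_0.
  replace (RtoC 0 + z)%C with z by ring. ring.
Qed.

(** * The Binet kernel t/(z^2+t^2) *)

Lemma Ci_sqr : (Ci * Ci)%C = RtoC (-1).
Proof. apply C_ext; unfold Re, Im, Ci; simpl; ring. Qed.

Lemma sum_sq_factor z t : (z ^ 2 + RtoC t ^ 2 = (z + RtoC t * (RtoC 1 * Ci)) * (z + RtoC t * (RtoC (-1) * Ci)))%C.
Proof.
  transitivity (z ^ 2 - RtoC t ^ 2 * (Ci * Ci))%C; [rewrite Ci_sqr; ring|ring].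
Qed.

Lemma sum_sq_nz z t : 0 < Re z -> (z ^ 2 + RtoC t ^ 2)%C <> RtoC 0.
Proof.
  intros Hz. rewrite sum_sq_factor. apply Cmult_neq_0; apply (Re_pos_inv _ (Re z)); try exact Hz;
    rewrite Re_ray; lra.
Qed.

Lemma Cinv_mult_nz (a b : C) : a <> RtoC 0 -> b <> RtoC 0 -> (/ (a * b) = / a * / b)%C.
Proof. intros Ha Hb. field. split; assumption. Qed.

Lemma half_inv_sq_sum (a b : C) : a <> RtoC 0 -> b <> RtoC 0 ->
  (/ 2 * (a ^ 2 + b ^ 2) / (a * b * (a * b)) = / 2 * (/ a ^ 2 + / b ^ 2))%C.
Proof. intros Ha Hb. field. split; assumption. Qed.

Lemma sum_sq_inv_bound z t : 0 < Re z -> Cmod (/ (z ^ 2 + RtoC t ^ 2)) <= / Re z * / Re z.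
Proof.
  intros Hz. rewrite sum_sq_factor.
  destruct (Re_pos_inv (z + RtoC t * (RtoC 1 * Ci)) (Re z) Hz) as [N1 B1]; [rewrite Re_ray; lra|].
  destruct (Re_pos_inv (z + RtoC t * (RtoC (-1) * Ci)) (Re z) Hz) as [N2 B2]; [rewrite Re_ray; lra|].
  rewrite Cinv_mult_nz by assumption.
  rewrite Cmod_mult. apply Rmult_le_compat; try apply Cmod_ge_0; assumption.
Qed.

Lemma cder_sum_sq z t : cder (fun u => z ^ 2 + RtoC u ^ 2)%C t (2 * RtoC t)%C.
Proof.
  eapply cder_eq.
  - apply cder_plus; [apply cder_const|]. apply (cder_pow (fun u => RtoC u)), cder_id.
  - simpl (INR 2). simpl pred. replace (1 + 1) with 2 by ring. rewrite Cpow_1_r. ring.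
Qed.

Definition binet (z : C) (t : R) : C := (RtoC t / (z ^ 2 + RtoC t ^ 2))%C.

Lemma cder_binet z t : 0 < Re z -> cder (binet z) t
  (/ 2 * (/ (z + RtoC t * (RtoC 1 * Ci)) ^ 2 + / (z + RtoC t * (RtoC (-1) * Ci)) ^ 2))%C.
Proof.
  intros Hz. assert (Hn := sum_sq_nz z t Hz).
  eapply cder_eq; [apply cder_div; [apply cder_id|apply cder_sum_sq|exact Hn]|].
  destruct (Re_pos_inv (z + RtoC t * (RtoC 1 * Ci)) (Re z) Hz) as [N1 _]; [rewrite Re_ray; lra|].
  destruct (Re_pos_inv (z + RtoC t * (RtoC (-1) * Ci)) (Re z) Hz) as [N2 _]; [rewrite Re_ray; lra|].
  cbv beta.
  replace (1 * (z ^ 2 + RtoC t ^ 2) - RtoC t * (2 * RtoC t))%C with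
    (/ 2 * ((z + RtoC t * (RtoC 1 * Ci)) ^ 2 + (z + RtoC t * (RtoC (-1) * Ci)) ^ 2))%C.
  - rewrite sum_sq_factor. now apply half_inv_sq_sum.
  - transitivity (z ^ 2 + RtoC t ^ 2 * (Ci * Ci))%C; [field|rewrite Ci_sqr; ring].
Qed.

Lemma binet_bound z t : 0 < Re z -> 0 <= t -> Cmod (binet z t) <= t * (/ Re z * / Re z).
Proof.
  intros Hz Ht. unfold binet, Cdiv. rewrite Cmod_mult, Cmod_R, Rabs_pos_eq by exact Ht.
  apply Rmult_le_compat_l; [exact Ht|now apply sum_sq_inv_bound].
Qed.

(** The rotated integrals for s = 1 and s = -1 average to the Laplace integral of the
    derivative of t/(z^2+t^2); integrating by parts once more gives the factor a. *)
Lemma sine_integral a z I : 0 < a -> 0 < Re z ->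
  cint_inf (fun t => binet z t * RtoC (exp (- (a * t))))%C I ->
  cint_inf (fun t => RtoC (sin (a * t)) / (RtoC t + z) ^ 2)%C (RtoC a * I)%C.
Proof.
  intros Ha Hz HI.
  assert (H1 := rotated_integral a 1 z Ha Hz ltac:(lra)).
  assert (H2 := rotated_integral a (-1) z Ha Hz ltac:(lra)).
  assert (E : (/ 2 * (rval a 1 2 z + rval a (-1) 2 z) = RtoC a * I)%C).
  { destruct (pow_exp_bound a 1 Ha) as [B [HB HB1]].
    assert (HD : cint_inf (fun t => - RtoC a * (binet z t * RtoC (exp (- (a * t))))
       + / 2 * (rker a 1 2 z t + rker a (-1) 2 z t))%C 
       (0 - binet z 0 * RtoC (exp (- (a * 0))))%C).
    { apply (cint_inf_derive (fun t => binet z t * RtoC (exp (- (a * t))))%C _ 0 (/ Re z * / Re z * B)).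
      - intros t Ht. eapply cder_eq; [apply cder_mult; [now apply cder_binet|apply cder_exp_lin]|].
        unfold rker. ring.
      - intros t Ht. apply ccont_plus; (apply ccont_mult; [apply ccont_const|]).
        + apply ccont_mult; [eapply cder_ccont, cder_binet, Hz|eapply cder_ccont, cder_exp_lin].
        + apply ccont_plus; now apply rker_ccont.
      - intros T HT. match goal with |- Cmod (?x - _) <= _ => replace (x - 0)%C with x by ring end.
        rewrite Cmod_mult, Cmod_R, Rabs_pos_eq by (left; apply exp_pos).
        specialize (HB1 T HT). rewrite pow_1 in HB1.
        assert (Hp : 0 <= / Re z * / Re z).
        { assert (0 < / Re z) by now apply Rinv_0_lt_compat. nra. }
        apply Rle_trans with (T * (/ Re z * / Re z) * exp (- (a * T))).
        + apply Rmult_le_compat_r; [left; apply exp_pos|now apply binet_bound].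
        + unfold Rdiv. replace (T * (/ Re z * / Re z) * exp (- (a * T))) 
            with (/ Re z * / Re z * (T * exp (- (a * T)))) by ring.
          rewrite (Rmult_assoc (/ Re z * / Re z) B). apply Rmult_le_compat_l; [exact Hp|].
          eapply Rle_trans; [exact HB1|now apply inv_sq_le_inv]. }
    assert (HD2 := cint_inf_plus _ _ _ _ (cint_inf_scal (- RtoC a) _ _ HI)
      (cint_inf_scal (/ 2) _ _ (cint_inf_plus _ _ _ _ (rval_correct a 1 2 z Ha Hz) (rval_correct a (-1) 2 z Ha Hz)))).
    assert (E := cint_inf_unique _ _ _ HD HD2).
    replace (binet z 0) with (RtoC 0) in E by (unfold binet, Cdiv; ring).
    apply Ceq_minus.
    match type of E with (?x = ?y)%C => transitivity (y - x)%C; [ring|rewrite E; ring] end. }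
  rewrite <- E.
  apply cint_inf_ext with (fun t => - (Ci / 2) * (Cexp (RtoC (a * t) * (RtoC 1 * Ci)) / (RtoC t + z) ^ 2)
     + (Ci / 2) * (Cexp (RtoC (a * t) * (RtoC (-1) * Ci)) / (RtoC t + z) ^ 2))%C.
  - intros t Ht. unfold Cdiv. 
    transitivity (- Ci * / 2 * (Cexp (RtoC (a * t) * (RtoC 1 * Ci)) - Cexp (RtoC (a * t) * (RtoC (-1) * Ci)))
       * / (RtoC t + z) ^ 2)%C; [ring|]. f_equal.
    assert (X1 : Cexp (RtoC (a * t) * (RtoC 1 * Ci)) = (cos (a * t), sin (a * t))).
    { unfold Cexp, Ci. simpl. replace (a * t * (1 * 0 - 0 * 1) - 0 * (1 * 1 + 0 * 0)) with 0 by ring.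
      replace (a * t * (1 * 1 + 0 * 0) + 0 * (1 * 0 - 0 * 1)) with (a * t) by ring.
      rewrite exp_0, !Rmult_1_l. reflexivity. }
    assert (X2 : Cexp (RtoC (a * t) * (RtoC (-1) * Ci)) = (cos (a * t), - sin (a * t))).
    { unfold Cexp, Ci. simpl. replace (a * t * (-1 * 0 - 0 * 1) - 0 * (-1 * 1 + 0 * 0)) with 0 by ring.
      replace (a * t * (-1 * 1 + 0 * 0) + 0 * (-1 * 0 - 0 * 1)) with (- (a * t)) by ring.
      rewrite exp_0, !Rmult_1_l, cos_neg, sin_neg. reflexivity. }
    rewrite X1, X2. apply C_ext; unfold Re, Im, Ci; simpl; field.
  - eapply cint_inf_eq; [apply cint_inf_plus; apply cint_inf_scal; [exact H1|exact H2]|].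
    transitivity (- (Ci * Ci) * (/ 2 * (rval a 1 2 z + rval a (-1) 2 z)))%C.
    + field.
    + rewrite Ci_sqr. ring.
Qed.

(** * The dilogarithm and the logarithm as exponential series *)

Lemma csum_n_RtoC r w M :
  csum_n (fun k => RtoC (r k) * w)%C (S M) = (RtoC (sum_f_R0 r M) * w)%C.
Proof.
  induction M as [|M IH]; [cbn [csum_n sum_f_R0]; ring|].
  rewrite tech5, RtoC_plus. change (csum_n (fun k => RtoC (r k) * w)%C (S (S M))) with
    (csum_n (fun k => RtoC (r k) * w) (S M) + RtoC (r (S M)) * w)%C. rewrite IH. ring.
Qed.

Lemma csum_n_ext f g n : (forall k, f k = g k) -> csum_n f n = csum_n g n.
Proof. intros H. induction n as [|n IH]; cbn [csum_n]; [reflexivity|now rewrite IH, H]. Qed.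

Lemma csum_n_scal c f n : csum_n (fun k => c * f k)%C n = (c * csum_n f n)%C.
Proof. induction n as [|n IH]; cbn [csum_n]; [ring|rewrite IH; ring]. Qed.

Lemma telescoping_series (u : nat -> R) c : 0 <= c ->
  (forall k, Rabs (u (S k)) <= c * (/ INR (S k) - / INR (S (S k)))) ->
  forall M, Rabs (Series u - sum_f_R0 u M) <= c * / INR (S M).
Proof.
  intros Hc H.
  assert (HT : forall M M', (M <= M')%nat -> Rabs (sum_f_R0 u M' - sum_f_R0 u M) <= c * / INR (S M)).
  { intros M M' HM. replace M' with (M + (M' - M))%nat by lia.
    eapply Rle_trans; [now apply telescoping_partial|]. apply Rmult_le_compat_l; [exact Hc|].
    assert (0 < / INR (S (M + (M' - M)))) by apply Rinv_0_lt_compat, INR_S_pos. lra. }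
  assert (HC : ex_finite_lim_seq (sum_f_R0 u)).
  { apply ex_lim_seq_cauchy_corr. intros eps.
    destruct (inv_INR_S_small (eps / (c + 1))) as [N HN].
    { apply Rdiv_lt_0_compat; [apply cond_pos|lra]. }
    exists N. assert (W : forall n m, (N <= n)%nat -> (n <= m)%nat -> Rabs (sum_f_R0 u m - sum_f_R0 u n) < eps).
    { intros n m Hn Hm. eapply Rle_lt_trans; [now apply HT|]. specialize (HN n Hn).
      apply Rlt_div_r in HN; [|lra]. assert (0 < / INR (S n)) by apply Rinv_0_lt_compat, INR_S_pos. nra. }
    intros n m Hn Hm. destruct (Nat.le_ge_cases n m) as [Hnm|Hnm].
    - rewrite Rabs_minus_sym. now apply W.
    - now apply W. }
  destruct HC as [l Hl]. intros M.
  assert (ES : Series u = l).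
  { unfold Series. rewrite (Lim_seq_ext _ (sum_f_R0 u)) by (intros n; apply sum_n_Reals).
    rewrite (is_lim_seq_unique _ _ Hl). reflexivity. }
  rewrite ES.
  assert (HL : is_lim_seq (fun n => Rabs (sum_f_R0 u n - sum_f_R0 u M)) (Rabs (l - sum_f_R0 u M))).
  { apply (is_lim_seq_abs _ (Finite _)), is_lim_seq_minus'; [exact Hl|apply is_lim_seq_const]. }
  assert (A := is_lim_seq_le_loc (fun n => Rabs (sum_f_R0 u n - sum_f_R0 u M)) (fun _ => c * / INR (S M))
    (Rabs (l - sum_f_R0 u M)) (c * / INR (S M))).
  apply A; [|exact HL|apply is_lim_seq_const]. exists M. intros n Hn. now apply HT.
Qed.

Definition frq (k : nat) : R := 2 * PI * INR (S k).

Lemma frq_pos k : 0 < frq k.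
Proof. unfold frq. assert (A := PI_RGT_0). assert (B := INR_S_pos k). apply Rmult_lt_0_compat; lra. Qed.

Lemma exp_frq_le k t : 0 <= t -> exp (- (frq k * t)) <= exp (- (2 * PI * t)).
Proof.
  intros Ht. apply exp_monotone. unfold frq. rewrite S_INR. assert (A := pos_INR k). assert (B := PI_RGT_0).
  assert (0 <= 2 * PI * (INR k * t)) by (apply Rmult_le_pos; [lra|now apply Rmult_le_pos]). lra.
Qed.

Lemma exp_frq_pow k t : exp (- (2 * PI * t)) ^ S k = exp (- (frq k * t)).
Proof.
  induction k as [|k IH].
  - rewrite pow_1. f_equal. unfold frq; simpl. ring.
  - rewrite <- tech_pow_Rmult, IH, <- exp_plus. f_equal. unfold frq. rewrite (S_INR (S k)). ring.
Qed.

Definition li2e (t : R) : R := Series (fun k => exp (- (frq k * t)) * / INR (S k) ^ 2).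

Lemma li2e_tail t M : 0 <= t ->
  Rabs (li2e t - sum_f_R0 (fun k => exp (- (frq k * t)) * / INR (S k) ^ 2) M)
  <= exp (- (2 * PI * t)) * / INR (S M).
Proof.
  intros Ht. apply telescoping_series; [left; apply exp_pos|]. intros k.
  assert (A := inv_square_telescope k). assert (B := exp_frq_le (S k) t Ht).
  assert (P := exp_pos (- (frq (S k) * t))).
  assert (Q : 0 < / INR (S (S k)) ^ 2) by (apply Rinv_0_lt_compat, pow_lt, INR_S_pos).
  rewrite Rabs_pos_eq by (apply Rmult_le_pos; lra). apply Rmult_le_compat; lra.
Qed.

Lemma Li2_li2e t : Li2 (RtoC (exp (- 2 * PI * t))) = RtoC (li2e t).
Proof.
  replace (- 2 * PI * t) with (- (2 * PI * t)) by ring. unfold Li2, CSeries, li2e.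
  assert (E : forall k, (RtoC (exp (- (2 * PI * t))) ^ S k / RtoC (INR (S k) ^ 2))%C
     = RtoC (exp (- (frq k * t)) * / INR (S k) ^ 2)).
  { intros k. rewrite <- RtoC_pow, exp_frq_pow, <- RtoC_div; [reflexivity|].
    apply pow_nonzero, Rgt_not_eq, INR_S_pos. }
  match goal with |- _ = RtoC ?x => change (RtoC x) with (x, 0) end. f_equal.
  - apply Series_ext. intros k. now rewrite E.
  - transitivity (Series (fun _ => 0)); [apply Series_ext; intros k; now rewrite E|].
    rewrite (Series_ext _ (fun k => 0 * 0)) by (intros; ring). rewrite Series_scal_l. ring.
Qed.

Lemma uniform_ccont (S : nat -> R -> C) L c t : 0 <= c ->
  (forall M u, Cmod (L u - S M u) <= c * / INR (M + 1)) -> (forall M, ccont (S M) t) -> ccont L t.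
Proof.
  intros Hc H HS.
  assert (W : forall (pr : C -> R), (forall a b, Rabs (pr a - pr b) <= Cmod (a - b)) ->
     (forall M, continuous (fun u => pr (S M u)) t) -> continuous (fun u => pr (L u)) t).
  { intros pr Hpr HSc. apply continuity_pt_filterlim. intros eps Heps.
    destruct (inv_INR_S_small (eps / 3 / (c + 1))) as [M HM].
    { apply Rdiv_lt_0_compat; lra. }
    specialize (HM M (le_n _)). replace (Datatypes.S M) with (M + 1)%nat in HM by lia.
    assert (Hp : 0 < / INR (M + 1)) by (apply Rinv_0_lt_compat, lt_0_INR; lia).
    apply Rlt_div_r in HM; [|lra].
    assert (HMc : c * / INR (M + 1) < eps / 3) by nra.
    assert (Hcon := HSc M). apply continuity_pt_filterlim in Hcon.
    destruct (Hcon (eps / 3) ltac:(lra)) as [d [Hd Hd2]]. exists d. split; [exact Hd|].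
    intros u Hu. specialize (Hd2 u Hu). simpl in *. unfold Rdist in *.
    assert (A1 := Hpr (L u) (S M u)). assert (A2 := Hpr (L t) (S M t)).
    assert (B1 := H M u). assert (B2 := H M t).
    replace (pr (L u) - pr (L t)) with ((pr (L u) - pr (S M u)) + ((pr (S M u) - pr (S M t))
      + - (pr (L t) - pr (S M t)))) by ring.
    eapply Rle_lt_trans; [apply Rabs_triang|].
    assert (C1 := Rabs_triang (pr (S M u) - pr (S M t)) (- (pr (L t) - pr (S M t)))).
    rewrite Rabs_Ropp in C1. lra. }
  split; apply W; try (intros M; apply HS); intros a b.
  - apply Re_minus_le.
  - apply Im_minus_le.
Qed.

Lemma continuous_exp_abs a t : continuous (fun u => exp (- (a * Rabs u))) t.
Proof.
  apply (continuous_comp Rabs (fun v => exp (- (a * v)))); [apply continuous_Rabs|].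
  apply ex_derive_Rcontinuous.
  eexists; apply is_derive_exp_lin.
Qed.

Lemma ccont_csum_n (f : nat -> R -> C) n t : (forall k, ccont (f k) t) ->
  ccont (fun u => csum_n (fun k => f k u) n) t.
Proof.
  intros H. induction n as [|n IH]; cbn [csum_n]; [apply ccont_const|].
  apply ccont_plus; [exact IH|apply H].
Qed.

(** With |t| for t the bound on the tails is uniform on the whole line, which gives
    continuity up to the end point 0. *)
Lemma li2e_ccont t : ccont (fun u => RtoC (li2e (Rabs u))) t.
Proof.
  apply (uniform_ccont (fun M u => csum_n (fun k => RtoC (exp (- (frq k * Rabs u)) * / INR (S k) ^ 2) * 1)%C (S M)) _ 1).
  - lra.
  - intros M u. rewrite csum_n_RtoC, Cmult_1_r, <- RtoC_minus, Cmod_R.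
    eapply Rle_trans; [apply li2e_tail, Rabs_pos|]. replace (M + 1)%nat with (S M) by lia.
    apply Rmult_le_compat_r; [left; apply Rinv_0_lt_compat, INR_S_pos|].
    rewrite <- exp_0. apply exp_monotone. assert (A := Rabs_pos u). assert (B := PI_RGT_0). nra.
  - intros M. apply ccont_csum_n. intros k. apply ccont_mult; [|apply ccont_const].
    apply ccont_R. apply (continuous_mult (K := R_AbsRing)); [apply continuous_exp_abs|apply continuous_const].
Qed.

Definition expker (phi : R -> C) (k : nat) (t : R) : C := (phi t * RtoC (exp (- (frq k * t))))%C.

Definition eint (phi : R -> C) (k : nat) : C := improper (expker phi k).

(** The first exponential dominates all others, so such a function can be integrated
    termwise against the series of the dilogarithm. *)
Definition subexp (phi : R -> C) : Prop := (forall t, ccont phi t) /\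
  exists B, 0 <= B /\ forall t, 0 <= t -> Cmod (phi t) * exp (- (2 * PI * t)) <= B / (1 + t) ^ 2.

Lemma eint_correct phi k : subexp phi -> cint_inf (expker phi k) (eint phi k).
Proof.
  intros [Hc [B [HB HB1]]].
  assert (Hi : forall T, cintegrable (expker phi k) 0 T).
  { intros T. apply cintegrable_cont. intros x _. apply ccont_mult; [apply Hc|].
    eapply cder_ccont, cder_exp_lin. }
  destruct (cint_inf_dom2 (expker phi k) B) as [I [HI _]].
  - intros T _; apply Hi.
  - intros t Ht. unfold expker. rewrite Cmod_mult, Cmod_R, Rabs_pos_eq by (left; apply exp_pos).
    eapply Rle_trans; [|apply HB1; lra]. apply Rmult_le_compat_l; [apply Cmod_ge_0|apply exp_frq_le; lra].
  - exact (improper_correct _ _ HI).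
Qed.

Lemma dilog_integral phi : subexp phi -> exists I,
  cint_inf (fun t => phi t * RtoC (li2e t))%C I /\
  cseq (fun M => csum_n (fun k => RtoC (/ INR (S k) ^ 2) * eint phi k)%C (S M)) I.
Proof.
  intros Hphi. assert (Hphi' := Hphi). destruct Hphi' as [Hc [B [HB HB1]]].
  assert (Htail : forall M t, 0 < t -> Cmod (phi t * RtoC (li2e t)
     - csum_n (fun k => RtoC (/ INR (S k) ^ 2) * expker phi k t)%C (S M)) <= B * / INR (S M) / (1 + t) ^ 2).
  { intros M t Ht.
    rewrite (csum_n_ext _ (fun k => RtoC (exp (- (frq k * t)) * / INR (S k) ^ 2) * phi t)%C).
    2:{ intros k. unfold expker. rewrite RtoC_mult. ring. }
    rewrite csum_n_RtoC.
    match goal with |- Cmod (_ - RtoC ?s * _) <= _ =>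
      replace (phi t * RtoC (li2e t) - RtoC s * phi t)%C with (phi t * RtoC (li2e t - s))%C
        by (rewrite RtoC_minus; ring) end.
    rewrite Cmod_mult, Cmod_R.
    assert (A := li2e_tail t M ltac:(lra)). specialize (HB1 t ltac:(lra)).
    assert (P : 0 < / INR (S M)) by apply Rinv_0_lt_compat, INR_S_pos.
    eapply Rle_trans; [apply Rmult_le_compat_l; [apply Cmod_ge_0|exact A]|].
    rewrite <- Rmult_assoc. replace (B * / INR (S M) / (1 + t) ^ 2) with (B / (1 + t) ^ 2 * / INR (S M))
      by (unfold Rdiv; ring).
    apply Rmult_le_compat_r; lra. }
  destruct (cint_inf_dom2 (fun t => phi t * RtoC (li2e t))%C (2 * B)) as [I [HI _]].
  - intros T HT. destruct (cintegrable_cont (fun t => phi t * RtoC (li2e (Rabs t)))%C 0 T) as [J HJ].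
    + intros x _. apply ccont_mult; [apply Hc|apply li2e_ccont].
    + exists J. eapply cint_ext; [|exact HJ]. rewrite Rmin_left by exact HT.
      intros x Hx. cbv beta. now rewrite (Rabs_pos_eq x) by lra.
  - intros t Ht. specialize (Htail O t Ht). cbn [csum_n] in Htail.
    simpl (INR 1) in Htail. rewrite pow1, Rinv_1, Rmult_1_r in Htail.
    replace (phi t * RtoC (li2e t))%C with ((phi t * RtoC (li2e t) - (RtoC 0 + RtoC 1 * expker phi 0 t))
       + expker phi 0 t)%C by ring.
    eapply Rle_trans; [apply Cmod_triangle|]. 
    replace (2 * B / (1 + t) ^ 2) with (B / (1 + t) ^ 2 + B / (1 + t) ^ 2) by (unfold Rdiv; ring).
    apply Rplus_le_compat; [exact Htail|]. unfold expker.
    rewrite Cmod_mult, Cmod_R, Rabs_pos_eq by (left; apply exp_pos).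
    eapply Rle_trans; [|apply HB1; lra]. apply Rmult_le_compat_l; [apply Cmod_ge_0|apply exp_frq_le; lra].
  - exists I. split; [exact HI|].
    apply (series_interchange (fun k t => RtoC (/ INR (S k) ^ 2) * expker phi k t)%C _ _ _ B HI); [|exact Htail].
    intros k. apply cint_inf_scal. now apply eint_correct.
Qed.

(** ** The logarithm *)

Lemma log_series_bound r M : 0 <= r < 1 ->
  Rabs (ln (1 - r) + sum_f_R0 (fun k => r ^ S k * / INR (S k)) M) <= r / (1 - r) * / INR (S M).
Proof.
  intros Hr.
  set (w := fun s => ln (1 - s) + sum_f_R0 (fun k => s ^ S k * / INR (S k)) M).
  assert (Hw : forall s, 0 <= s <= r -> is_derive w s (- (s ^ S M / (1 - s)))).
  { intros s Hs. eapply is_derive_eq.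
    - apply is_derive_Rplus.
      + apply (is_derive_comp ln (fun s => 1 - s)).
        * apply is_derive_Reals, derivable_pt_lim_ln. lra.
        * apply is_derive_Rminus; [apply is_derive_Rconst|apply (is_derive_id (K := R_AbsRing))].
      + apply is_derive_sum_f with (df := fun k s => s ^ k). intros k _. eapply is_derive_eq.
        * apply (is_derive_Rmult (fun s => s ^ S k) (fun _ => / INR (S k)));
            [apply is_derive_Reals, derivable_pt_lim_pow|apply is_derive_Rconst].
        * simpl pred. to_R. field. apply Rgt_not_eq, INR_S_pos.
    - rewrite tech3 by lra. unfold scal; simpl; unfold mult; simpl. unfold one; simpl. to_R. field. lra. }
  assert (H := cder_le (fun s => RtoC (w s)) (fun s => RtoC (- (s ^ S M / (1 - s))))
     (fun s => s ^ S (S M) / (INR (S (S M)) * (1 - r))) (fun s => s ^ S M / (1 - r)) 0 r).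
  cbv beta in H. rewrite <- RtoC_minus, Cmod_R in H.
  assert (W0 : w 0 = 0).
  { unfold w. rewrite Rminus_0_r, ln_1, (sum_eq _ (fun _ => 0)); [rewrite sum_cte; ring|].
    intros k _. rewrite pow_i by lia. ring. }
  rewrite W0, Rminus_0_r in H. change (Rabs (w r) <= r / (1 - r) * / INR (S M)).
  assert (HN := INR_S_pos (S M)). assert (HM := INR_S_pos M).
  assert (Hg : forall s, is_derive (fun s => s ^ S (S M) / (INR (S (S M)) * (1 - r))) s (s ^ S M / (1 - r))).
  { intros s. eapply is_derive_eq.
    - apply (is_derive_Rmult (fun s => s ^ S (S M)) (fun _ => / (INR (S (S M)) * (1 - r))));
        [apply is_derive_Reals, derivable_pt_lim_pow|apply is_derive_Rconst].
    - simpl pred. to_R. field. split; lra. }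
  eapply Rle_trans; [apply H|].
  - lra.
  - intros s Hs. apply cder_R, Hw. lra.
  - intros s Hs. apply Hg.
  - intros s Hs. eapply cder_ccont, cder_R, Hw. lra.
  - intros s _. apply ex_derive_Rcontinuous. eexists; apply Hg.
  - intros s Hs. rewrite Cmod_R, Rabs_Ropp.
    assert (0 <= s ^ S M) by (apply pow_le; lra).
    rewrite Rabs_pos_eq by (apply Rdiv_le_0_compat; lra).
    unfold Rdiv. apply Rmult_le_compat_l; [assumption|]. apply Rinv_le_contravar; lra.
  - rewrite (pow_i (S (S M))) by lia. 
    replace (r ^ S (S M) / (INR (S (S M)) * (1 - r)) - 0 / (INR (S (S M)) * (1 - r)))
      with (r ^ S M * (r / (1 - r) * / INR (S (S M)))) by (rewrite <- (tech_pow_Rmult r (S M)); field; lra).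
    assert (Hp : r ^ S M <= 1) by (rewrite <- (pow1 (S M)); apply pow_incr; lra).
    assert (Hp0 : 0 <= r ^ S M) by (apply pow_le; lra).
    assert (Hq : 0 <= r / (1 - r)) by (apply Rdiv_le_0_compat; lra).
    assert (Hi : / INR (S (S M)) <= / INR (S M)) by (apply Rinv_le_contravar; [exact HM|apply le_INR; lia]).
    assert (Hi0 : 0 < / INR (S (S M))) by now apply Rinv_0_lt_compat.
    assert (r / (1 - r) * / INR (S (S M)) <= r / (1 - r) * / INR (S M)) by now apply Rmult_le_compat_l.
    assert (0 <= r / (1 - r) * / INR (S (S M))) by (apply Rmult_le_pos; lra). nra.
Qed.

(** The remainder of the series for log(1 - r) blows up like 1/t at r = exp(-2 pi t) as t
    tends to 0; one factor t repairs this. *)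
Lemma planck_bound t : 0 < t ->
  t * (exp (- (2 * PI * t)) / (1 - exp (- (2 * PI * t)))) <= exp (- (PI * t)) / PI.
Proof.
  intros Ht. assert (Hpi := PI_RGT_0). set (y := exp (- (PI * t))).
  assert (Hy : 0 < y) by apply exp_pos.
  assert (E : exp (- (2 * PI * t)) = y * y) by (unfold y; rewrite <- exp_plus; f_equal; ring).
  assert (Hlow : (1 + PI * t) * y <= 1).
  { assert (A := exp_ineq1_le (PI * t)).
    replace 1 with (exp (PI * t) * y) at 2 by (unfold y; rewrite <- exp_plus, <- exp_0; f_equal; ring).
    apply Rmult_le_compat_r; lra. }
  assert (Hpt : 0 < PI * t) by now apply Rmult_lt_0_compat.
  assert (Hy1 : y < 1) by nra.
  assert (Hyy : 0 < 1 - y * y) by nra.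
  rewrite E. apply Rmult_le_reg_r with (PI * (1 - y * y)); [now apply Rmult_lt_0_compat|].
  replace (t * (y * y / (1 - y * y)) * (PI * (1 - y * y))) with (PI * t * y * y) by (field; lra).
  replace (y / PI * (PI * (1 - y * y))) with (y * (1 - y * y)) by (field; lra).
  assert (PI * t * y <= 1 - y) by lra. assert (1 - y <= 1 - y * y) by nra. nra.
Qed.

Definition lge (t : R) : R := ln (1 - exp (- (2 * PI * t))).

(** Integrate log(1 - r) = - sum r^k/k termwise with r = exp(-2 pi t): moving the derivative
    from the exponential to Phi divides the k-th term by 2 pi k, which leaves the series of
    the dilogarithm against q = Phi'. *)
Lemma log_integral Phi q n D I : 0 <= D -> subexp q ->
  (forall t, cder Phi t (q t)) -> Phi 0 = 0 ->
  (forall t, 0 <= t -> Cmod (Phi t) <= D * t ^ S n) ->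
  cint_inf (fun t => q t * RtoC (li2e t))%C I ->
  cint_inf (fun t => Phi t * RtoC (lge t))%C (- / RtoC (2 * PI) * I)%C.
Proof.
  intros HD Hq HPhi H0 Hb HI. assert (Hpi := PI_RGT_0).
  destruct (pow_exp_bound PI n Hpi) as [B [HB HB1]].
  assert (Hexp1 : forall t, 0 < t -> exp (- (2 * PI * t)) < 1).
  { intros t Ht. rewrite <- exp_0. apply exp_increasing. nra. }
  set (c := D * B / PI).
  assert (Hc : 0 <= c) by (apply Rdiv_le_0_compat; [now apply Rmult_le_pos|lra]).
  assert (Hker : forall t, 0 < t -> Cmod (Phi t) * (exp (- (2 * PI * t)) / (1 - exp (- (2 * PI * t))))
     <= c / (1 + t) ^ 2).
  { intros t Ht. assert (A := planck_bound t Ht). specialize (Hb t ltac:(lra)). specialize (HB1 t ltac:(lra)).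
    assert (Hr : 0 <= exp (- (2 * PI * t)) / (1 - exp (- (2 * PI * t)))).
    { apply Rdiv_le_0_compat; [left; apply exp_pos|]. specialize (Hexp1 t Ht). lra. }
    eapply Rle_trans; [apply Rmult_le_compat_r; [exact Hr|exact Hb]|].
    rewrite <- tech_pow_Rmult.
    replace (D * (t * t ^ n) * (exp (- (2 * PI * t)) / (1 - exp (- (2 * PI * t)))))
      with (D * t ^ n * (t * (exp (- (2 * PI * t)) / (1 - exp (- (2 * PI * t)))))) by ring.
    assert (Htn : 0 <= D * t ^ n) by (apply Rmult_le_pos; [exact HD|apply pow_le; lra]).
    eapply Rle_trans; [apply Rmult_le_compat_l; [exact Htn|exact A]|].
    replace (D * t ^ n * (exp (- (PI * t)) / PI)) with (D / PI * (t ^ n * exp (- (PI * t)))) by (field; lra).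
    replace (c / (1 + t) ^ 2) with (D / PI * (B / (1 + t) ^ 2)) by (unfold c; field; split; nra).
    apply Rmult_le_compat_l; [apply Rdiv_le_0_compat; lra|exact HB1]. }
  assert (Htail : forall M t, 0 < t -> Cmod (Phi t * RtoC (lge t)
     - csum_n (fun k => RtoC (- / INR (S k)) * expker Phi k t)%C (S M)) <= c * / INR (S M) / (1 + t) ^ 2).
  { intros M t Ht.
    rewrite (csum_n_ext _ (fun k => RtoC (- (exp (- (2 * PI * t)) ^ S k * / INR (S k))) * Phi t)%C).
    2:{ intros k. unfold expker. rewrite exp_frq_pow, !RtoC_opp, RtoC_mult. ring. }
    rewrite csum_n_RtoC.
    match goal with |- Cmod (_ - RtoC ?s * _) <= _ =>
      replace (Phi t * RtoC (lge t) - RtoC s * Phi t)%C with (Phi t * RtoC (lge t - s))%C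
        by (rewrite RtoC_minus; ring) end.
    rewrite Cmod_mult, Cmod_R.
    replace (lge t - sum_f_R0 (fun k => - (exp (- (2 * PI * t)) ^ S k * / INR (S k))) M)
      with (ln (1 - exp (- (2 * PI * t))) + sum_f_R0 (fun k => exp (- (2 * PI * t)) ^ S k * / INR (S k)) M).
    2:{ unfold lge. rewrite (sum_eq (fun k => - _) (fun k => (exp (- (2 * PI * t)) ^ S k * / INR (S k)) * (-1)))
          by (intros; ring). rewrite <- scal_sum. ring. }
    assert (A := log_series_bound (exp (- (2 * PI * t))) M (conj (Rlt_le _ _ (exp_pos _)) (Hexp1 t Ht))).
    eapply Rle_trans; [apply Rmult_le_compat_l; [apply Cmod_ge_0|exact A]|].
    rewrite <- Rmult_assoc. replace (c * / INR (S M) / (1 + t) ^ 2) with (c / (1 + t) ^ 2 * / INR (S M))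
      by (unfold Rdiv; ring).
    apply Rmult_le_compat_r; [left; apply Rinv_0_lt_compat, INR_S_pos|now apply Hker]. }
  assert (HPk : forall k, cint_inf (expker Phi k) (/ RtoC (frq k) * eint q k)%C).
  { intros k. assert (Ha := frq_pos k). assert (Han := RtoC_nz _ (Rgt_not_eq _ _ Ha)).
    destruct (pow_exp_bound (frq k) (S n) Ha) as [B' [HB' HB1']].
    assert (HZ : cint_inf (fun t => q t * RtoC (exp (- (frq k * t))) 
       + Phi t * (- RtoC (frq k) * RtoC (exp (- (frq k * t)))))%C
       (0 - Phi 0 * RtoC (exp (- (frq k * 0))))%C).
    { apply (cint_inf_derive (fun t => Phi t * RtoC (exp (- (frq k * t))))%C _ 0 (D * B')).
      - intros t _. apply (cder_mult Phi (fun t => RtoC (exp (- (frq k * t))))); [apply HPhi|apply cder_exp_lin].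
      - intros t _. apply ccont_plus; apply ccont_mult.
        + apply Hq.
        + eapply cder_ccont, cder_exp_lin.
        + eapply cder_ccont, HPhi.
        + apply ccont_mult; [apply ccont_const|eapply cder_ccont, cder_exp_lin].
      - intros T HT. match goal with |- Cmod (?x - _) <= _ => replace (x - 0)%C with x by ring end.
        rewrite Cmod_mult, Cmod_R, Rabs_pos_eq by (left; apply exp_pos).
        eapply Rle_trans; [apply Rmult_le_compat_r; [left; apply exp_pos|now apply Hb]|].
        rewrite Rmult_assoc. unfold Rdiv. rewrite Rmult_assoc. apply Rmult_le_compat_l; [exact HD|].
        eapply Rle_trans; [now apply HB1'|now apply inv_sq_le_inv]. }
    rewrite H0 in HZ.
    apply cint_inf_ext with (fun t => / RtoC (frq k) * expker q k t - / RtoC (frq k) *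
      (q t * RtoC (exp (- (frq k * t))) + Phi t * (- RtoC (frq k) * RtoC (exp (- (frq k * t))))))%C.
    { intros t _. unfold expker. field. exact Han. }
    eapply cint_inf_eq; [apply cint_inf_minus; apply cint_inf_scal; [now apply eint_correct|exact HZ]|]. ring. }
  assert (HPc : forall t, ccont (fun u => Phi (Rabs u)) t).
  { intros t. apply (ccont_comp Phi Rabs); [eapply cder_ccont, HPhi|apply continuous_Rabs]. }
  (* near 0 the integrand is a uniform limit of continuous functions of |t|, 0 at t = 0 *)
  destruct (cint_inf_dom2 (fun t => Phi t * RtoC (lge t))%C (2 * c)) as [I1 [HI1 _]].
  - intros T HT. destruct (cintegrable_cont (fun t => Phi (Rabs t) * RtoC (lge (Rabs t)))%C 0 T) as [J HJ].
    + intros x _.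
      apply (uniform_ccont (fun M u => csum_n (fun k => RtoC (- / INR (S k)) * expker Phi k (Rabs u))%C (S M)) _ c _ Hc).
      * intros M u. replace (M + 1)%nat with (S M) by lia.
        assert (P : 0 <= c * / INR (S M)).
        { apply Rmult_le_pos; [exact Hc|left; apply Rinv_0_lt_compat, INR_S_pos]. }
        destruct (Req_dec u 0) as [Eu|Eu].
        -- subst u. rewrite Rabs_R0, H0.
           rewrite (csum_n_ext _ (fun k => RtoC (- / INR (S k)) * RtoC 0)%C)
             by (intros k; unfold expker; rewrite H0; ring).
           rewrite csum_n_RtoC. match goal with |- Cmod ?x <= _ => replace x with (RtoC 0) by ring end.
           rewrite Cmod_0. exact P.
        -- assert (Hu := Rabs_pos_lt u Eu). eapply Rle_trans; [now apply Htail|].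
           unfold Rdiv. rewrite <- (Rmult_1_r (c * / INR (S M))) at 2. apply Rmult_le_compat_l; [exact P|].
           rewrite <- Rinv_1. apply Rinv_le_contravar; nra.
      * intros M. apply ccont_csum_n. intros k. apply ccont_mult; [apply ccont_const|].
        apply ccont_mult; [apply HPc|]. apply ccont_R, continuous_exp_abs.
    + exists J. eapply cint_ext; [|exact HJ]. rewrite Rmin_left by exact HT.
      intros x Hx. cbv beta. now rewrite (Rabs_pos_eq x) by lra.
  - intros t Ht. specialize (Htail O t Ht). specialize (Hker t Ht). cbn [csum_n] in Htail.
    simpl (INR 1) in Htail. rewrite Rinv_1, Rmult_1_r in Htail.
    replace (Phi t * RtoC (lge t))%C with ((Phi t * RtoC (lge t) - (RtoC 0 + RtoC (- (1)) * expker Phi 0 t))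
       - expker Phi 0 t)%C by (rewrite RtoC_opp; ring).
    eapply Rle_trans; [apply Cmod_triangle|]. rewrite Cmod_opp.
    replace (2 * c / (1 + t) ^ 2) with (c / (1 + t) ^ 2 + c / (1 + t) ^ 2) by (unfold Rdiv; ring).
    apply Rplus_le_compat; [exact Htail|]. unfold expker.
    rewrite Cmod_mult, Cmod_R, Rabs_pos_eq by (left; apply exp_pos).
    eapply Rle_trans; [|exact Hker]. apply Rmult_le_compat_l; [apply Cmod_ge_0|].
    eapply Rle_trans; [apply exp_frq_le; lra|]. specialize (Hexp1 t Ht).
    assert (He := exp_pos (- (2 * PI * t))). rewrite <- (Rdiv_1_r (exp (- (2 * PI * t)))) at 1.
    unfold Rdiv. apply Rmult_le_compat_l; [lra|]. apply Rinv_le_contravar; lra.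
  - eapply cint_inf_eq; [exact HI1|].
    assert (HC1 : cseq (fun M => csum_n (fun k => RtoC (- / INR (S k)) * (/ RtoC (frq k) * eint q k))%C (S M)) I1).
    { apply (series_interchange (fun k t => RtoC (- / INR (S k)) * expker Phi k t)%C _ _ _ c HI1); [|exact Htail].
      intros k. apply cint_inf_scal, HPk. }
    destruct (dilog_integral q Hq) as [I2 [HI2 HC2]].
    rewrite (cint_inf_unique _ _ _ HI HI2).
    apply (cseq_unique _ _ _ HC1).
    apply cseq_ext with (fun M => - / RtoC (2 * PI) * csum_n (fun k => RtoC (/ INR (S k) ^ 2) * eint q k)%C (S M))%C;
      [|now apply cseq_scal].
    intros M. rewrite <- csum_n_scal. apply csum_n_ext. intros k.
    assert (A := RtoC_nz _ (Rgt_not_eq _ _ (INR_S_pos k))). assert (P2 := RtoC_nz (2 * PI) ltac:(lra)).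
    unfold frq. rewrite RtoC_opp, (RtoC_mult (2 * PI)), !RtoC_inv
      by (try apply pow_nonzero; apply Rgt_not_eq, INR_S_pos).
    rewrite RtoC_pow. field. split; assumption.
Qed.

(** * From the periodic Bernoulli function to the dilogarithm *)

(** The bound for the Fourier gap at level 3, where cos(x - 3 pi/2) = - sin x, carried from
    [0, 1) to all t by periodicity. *)
Lemma bper3_fourier t M : 0 <= t ->
  Rabs (bper 3 t * ((2 * PI) ^ 3 / 12) - sum_f_R0 (fun k => sin (frq k * t) * / INR (S k) ^ 3) M)
  <= 2 * PI * / INR (S M).
Proof.
  intros Ht. destruct (nfloor_ex t Ht) as [j [Hj1 Hj2]].
  assert (Hf := frac_part_nat j t (conj Hj1 Hj2)).
  set (x := t - INR j) in *.
  assert (Hg : Rabs (fourier_gap 3 M x) <= 2 * PI * / INR (S M)).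
  { assert (Ex : (2 * PI) ^ 1 / INR (S M) = 2 * PI * / INR (S M)) by (rewrite pow_1; reflexivity).
    rewrite <- Ex. destruct (Req_dec x 0) as [E|E].
    - rewrite E. apply (fourier_gap_bound_0 1).
    - apply (fourier_gap_bound 1). unfold x in *. lra. }
  unfold fourier_gap in Hg. unfold bper. rewrite Hf.
  replace (2 * INR (fact 3)) with 12 in Hg by (simpl; ring).
  assert (Es : fourier_sum 3 M x = - sum_f_R0 (fun k => sin (frq k * t) * / INR (S k) ^ 3) M).
  { unfold fourier_sum. rewrite <- (Rmult_1_r (sum_f_R0 (fun k => sin _ * _) M)), Ropp_mult_distr_r.
    rewrite (Rmult_comm _ (- (1))), scal_sum. apply sum_eq. intros k _.
    assert (Ec : cos (2 * PI * INR (S k) * x - INR 3 * PI / 2) = - sin (2 * PI * INR (S k) * x)).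
    { replace (2 * PI * INR (S k) * x - INR 3 * PI / 2) with (2 * PI * INR (S k) * x - PI / 2 - PI)
        by (simpl (INR 3); field).
      rewrite cos_minus, cos_PI, sin_PI, cos_minus, cos_PI2, sin_PI2. ring. }
    assert (Ep : sin (frq k * t) = sin (2 * PI * INR (S k) * x)).
    { replace (frq k * t) with (2 * PI * INR (S k) * x + 2 * INR (S k * j) * PI)
        by (unfold frq, x; rewrite mult_INR; ring).
      apply sin_period. }
    rewrite Ec, Ep. unfold Rdiv. ring. }
  rewrite Es in Hg.
  match goal with |- Rabs ?a <= _ => match type of Hg with Rabs ?b <= _ =>
    replace a with b by ring end end. exact Hg.
Qed.

Lemma binet_subexp z n : 0 < Re z -> subexp (fun t => RtoC (t ^ n) * binet z t)%C.
Proof.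
  intros Hz. assert (Hpi := PI_RGT_0). split.
  - intros t. apply ccont_mult; [|eapply cder_ccont, cder_binet, Hz].
    apply ccont_R, ex_derive_Rcontinuous. auto_derive. exact I.
  - destruct (pow_exp_bound (2 * PI) (S n) ltac:(lra)) as [B [HB HB1]].
    assert (Hi : 0 < / Re z) by now apply Rinv_0_lt_compat.
    exists (/ Re z * / Re z * B). split; [apply Rmult_le_pos; nra|]. intros t Ht.
    rewrite Cmod_mult, Cmod_R, Rabs_pos_eq by now apply pow_le.
    assert (A := binet_bound z t Hz Ht). specialize (HB1 t Ht). assert (He := exp_pos (- (2 * PI * t))).
    apply Rle_trans with (t ^ n * (t * (/ Re z * / Re z)) * exp (- (2 * PI * t))).
    + apply Rmult_le_compat_r; [lra|]. apply Rmult_le_compat_l; [now apply pow_le|exact A].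
    + replace (t ^ n * (t * (/ Re z * / Re z)) * exp (- (2 * PI * t)))
        with (/ Re z * / Re z * (t ^ S n * exp (- (2 * PI * t)))) by (simpl; ring).
      unfold Rdiv. rewrite (Rmult_assoc (/ Re z * / Re z) B). apply Rmult_le_compat_l; [nra|exact HB1].
Qed.

Lemma subexp_ext f g : (forall t, f t = g t) -> subexp f -> subexp g.
Proof.
  intros E [Hc [B [HB HB1]]]. split.
  - intros t. apply ccont_ext with f; auto.
  - exists B. split; [exact HB|]. intros t Ht. rewrite <- E. now apply HB1.
Qed.

Lemma subexp_scal c f : subexp f -> subexp (fun t => c * f t)%C.
Proof.
  intros [Hc [B [HB HB1]]]. split.
  - intros t. apply ccont_mult; [apply ccont_const|apply Hc].
  - exists (Cmod c * B). split; [apply Rmult_le_pos; [apply Cmod_ge_0|exact HB]|].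
    intros t Ht. rewrite Cmod_mult. unfold Rdiv.
    rewrite (Rmult_assoc (Cmod c) (Cmod (f t))), (Rmult_assoc (Cmod c) B).
    apply Rmult_le_compat_l; [apply Cmod_ge_0|now apply HB1].
Qed.

(** Each sine integral of the Fourier series of B_3 becomes a Laplace integral, and
    the Laplace kernels sum to the dilogarithm. *)
Lemma kval_dilog z I : 0 < Re z ->
  cint_inf (fun t => binet z t * RtoC (li2e t))%C I ->
  kval 3 2 z = (3 / RtoC (PI ^ 2) * I)%C.
Proof.
  intros Hz HI. assert (Hsz := Re_pos_slit z Hz). assert (Hpi := PI_RGT_0).
  assert (Hsub : subexp (binet z)).
  { apply subexp_ext with (2 := binet_subexp z 0 Hz). intros t. simpl pow. ring. }
  destruct (dilog_integral _ Hsub) as [I' [HI' HC]].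
  rewrite <- (cint_inf_unique _ _ _ HI HI') in HC. clear I' HI'.
  set (c3 := (2 * PI) ^ 3 / 12).
  destruct (shift_pow_bound z 2 Hsz ltac:(lia)) as [B [HB HB1]].
  assert (HC3 : cseq (fun M => csum_n (fun k => RtoC (/ INR (S k) ^ 3) * (RtoC (frq k) * eint (binet z) k))%C (S M))
     (RtoC c3 * kval 3 2 z)%C).
  { apply (series_interchange (fun k t => RtoC (/ INR (S k) ^ 3) * (RtoC (sin (frq k * t)) / (RtoC t + z) ^ 2))%C
      (fun t => RtoC c3 * (RtoC (bper 3 t) / (RtoC t + z) ^ 2))%C _ _ (2 * PI * B)).
    - apply cint_inf_scal. exact (kval_correct 3 2 z Hsz (le_n 2)).
    - intros k. apply cint_inf_scal. apply sine_integral; [apply frq_pos|exact Hz|].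
      exact (eint_correct (binet z) k Hsub).
    - intros M t Ht.
      rewrite (csum_n_ext _ (fun k => RtoC (sin (frq k * t) * / INR (S k) ^ 3) * / (RtoC t + z) ^ 2)%C).
      2:{ intros k. rewrite RtoC_mult. unfold Cdiv. ring. }
      rewrite csum_n_RtoC.
      match goal with |- Cmod (_ - RtoC ?s * _) <= _ =>
        replace (RtoC c3 * (RtoC (bper 3 t) / (RtoC t + z) ^ 2) - RtoC s * / (RtoC t + z) ^ 2)%C
          with (RtoC (bper 3 t * c3 - s) * / (RtoC t + z) ^ 2)%C
          by (rewrite RtoC_minus, RtoC_mult; unfold Cdiv; ring) end.
      rewrite Cmod_mult, Cmod_R.
      replace (2 * PI * B * / INR (S M) / (1 + t) ^ 2) with (2 * PI * / INR (S M) * (B / (1 + t) ^ 2))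
        by (unfold Rdiv; ring).
      apply Rmult_le_compat; [apply Rabs_pos|apply Cmod_ge_0|apply bper3_fourier; lra|apply HB1; lra]. }
  assert (HC4 : cseq (fun M => RtoC (2 * PI) * csum_n (fun k => RtoC (/ INR (S k) ^ 2) * eint (binet z) k) (S M))%C
     (RtoC c3 * kval 3 2 z)%C).
  { apply cseq_ext with (2 := HC3). intros M. rewrite <- csum_n_scal. apply csum_n_ext. intros k.
    assert (A := INR_S_pos k). unfold frq. rewrite !Cmult_assoc, <- !RtoC_mult. do 2 f_equal. field. lra. }
  assert (E := cseq_unique _ _ _ HC4 (cseq_scal (RtoC (2 * PI)) _ _ HC)).
  assert (Hc3 : RtoC c3 <> RtoC 0).
  { apply RtoC_nz. unfold c3. apply Rgt_not_eq, Rdiv_lt_0_compat; [apply pow_lt; lra|lra]. }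
  transitivity (/ RtoC c3 * (RtoC c3 * kval 3 2 z))%C; [field; exact Hc3|].
  rewrite E. rewrite Cmult_assoc. f_equal. unfold c3.
  rewrite <- RtoC_inv, <- RtoC_mult, <- RtoC_div.
  - f_equal. field. lra.
  - apply pow_nonzero. lra.
  - apply Rgt_not_eq, Rdiv_lt_0_compat; [apply pow_lt; lra|lra].
Qed.

(** Termwise, the moment of exp(-2 pi k t)/k^2 is (2n+1)! / (2 pi)^(2n+2) / k^(2n+4), so the
    zeta value at 2n+4 appears. *)
Lemma dilog_moment n :
  cint_inf (fun t => RtoC (t ^ (2 * n + 1)) * RtoC (li2e t))%C
    (RtoC (INR (fact (2 * n + 1)) / (2 * PI) ^ (2 * n + 2) *
       ((-1) ^ S n * bernoulli (2 * S n + 2) * ((2 * PI) ^ (2 * S n + 2) / (2 * INR (fact (2 * S n + 2))))))).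
Proof.
  assert (Hpi := PI_RGT_0).
  assert (Hsub : subexp (fun t => RtoC (t ^ (2 * n + 1)))).
  { split.
    - intros t. apply ccont_R, ex_derive_Rcontinuous. auto_derive. exact I.
    - destruct (pow_exp_bound (2 * PI) (2 * n + 1) ltac:(lra)) as [B [HB HB1]].
      exists B. split; [exact HB|]. intros t Ht. rewrite Cmod_R, Rabs_pos_eq by now apply pow_le.
      now apply HB1. }
  destruct (dilog_integral _ Hsub) as [I [HI HC]].
  eapply cint_inf_eq; [exact HI|]. apply (cseq_unique _ _ _ HC).
  assert (HP : forall k, eint (fun t => RtoC (t ^ (2 * n + 1))) k
     = RtoC (INR (fact (2 * n + 1)) / frq k ^ S (2 * n + 1))).
  { intros k. apply (cint_inf_unique _ _ _ (eint_correct _ k Hsub)).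
    apply cint_inf_ext with (2 := moment_exp (frq k) (2 * n + 1) (frq_pos k)).
    intros t _. unfold expker. now rewrite RtoC_mult. }
  apply cseq_ext with (fun M => RtoC (INR (fact (2 * n + 1)) / (2 * PI) ^ (2 * n + 2) *
     sum_f_R0 (fun k => / INR (S k) ^ (2 * S n + 2)) M)).
  - intros M. rewrite RtoC_mult, Cmult_comm, <- csum_n_RtoC. apply csum_n_ext. intros k.
    rewrite HP, <- !RtoC_mult. f_equal. unfold frq. rewrite (Rpow_mult_distr (2 * PI)).
    replace (S (2 * n + 1)) with (2 * n + 2)%nat by lia.
    replace (2 * S n + 2)%nat with (2 + (2 * n + 2))%nat by lia. rewrite (pow_add (INR (S k)) 2).
    assert (A := INR_S_pos k). assert (B := pow_lt _ (2 * n + 2) A).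
    assert (C1 : 0 < (2 * PI) ^ (2 * n + 2)) by (apply pow_lt; lra).
    set (p := INR (S k) ^ (2 * n + 2)) in *. set (q := (2 * PI) ^ (2 * n + 2)) in *.
    set (f := INR (fact _)). set (x := INR (S k)) in *. clearbody p q f x. field. repeat split; lra.
  - apply cseq_R. apply is_lim_seq_mult'; [apply is_lim_seq_const|apply zeta_even_lim].
Qed.

(** * The two integral formulas in the right half-plane *)

(** The factor of Li_2 in the second formula for N = n+1, written through binet to
    inherit its continuity and its bounds. *)
Definition qker (z : C) (n : nat) (t : R) : C := (RtoC (t ^ (2 * n)) * (z ^ 2 * binet z t))%C.

Lemma qker_E z n t : 0 < Re z ->
  qker z n t = (RtoC (t ^ (2 * S n - 1)) / (1 + (RtoC t / z) ^ 2))%C.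
Proof.
  intros Hz. assert (Hn := sum_sq_nz z t Hz). assert (Hzn := slit_plane_nz z (Re_pos_slit z Hz)).
  unfold qker, binet. replace (2 * S n - 1)%nat with (S (2 * n)) by lia.
  rewrite <- (tech_pow_Rmult t (2 * n)), RtoC_mult.
  assert (E : (1 + (RtoC t / z) ^ 2)%C = ((z ^ 2 + RtoC t ^ 2) / z ^ 2)%C) by (field; exact Hzn).
  rewrite E. field. split; [exact Hzn|exact Hn].
Qed.

Lemma qker_subexp z n : 0 < Re z -> subexp (qker z n).
Proof.
  intros Hz. apply subexp_ext with (fun t => z ^ 2 * (RtoC (t ^ (2 * n)) * binet z t))%C.
  - intros t. unfold qker. ring.
  - now apply subexp_scal, binet_subexp.
Qed.

(** By induction: t^2/(z^2+t^2) = 1 - z^2/(z^2+t^2), so two consecutive integrals differ by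
    a moment of the dilogarithm, and this moment is the next term of the asymptotic series. *)
Lemma remainder_dilog A logG logGamma n z : is_glaisher A ->
  is_log_branch (fun z => BarnesG (z + 1)%C) logG ->
  is_log_branch (fun z => Gamma (z + 1)%C) logGamma -> 0 < Re z ->
  exists I, cint_inf (fun t => qker z n t * RtoC (li2e t))%C I /\
  barnes_remainder A logG logGamma (S n) z
    = (/ z ^ (2 * S n) * RtoC ((-1) ^ S n / (2 * PI ^ 2)) * I)%C.
Proof.
  intros hA hG hGa Hz. assert (Hsz := Re_pos_slit z Hz). assert (Hzn := slit_plane_nz z Hsz).
  assert (Hpi := PI_RGT_0). assert (HP2 : PI ^ 2 <> 0) by (apply pow_nonzero; lra).
  assert (HP2c := RtoC_nz _ HP2).
  induction n as [|n [I [HI IH]]].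
  - destruct (dilog_integral (binet z)) as [I [HI _]].
    { apply subexp_ext with (2 := binet_subexp z 0 Hz). intros t. simpl pow. ring. }
    exists (z ^ 2 * I)%C. split.
    + apply cint_inf_ext with (fun t => z ^ 2 * (binet z t * RtoC (li2e t)))%C.
      * intros t _. unfold qker. simpl (2 * 0)%nat. rewrite pow_O. ring.
      * now apply cint_inf_scal.
    + rewrite (remainder_kint A logG logGamma 0 z hA hG hGa Hsz).
      change (2 * 1 + 1)%nat with 3%nat. change (2 * 1)%nat with 2%nat.
      rewrite (kval_dilog z I Hz HI). rewrite pow_1, RtoC_div, (RtoC_mult 2) by lra.
      simpl (INR 2). simpl (INR 3). replace (1 + 1 + 1) with 3 by ring. replace (1 + 1) with 2 by ring.
      field. split; assumption.
  - assert (Hm := dilog_moment n). set (m := RtoC _) in Hm.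
    exists (z ^ 2 * (m - I))%C. split.
    + apply cint_inf_ext with (fun t => z ^ 2 * (RtoC (t ^ (2 * n + 1)) * RtoC (li2e t)
         - qker z n t * RtoC (li2e t)))%C.
      * intros t _. assert (Hn := sum_sq_nz z t Hz). unfold qker, binet.
        replace (2 * S n)%nat with (2 * n + 2)%nat by lia. rewrite !pow_add, pow_1, !RtoC_mult.
        rewrite (RtoC_pow t 2). field. exact Hn.
      * apply cint_inf_scal. now apply cint_inf_minus.
    + rewrite remainder_step, IH. unfold m.
      replace (2 * S (S n))%nat with (2 * S n + 2)%nat by lia. rewrite Cpow_add_r.
      assert (Hzp := Cpow_nz z (2 * S n) Hzn).
      set (b := bernoulli (2 * S n + 2)).
      assert (Em : INR (fact (2 * n + 1)) / (2 * PI) ^ (2 * n + 2) *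
         ((-1) ^ S n * b * ((2 * PI) ^ (2 * S n + 2) / (2 * INR (fact (2 * S n + 2)))))
         = (-1) ^ S n * (2 * PI ^ 2) * (b / (INR (2 * S n) * INR (2 * S n + 1) * INR (2 * S n + 2)))).
      { replace (2 * S n + 2)%nat with (S (S (S (2 * n + 1)))) by lia.
        replace (2 * S n + 1)%nat with (S (S (2 * n + 1))) by lia.
        replace (2 * S n)%nat with (S (2 * n + 1)) by lia.
        replace (2 * n + 2)%nat with (S (2 * n + 1)) by lia.
        rewrite !fact_simpl, !mult_INR. rewrite <- !(tech_pow_Rmult (2 * PI)).
        assert (P1 : 0 < (2 * PI) ^ (2 * n + 1)) by (apply pow_lt; lra).
        assert (F := INR_fact_lt_0 (2 * n + 1)).
        assert (Q1 := INR_S_pos (2 * n + 1)). assert (Q2 := INR_S_pos (S (2 * n + 1))).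
        assert (Q3 := INR_S_pos (S (S (2 * n + 1)))). field. repeat split; lra. }
      rewrite Em.
      assert (N0 := not_0_INR (2 * S n) ltac:(lia)). assert (N1 := not_0_INR (2 * S n + 1) ltac:(lia)).
      assert (N2 := not_0_INR (2 * S n + 2) ltac:(lia)).
      assert (Hs : (-1) ^ S n * (-1) ^ S n = 1).
      { rewrite <- Rpow_mult_distr. replace (-1 * -1) with 1 by ring. apply pow1. }
      rewrite <- (tech_pow_Rmult (-1) (S n)). set (e := (-1) ^ S n) in *.
      set (D := INR (2 * S n) * INR (2 * S n + 1) * INR (2 * S n + 2)).
      assert (HD : D <> 0) by (unfold D; repeat apply Rmult_integral_contrapositive_currified; assumption).
      assert (HDc := RtoC_nz _ HD).
      rewrite !RtoC_div by (try assumption; lra). rewrite !RtoC_mult, !RtoC_div by assumption.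
      assert (Hsc : (RtoC e * RtoC e)%C = RtoC 1) by (rewrite <- RtoC_mult; now f_equal).
      set (ec := RtoC e) in *. set (bc := RtoC b). set (p := (z ^ (2 * S n))%C) in *.
      set (pc := RtoC (PI ^ 2)) in *. set (Dc := RtoC D) in *.
      transitivity (/ p * (ec / (2 * pc)) * I - (ec * ec) * bc / (Dc * p))%C.
      * rewrite Hsc. field. repeat split; assumption.
      * field. repeat split; assumption.
Qed.

Lemma Phi_bound (Phi q : R -> C) D n : (forall t, cder Phi t (q t)) -> Phi 0 = 0 -> 0 <= D ->
  (forall t, 0 <= t -> Cmod (q t) <= D * t ^ n) ->
  forall t, 0 <= t -> Cmod (Phi t) <= D * t ^ S n.
Proof.
  intros Hd H0 HD Hq t Ht.
  assert (Hg : forall s, is_derive (fun s => D * s ^ S n) s (D * (INR (S n) * s ^ n))).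
  { intros s. apply (is_derive_scal (fun s => s ^ S n)). apply is_derive_Reals, derivable_pt_lim_pow. }
  assert (A := cder_le Phi q (fun s => D * s ^ S n) (fun s => D * (INR (S n) * s ^ n)) 0 t Ht).
  cbv beta in A. rewrite H0, pow_i, Rmult_0_r, Rminus_0_r in A by lia.
  replace (Phi t - RtoC 0)%C with (Phi t) in A by ring. apply A.
  - intros x _. apply Hd.
  - intros x _. apply Hg.
  - intros x _. eapply cder_ccont, Hd.
  - intros x _. apply ex_derive_Rcontinuous. eexists; apply Hg.
  - intros x Hx. eapply Rle_trans; [apply Hq; lra|]. apply Rmult_le_compat_l; [exact HD|].
    assert (0 <= x ^ n) by (apply pow_le; lra). assert (P := pos_INR n). rewrite S_INR. nra.
Qed.

Lemma cder_cRInt q t : (forall u, ccont q u) -> cder (fun x => cRInt q 0 x) t (q t).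
Proof.
  intros Hq.
  assert (HI : forall x, cint q 0 x (cRInt q 0 x)).
  { intros x. apply cRInt_correct, cintegrable_cont. intros u _; apply Hq. }
  split.
  - apply (is_derive_RInt (V := R_CompleteNormedModule) (fun u => Re (q u)) (fun x => Re (cRInt q 0 x)) 0).
    + apply filter_forall. intros x. exact (proj1 (HI x)).
    + exact (proj1 (Hq t)).
  - apply (is_derive_RInt (V := R_CompleteNormedModule) (fun u => Im (q u)) (fun x => Im (cRInt q 0 x)) 0).
    + apply filter_forall. intros x. exact (proj2 (HI x)).
    + exact (proj2 (Hq t)).
Qed.

Lemma qker_bound z n t : 0 < Re z -> 0 <= t ->
  Cmod (qker z n t) <= Cmod z ^ 2 * (/ Re z * / Re z) * t ^ (2 * n + 1).
Proof.
  intros Hz Ht. unfold qker. rewrite !Cmod_mult, Cmod_R, Cmod_pow, Rabs_pos_eq by now apply pow_le.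
  assert (A := binet_bound z t Hz Ht). rewrite pow_add, pow_1.
  replace (Cmod z ^ 2 * (/ Re z * / Re z) * (t ^ (2 * n) * t))
    with (t ^ (2 * n) * (Cmod z ^ 2 * (t * (/ Re z * / Re z)))) by ring.
  apply Rmult_le_compat_l; [now apply pow_le|]. apply Rmult_le_compat_l; [apply pow2_ge_0|exact A].
Qed.

Lemma cint_is_RInt f a b I : cint f a b I -> is_RInt (V := C_R_NormedModule) f a b I.
Proof.
  intros [A1 A2]. destruct I as [x y].
  apply (is_RInt_fct_extend_pair (U := R_NormedModule) (V := R_NormedModule)); assumption.
Qed.

(** The substitution u = s t turns the inner integral into the antiderivative of qker that
    vanishes at 0, as needed to integrate by parts against the logarithm. *)
Lemma inner_integral z n t : 0 < Re z -> 0 < t ->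
  (RInt (V := C_R_CompleteNormedModule)
     (fun s : R => RtoC (s ^ (2 * S n - 1)) / (1 + (RtoC (s * t) / z) ^ 2))%C 0 1
   * RtoC (t ^ (2 * S n)) = cRInt (qker z n) 0 t)%C.
Proof.
  intros Hz Ht. assert (Hzn := slit_plane_nz z (Re_pos_slit z Hz)).
  assert (Hc : forall u, ccont (qker z n) u) by (apply (qker_subexp z n Hz)).
  set (Phi := fun x => cRInt (qker z n) 0 x).
  assert (Hd : forall x, cder Phi x (qker z n x)) by (intros x; now apply cder_cRInt).
  assert (H0 : Phi 0 = RtoC 0).
  { apply (cint_unique (qker z n) 0 0); [|apply cint_point].
    apply cRInt_correct, cintegrable_cont. intros u _; apply Hc. }
  assert (HI : cint (fun s => RtoC t * qker z n (s * t))%C 0 1 (Phi t)).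
  { eapply cint_eq.
    - apply (cint_derive (fun s => Phi (s * t))).
      + intros s _. apply (cder_comp Phi (fun s => s * t)); [apply Hd|].
        auto_derive; [exact I|ring].
      + intros s _. apply ccont_mult; [apply ccont_const|].
        apply (ccont_comp (qker z n) (fun s => s * t)); [apply Hc|].
        apply ex_derive_Rcontinuous. auto_derive. exact I.
    - cbv beta. rewrite Rmult_1_l, Rmult_0_l, H0. ring. }
  assert (Htp : t ^ (2 * S n) <> 0) by (apply pow_nonzero; lra).
  assert (Htc := RtoC_nz _ Htp).
  assert (HJ : cint (fun s : R => RtoC (s ^ (2 * S n - 1)) / (1 + (RtoC (s * t) / z) ^ 2))%C 0 1
     (/ RtoC (t ^ (2 * S n)) * Phi t)%C).
  { apply cint_ext with (fun s => / RtoC (t ^ (2 * S n)) * (RtoC t * qker z n (s * t)))%C; [|now apply cint_scal].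
    intros s _. rewrite qker_E by exact Hz. rewrite Rpow_mult_distr, RtoC_mult.
    replace (2 * S n)%nat with (S (2 * S n - 1)) at 1 by lia. rewrite <- (tech_pow_Rmult t), RtoC_mult.
    assert (Hp : RtoC (t ^ (2 * S n - 1)) <> RtoC 0) by (apply RtoC_nz, pow_nonzero; lra).
    assert (Ht0 : RtoC t <> RtoC 0) by (apply RtoC_nz; lra).
    unfold Cdiv at 1 3. set (y := (/ (1 + (RtoC (s * t) / z) ^ 2))%C). clearbody y.
    field. split; assumption. }
  rewrite (is_RInt_unique (V := C_R_CompleteNormedModule) _ _ _ _ (cint_is_RInt _ _ _ _ HJ)).
  fold (Phi t). field. exact Htc.
Qed.

Theorem theorem1p1 (A : R) (logG logGamma : C -> C) (N : nat)
  (hA : is_glaisher A)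
  (hG : is_log_branch (fun z => BarnesG (z + 1)%C) logG)
  (hGamma : is_log_branch (fun z => Gamma (z + 1)%C) logGamma)
  (hN : (1 <= N)%nat) :
  (forall z : C, z <> RtoC 0 -> Rabs (Carg z) < PI / 2 ->
    (exists I : C,
      is_Cint_0_infty
        (fun t : R =>
           (RInt (V := C_R_CompleteNormedModule)
              (fun s : R => RtoC (s ^ (2 * N - 1)) /
                            (1 + (RtoC (s * t) / z) ^ 2)) 0 1
            * RtoC (t ^ (2 * N) * ln (1 - exp (- 2 * PI * t))))%C) I /\
      barnes_remainder A logG logGamma N z
        = (/ z ^ (2 * N) * RtoC ((- 1) ^ (N + 1) / PI) * I)%C) /\
    (exists I : C,
      is_Cint_0_infty
        (fun t : R =>
           (RtoC (t ^ (2 * N - 1)) / (1 + (RtoC t / z) ^ 2)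
            * Li2 (RtoC (exp (- 2 * PI * t))))%C) I /\
      barnes_remainder A logG logGamma N z
        = (/ z ^ (2 * N) * RtoC ((- 1) ^ N / (2 * PI ^ 2)) * I)%C)) /\
  (forall z : C, z <> RtoC 0 -> Rabs (Carg z) < PI ->
    (exists I : C,
      is_Cint_0_infty
        (fun t : R =>
           (RtoC (bernoulli_poly (2 * N + 1) (frac_part t))
            / (RtoC t + z) ^ (2 * N))%C) I /\
      barnes_remainder A logG logGamma N z
        = (RtoC (- (1 / (INR (2 * N) * INR (2 * N + 1)))) * I)%C) /\
    (exists I : C,
      is_Cint_0_infty
        (fun t : R =>
           (RtoC (bernoulli_poly (2 * N + 2) (frac_part t)
                  - bernoulli (2 * N + 2))
            / (RtoC t + z) ^ (2 * N + 1))%C) I /\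
      barnes_remainder A logG logGamma N z
        = (RtoC (- (1 / (INR (2 * N + 1) * INR (2 * N + 2)))) * I)%C)).
Proof.
  destruct N as [|n]; [lia|]. clear hN. assert (Hpi := PI_RGT_0).
  split.
  - intros z Hz0 Hz1. assert (Hz := Carg_Re_pos z Hz0 Hz1).
    destruct (remainder_dilog A logG logGamma n z hA hG hGamma Hz) as [I [HI HR]].
    split.
    + assert (Hc : forall u, ccont (qker z n) u) by (apply (qker_subexp z n Hz)).
      set (Phi := fun x => cRInt (qker z n) 0 x).
      assert (Hd : forall x, cder Phi x (qker z n x)) by (intros x; now apply cder_cRInt).
      assert (H0 : Phi 0 = RtoC 0).
      { apply (cint_unique (qker z n) 0 0); [|apply cint_point].
        apply cRInt_correct, cintegrable_cont. intros u _; apply Hc. }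
      set (D := Cmod z ^ 2 * (/ Re z * / Re z)).
      assert (HD : 0 <= D).
      { assert (0 < / Re z) by now apply Rinv_0_lt_compat.
        apply Rmult_le_pos; [apply pow2_ge_0|nra]. }
      exists (- / RtoC (2 * PI) * I)%C. split.
      * apply is_Cint_of_cint_inf.
        apply cint_inf_ext with (fun t => Phi t * RtoC (lge t))%C.
        -- intros t Ht. rewrite RtoC_mult, Cmult_assoc, inner_integral by assumption.
           unfold lge. do 5 f_equal. ring.
        -- apply (log_integral Phi (qker z n) (2 * n + 1) D I HD (qker_subexp z n Hz) Hd H0); [|exact HI].
           apply (Phi_bound Phi (qker z n)); auto. intros t Ht. now apply qker_bound.
      * rewrite HR. replace (S n + 1)%nat with (S (S n)) by lia.
        assert (E : (-1) ^ S n / (2 * PI ^ 2) = (-1) ^ S (S n) / PI * - / (2 * PI)).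
        { rewrite <- (tech_pow_Rmult (-1) (S n)). field. lra. }
        rewrite E, RtoC_mult, RtoC_opp, RtoC_inv by lra. ring.
    + exists I. split; [|exact HR].
      apply is_Cint_of_cint_inf. apply cint_inf_ext with (2 := HI).
      intros t _. now rewrite qker_E, Li2_li2e by exact Hz.
  - intros z Hz0 Hz1. assert (Hz := Carg_slit z Hz0 Hz1).
    assert (HR := remainder_kint A logG logGamma n z hA hG hGamma Hz).
    assert (K1 := kval_correct (2 * S n + 1) (2 * S n) z Hz ltac:(lia)).
    assert (K2 := kval_correct (S (2 * S n + 1)) (S (2 * S n)) z Hz ltac:(lia)).
    assert (KP := kint_parts (2 * S n + 1) (2 * S n) z _ _ Hz ltac:(lia) ltac:(lia) K1 K2).
    assert (N0 := not_0_INR (2 * S n) ltac:(lia)). assert (N1 := not_0_INR (2 * S n + 1) ltac:(lia)).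
    assert (N2 := not_0_INR (2 * S n + 2) ltac:(lia)).
    split.
    + exists (kval (2 * S n + 1) (2 * S n) z). split; [apply is_Cint_of_cint_inf, K1|].
      rewrite HR, RtoC_opp, RtoC_div, RtoC_mult
        by (apply Rmult_integral_contrapositive_currified; assumption).
      field. split; apply RtoC_nz; assumption.
    + replace (S (2 * S n + 1)) with (2 * S n + 2)%nat in * by lia.
      replace (S (2 * S n)) with (2 * S n + 1)%nat in * by lia.
      set (b := bernoulli (2 * S n + 2)) in *.
      exists (kval (2 * S n + 2) (2 * S n + 1) z - RtoC b * / (RtoC (INR (2 * S n)) * z ^ (2 * S n)))%C. split.
      * apply is_Cint_of_cint_inf.
        apply cint_inf_ext with (fun t => RtoC (bper (2 * S n + 2) t) / (RtoC t + z) ^ (2 * S n + 1)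
           - RtoC b * / (RtoC t + z) ^ (2 * S n + 1))%C.
        -- intros t _. unfold bper. rewrite RtoC_minus. unfold Cdiv. ring.
        -- apply cint_inf_minus; [exact K2|]. apply cint_inf_scal.
           replace (2 * S n + 1)%nat with (S (2 * S n)) by lia. apply kint_0; [exact Hz|lia].
      * rewrite HR, KP, RtoC_opp, RtoC_div, RtoC_mult
          by (apply Rmult_integral_contrapositive_currified; assumption).
        assert (Hp := Cpow_nz z (2 * S n) Hz0).
        assert (M0 := RtoC_nz _ N0). assert (M1 := RtoC_nz _ N1). assert (M2 := RtoC_nz _ N2).
        field. repeat split; assumption.
Qed.
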